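(* Let $V$ be a commutative valuation domain with quotient field $F$, $K/F$ a finite Galois extension with group $G$ which is tamely ramified and defectless, $S$ the integral closure of $V$ in $K$, assume $S$ is finitely generated as a $V$-module, and let $f:G\times G\to S\setminus\{0\}$ be a normalized $2$-cocycle. Then the following are equivalent: (1) $A_f$ is semihereditary; (2) for each maximal ideal $M$ of $S$, $G^T(S_M\mid F)\subseteq H_M$ and there exists a set of right coset representatives $\sigma_1,\ldots,\sigma_m$ of $G^T(S_M\mid F)$ in $G$ with $f(\sigma_i,\sigma_i^{-1})\notin M^2$ for all $i$; (3) for each maximal ideal $M$ of $S$, $A_{f_{(M)}}$ is semihereditary and there exists a set of right coset representatives $\sigma_1,\ldots,\sigma_m$ of $G^T(S_M\mid F)$ in $G$ with $f(\sigma_i,\sigma_i^{-1})\notin M^2$ for all $i$.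
   Context: $V$ has arbitrary Krull dimension. A normalized 2-cocycle satisfies $\sigma(f(\tau,\gamma))f(\sigma,\tau\gamma)=f(\sigma,\tau)f(\sigma\tau,\gamma)$, $f(1,\sigma)=f(\sigma,1)=1$; values need not be units. $A_f=\bigoplus_{\sigma\in G}Sx_\sigma$ (free left $S$-module) with $(sx_\sigma)(tx_\tau)=s\,\sigma(t)f(\sigma,\tau)x_{\sigma\tau}$. Semihereditary: finitely generated one-sided ideals projective. For a maximal ideal $M$ of $S$: $G^Z=\{\sigma\in G:\sigma(S_M)\subseteq S_M\}$; $H_M=\{\sigma\in G^Z: f(\sigma,\sigma^{-1})\notin M\}$; $G^T=G^T(S_M\mid F)=\{\sigma\in G:\sigma(x)-x\in J(S_M)\ \forall x\in S_M\}$ with fixed field $K^T$; $U=K^T\cap S_M$, $T$ the integral closure of $U$ in $K$; $f_{(M)}$ is the restriction of $f$ to $G^T\times G^T$ and $A_{f_{(M)}}=\sum_{\sigma\in G^T}Tx_\sigma$ with the same multiplication rule. Tamely ramified and defectless: $e=[\Gamma_{S_M}:\Gamma_V]$, $r$ = number of maximal ideals of $S$, $[K:F]=e[\overline{S_M}:\overline V]r$, $\mathrm{char}\,\overline V\nmid e$, $\overline{S_M}/\overline V$ separable. *)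

(* Defs.v *)
From HB Require Import structures.
From mathcomp Require Import all_boot all_order all_algebra all_fingroup all_field.
Set Implicit Arguments. Unset Strict Implicit. Unset Printing Implicit Defensive.
Import GRing.Theory.
Local Open Scope ring_scope.

Section Defs.
Variable (R : fieldType).

Definition subring (A : R -> Prop) : Prop :=
  [/\ A 0, A 1, (forall x y, A x -> A y -> A (x - y)) &
      (forall x y, A x -> A y -> A (x * y))].

Definition valuation_domain (V : R -> Prop) : Prop :=
  subring V /\ (forall x, x != 0 -> V x \/ V x^-1).

Definition ideal (A I : R -> Prop) : Prop :=
  [/\ forall x, I x -> A x, I 0, (forall x y, I x -> I y -> I (x - y)) &
      (forall a x, A a -> I x -> I (a * x))].

Definition max_ideal (A M : R -> Prop) : Prop :=
  [/\ ideal A M, ~ M 1 &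
      forall N, ideal A N -> (forall x, M x -> N x) ->
                (forall x, N x <-> M x) \/ N 1].

Definition ideal_sq (M : R -> Prop) (x : R) : Prop :=
  exists n (a b : 'I_n -> R), (forall i, M (a i)) /\ (forall i, M (b i)) /\
    x = \sum_(i < n) a i * b i.

Definition localize (A M : R -> Prop) (x : R) : Prop :=
  exists s t, [/\ A s, A t, ~ M t & x = s / t].

Definition unit_of (A : R -> Prop) (u : R) : Prop := [/\ A u, u != 0 & A u^-1].

Definition jacobson (A : R -> Prop) (x : R) : Prop :=
  A x /\ forall y, A y -> unit_of A (1 - x * y).

Definition integral_over (A : R -> Prop) (x : R) : Prop :=
  exists p : {poly R}, [/\ p \is monic, (forall i, A p`_i) & root p x].

End Defs.

Section Rings.
Variables (T : zmodType) (P : T -> Prop) (mul : T -> T -> T).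

Definition lspan n (b : 'I_n -> T) (x : T) : Prop :=
  exists c : 'I_n -> T, (forall i, P (c i)) /\ x = \sum_(i < n) mul (c i) (b i).
Definition rspan n (b : 'I_n -> T) (x : T) : Prop :=
  exists c : 'I_n -> T, (forall i, P (c i)) /\ x = \sum_(i < n) mul (b i) (c i).

(* a (finitely generated) left submodule X is projective: it is a direct summand
   of a free module P^m, i.e. there are P-linear maps p : P^m -> X and
   s : X -> P^m with p \o s = id *)
Definition lprojective (X : T -> Prop) : Prop :=
  exists m (p : ('I_m -> T) -> T) (s : T -> 'I_m -> T),
  [/\ (forall u, (forall i, P (u i)) -> X (p u)),
      (forall x, X x -> forall i, P (s x i)),
      (forall a u v, P a -> (forall i, P (u i)) -> (forall i, P (v i)) ->
         p (fun i => mul a (u i) + v i) = mul a (p u) + p v),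
      (forall a x y, P a -> X x -> X y ->
         forall i, s (mul a x + y) i = mul a (s x i) + s y i) &
      (forall x, X x -> p (s x) = x)].

Definition rprojective (X : T -> Prop) : Prop :=
  exists m (p : ('I_m -> T) -> T) (s : T -> 'I_m -> T),
  [/\ (forall u, (forall i, P (u i)) -> X (p u)),
      (forall x, X x -> forall i, P (s x i)),
      (forall a u v, P a -> (forall i, P (u i)) -> (forall i, P (v i)) ->
         p (fun i => mul (u i) a + v i) = mul (p u) a + p v),
      (forall a x y, P a -> X x -> X y ->
         forall i, s (mul x a + y) i = mul (s x i) a + s y i) &
      (forall x, X x -> p (s x) = x)].

Definition semihereditary : Prop :=
  forall n (b : 'I_n -> T), (forall i, P (b i)) ->
    lprojective (lspan b) /\ rprojective (rspan b).
End Rings.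

Section Galois.
Variables (F : fieldType) (K : splittingFieldType F).
Local Notation G := (gal_of {:K}).

(* composition sigma o tau (note: in mathcomp (x * y)%g a = y (x a)) *)
Definition gcomp (s t : G) : G := (t * s)%g.

Definition inK (V : F -> Prop) (x : K) : Prop := exists v, V v /\ x = v%:A.

(* crossed product elements: sum_sigma a(sigma) x_sigma  <->  a : {ffun G -> K} *)
Definition cp_mul (f : G -> G -> K) (a b : {ffun G -> K}) : {ffun G -> K} :=
  [ffun r => \sum_(s : G) \sum_(t : G)
     (if gcomp s t == r then a s * s (b t) * f s t else 0)].

Definition cp_set (C : K -> Prop) (H : G -> Prop) (a : {ffun G -> K}) : Prop :=
  forall s, (H s -> C (a s)) /\ (~ H s -> a s = 0).

Definition normalized_cocycle (f : G -> G -> K) : Prop :=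
  (forall s t g : G, s (f t g) * f s (gcomp t g) = f s t * f (gcomp s t) g) /\
  (forall s : G, f 1%g s = 1 /\ f s 1%g = 1).

Definition GZ (S M : K -> Prop) (s : G) : Prop :=
  forall x, localize S M x -> localize S M (s x).
Definition HM (S M : K -> Prop) (f : G -> G -> K) (s : G) : Prop :=
  GZ S M s /\ ~ M (f s s^-1%g).
Definition GT (S M : K -> Prop) (s : G) : Prop :=
  forall x, localize S M x -> jacobson (localize S M) (s x - x).
Definition UM (S M : K -> Prop) (x : K) : Prop :=
  localize S M x /\ forall s, GT S M s -> s x = x.
Definition TM (S M : K -> Prop) : K -> Prop := integral_over (UM S M).

Definition right_coset_reps (H : G -> Prop) (r : seq G) : Prop :=
  forall g : G, exists i, (i < size r)%N /\ H (gcomp g (nth 1%g r i)^-1%g) /\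
    forall j, (j < size r)%N -> H (gcomp g (nth 1%g r j)^-1%g) -> j = i.

(* e = [Gamma_{S_M} : Gamma_V]: number of classes of K^* modulo F^* U(S_M) *)
Definition ram_index (V : F -> Prop) (SM : K -> Prop) (e : nat) : Prop :=
  exists c : 'I_e -> K,
  [/\ forall i, c i != 0,
      (forall x, x != 0 -> exists i v u,
          [/\ v != 0, unit_of SM u & x = c i * v%:A * u]) &
      (forall i j v u, v != 0 -> unit_of SM u -> c i = c j * v%:A * u -> i = j)].

(* f = [S_M / J(S_M) : V / J(V)] : there is a family in S_M whose residues form
   a basis of the residue field of S_M over that of V *)
Definition res_degree (V : F -> Prop) (SM : K -> Prop) (d : nat) : Prop :=
  exists b : 'I_d -> K,
  [/\ forall i, SM (b i),
      (forall v : 'I_d -> F, (forall i, V (v i)) ->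
          jacobson SM (\sum_i (v i)%:A * b i) -> forall i, jacobson V (v i)) &
      (forall y, SM y -> exists v : 'I_d -> F, (forall i, V (v i)) /\
          jacobson SM (y - \sum_i (v i)%:A * b i))].

(* the residue field extension is separable: every residue class is a root of
   the reduction of a monic polynomial over V that is separable over V/J(V)
   (i.e. coprime to its derivative modulo J(V)) *)
Definition res_separable (V : F -> Prop) (SM : K -> Prop) : Prop :=
  forall y, SM y -> exists p a b : {poly F},
  [/\ p \is monic, (forall i, V p`_i), (forall i, V a`_i /\ V b`_i),
      (forall i, jacobson V (a * p + b * p^`() - 1)`_i) &
      jacobson SM (map_poly (in_alg K) p).[y]].

Definition res_char_ndvd (V : F -> Prop) (e : nat) : Prop :=
  forall p, prime p -> jacobson V (p%:R) -> ~~ (p %| e)%N.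

Definition num_max_ideals (S : K -> Prop) (r : nat) : Prop :=
  exists Ms : 'I_r -> (K -> Prop),
  [/\ forall i, max_ideal S (Ms i),
      (forall i j, (forall x, Ms i x <-> Ms j x) -> i = j) &
      (forall M, max_ideal S M -> exists i, forall x, M x <-> Ms i x)].

Definition tame_defectless (V : F -> Prop) (S : K -> Prop) : Prop :=
  exists r, num_max_ideals S r /\
  forall M, max_ideal S M -> exists e d,
  [/\ ram_index V (localize S M) e, res_degree V (localize S M) d,
      \dim {:K} = (e * d * r)%N, res_char_ndvd V e &
      res_separable V (localize S M)].

Definition fin_gen_module (V : F -> Prop) (S : K -> Prop) : Prop :=
  exists n (g : 'I_n -> K), forall x, S x <->
    exists v : 'I_n -> F, (forall i, V (v i)) /\ x = \sum_i (v i)%:A * g i.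
End Galois.

(* Main.v *)
(** Write g_s = f(s, s^-1). Both sides of the theorem are equivalent to: g_s is not in M^2
    for every s in G and every maximal ideal M of S.

    Necessity: for g_s in M^2 one finds a in M strictly between 1 and g_s in the valuation of
    S_M, and the left ideal A a + A x_{s^-1} is not projective, as 1 is not in X^{-1} X.

    Sufficiency: let X be a finitely generated left ideal, X' the sum of the x_s^{-1} X, and p an
    S-linear map from X' to X which is the identity on X modulo J(S) X'. Then
    Phi = sum_s x_s (t p) x_s^{-1} is an A-linear endomorphism of X that factors through a free
    module. At each M the lattices x_s^{-1} X_{s M} form a chain between X_M and M^{-1} X_M
    because g_s is not in M^2, and Phi acts on the graded pieces of this chain by traces of t; as
    the ramification is tame, t can be chosen such that these are units, so Phi is bijective.
    Right ideals are left ideals for the opposite cocycle st(f(t^-1, s^-1)).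

    Tameness gives |G^T| = e, a unit of S_M. If g_s in M \ M^2 for some s in G^T, then
    g_s = pi generates M S_M, and a product of values of f is fixed by s and equals a unit times
    pi^j with 0 < j < |s|; so s^j is a nontrivial element acting trivially on M/M^2, which is
    impossible because S is finitely generated over V. Hence G^T is contained in H_M. Finally the
    integral closure T of U is S_M, so that (3) is the same statement for S_M and G^T. *)
Require Import Defs.
From HB Require Import structures.
From mathcomp Require Import all_boot all_order all_algebra all_fingroup all_field.
From mathcomp Require Import cyclic boolp ring.
From mathcomp Require classical_sets.
Set Implicit Arguments. Unset Strict Implicit. Unset Printing Implicit Defensive.
Import GRing.Theory.
Local Open Scope ring_scope.

(** * Subrings, maximal ideals and residue fields *)

(** The Krull dimension is arbitrary: S need not be noetherian, M need not be principal, and no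
    discrete valuation is at hand. Two facts replace it. S is a semilocal Bezout domain, so its
    finitely generated torsion-free modules are free; and an element of M outside M^2 generates M
    S_M. The chain property rests on a cocycle identity: f(s, t) divides g_s with a conjugated value
    of f as cofactor, and both factors cannot be nonunits at M. The map p exists because the
    inclusion of X in X' has a generalized inverse modulo each M, and the finitely many inverses are
    glued by the Chinese remainder theorem. The trace of t at M runs only over the s with g_s a unit
    at M. These s need not form a group and they move M, so t is prescribed at one ideal out of each
    class of ideals that they link. The lattice argument is stated for a ring C and a group H
    because it serves twice: for S with G, and for S_M with G^T. In higher rank a nonzero element
    can be divisible by all powers of pi, so divisibility alone does not show that wild elements are
    trivial; there the finite generation of S over V is needed. *)

Section Subring.
Variables (R : fieldType) (C : R -> Prop) (hC : subring C).

Lemma subring0 : C 0. Proof. by case: hC. Qed.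
Lemma subring1 : C 1. Proof. by case: hC. Qed.
Lemma subringB x y : C x -> C y -> C (x - y). Proof. by case: hC => _ _ h _; exact: h. Qed.
Lemma subringM x y : C x -> C y -> C (x * y). Proof. by case: hC => _ _ _; exact. Qed.
Lemma subringN x : C x -> C (- x).
Proof. by move=> Cx; rewrite -sub0r; apply: subringB => //; exact: subring0. Qed.
Lemma subringD x y : C x -> C y -> C (x + y).
Proof. by move=> Cx Cy; rewrite -[y]opprK; apply: subringB => //; exact: subringN. Qed.
Lemma subring_sum I (r : seq I) (P : pred I) (F : I -> R) :
  (forall i, P i -> C (F i)) -> C (\sum_(i <- r | P i) F i).
Proof. by move=> h; elim/big_ind: _ => //; [exact: subring0 | exact: subringD]. Qed.
Lemma subring_prod I (r : seq I) (P : pred I) (F : I -> R) :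
  (forall i, P i -> C (F i)) -> C (\prod_(i <- r | P i) F i).
Proof. by move=> h; elim/big_ind: _ => //; [exact: subring1 | exact: subringM]. Qed.
Lemma subringX x n : C x -> C (x ^+ n).
Proof. by move=> Cx; elim: n => [|n IH]; rewrite ?expr0 ?exprS; [exact: subring1 | exact: subringM]. Qed.
Lemma subring_nat n : C n%:R.
Proof. by elim: n => [|n IH]; [exact: subring0 | rewrite -natr1; apply: subringD => //; exact: subring1]. Qed.
Lemma subring_sign (b : bool) : C ((-1) ^+ b).
Proof. by case: b; rewrite ?expr1 ?expr0; [apply: subringN|]; exact: subring1. Qed.

Section Ideal.
Variables (I : R -> Prop) (hI : ideal C I).
Lemma ideal_sub x : I x -> C x. Proof. by case: hI => h _ _ _; exact: h. Qed.
Lemma ideal0 : I 0. Proof. by case: hI. Qed.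
Lemma idealB x y : I x -> I y -> I (x - y). Proof. by case: hI => _ _ h _; exact: h. Qed.
Lemma idealMl a x : C a -> I x -> I (a * x). Proof. by case: hI => _ _ _; exact. Qed.
Lemma idealMr a x : C a -> I x -> I (x * a). Proof. by rewrite mulrC; exact: idealMl. Qed.
Lemma idealN x : I x -> I (- x).
Proof. by move=> Cx; rewrite -sub0r; apply: idealB => //; exact: ideal0. Qed.
Lemma idealD x y : I x -> I y -> I (x + y).
Proof. by move=> Cx Cy; rewrite -[y]opprK; apply: idealB => //; exact: idealN. Qed.
Lemma ideal_sum J (r : seq J) (P : pred J) (F : J -> R) :
  (forall i, P i -> I (F i)) -> I (\sum_(i <- r | P i) F i).
Proof. by move=> h; elim/big_ind: _ => //; [exact: ideal0 | exact: idealD]. Qed.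
Lemma idealBl x y : I (x - y) -> I x -> I y.
Proof. by move=> h1 h2; rewrite -[y](subKr x); apply: idealB. Qed.
End Ideal.

Section MaxIdeal.
Variables (M : R -> Prop) (hM : max_ideal C M).
Lemma max_ideal_ideal : ideal C M. Proof. by case: hM. Qed.
Let hI := max_ideal_ideal.
Lemma max_ideal1 : ~ M 1. Proof. by case: hM. Qed.
Lemma max_ideal_inv x : C x -> ~ M x -> exists2 y, C y & M (x * y - 1).
Proof.
move=> Cx nMx.
pose N z := exists m y, [/\ M m, C y & z = m + x * y].
have MN z : M z -> N z.
  by move=> Mz; exists z, 0; split=> //; [exact: subring0 | rewrite mulr0 addr0].
have hN : ideal C N.
  split.
  - move=> z [m [y [Mm Cy ->]]]; apply: subringD; [exact: (ideal_sub hI) | exact: subringM].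
  - by apply: MN; exact: ideal0 hI.
  - move=> z1 z2 [m1 [y1 [Mm1 Cy1 ->]]] [m2 [y2 [Mm2 Cy2 ->]]].
    exists (m1 - m2), (y1 - y2); split; [exact: idealB|exact: subringB|].
    by rewrite mulrBr opprD addrACA.
  - move=> a z Ca [m [y [Mm Cy ->]]]; exists (a * m), (a * y).
    by split; [exact: idealMl|exact: subringM|rewrite mulrDr mulrCA].
case: hM => _ _ /(_ N hN MN) [h|[m [y [Mm Cy e]]]].
  by case: nMx; apply/h; exists 0, 1; split; [exact: ideal0 hI|exact: subring1|rewrite add0r mulr1].
exists y => //; rewrite e opprD addrCA subrr addr0; exact: idealN.
Qed.
Lemma max_ideal_prime x y : C x -> C y -> M (x * y) -> M x \/ M y.
Proof.
move=> Cx Cy Mxy; case: (pselect (M x)) => [|nMx]; [by left | right].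
have [z Cz h] := max_ideal_inv Cx nMx.
have -> : y = z * (x * y) - (x * z - 1) * y.
  by rewrite mulrBl mul1r opprB addrCA mulrA [z * x]mulrC subrr addr0.
apply: idealB => //; [exact: idealMl | exact: idealMr].
Qed.
Lemma max_ideal_nM x y : C x -> C y -> ~ M x -> ~ M y -> ~ M (x * y).
Proof. by move=> Cx Cy nx ny /(max_ideal_prime Cx Cy) []. Qed.
Lemma max_ideal_neq0 x : ~ M x -> x != 0.
Proof. by move=> nMx; apply/eqP => x0; apply: nMx; rewrite x0; exact: ideal0 hI. Qed.
Lemma max_ideal_prod I (r : seq I) (P : pred I) (F : I -> R) :
  (forall i, P i -> C (F i) /\ ~ M (F i)) -> ~ M (\prod_(i <- r | P i) F i).
Proof.
move=> h; suff [] : C (\prod_(i <- r | P i) F i) /\ ~ M (\prod_(i <- r | P i) F i) by [].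
elim/big_ind: _ => //; first by split; [exact: subring1 | exact: max_ideal1].
by move=> x y [? ?] [? ?]; split; [exact: subringM | exact: max_ideal_nM].
Qed.
End MaxIdeal.
End Subring.

(* The elements of the residue field are chosen representatives of the classes modulo M. *)
Section ResidueField.
Variables (R : fieldType) (C M : R -> Prop) (hC : subring C) (hM : max_ideal C M).
Let hI := max_ideal_ideal hM.

Let inclass (x : R) : pred R := fun y => `[< C y /\ M (x - y) >].
(** The value of [choose] depends only on the extension of the predicate, so congruent elements
    receive the same representative and no quotient type is needed. *)
Definition residue_rep (x : R) : R := choose (inclass x) x.

Let inclassxx x : C x -> inclass x x.
Proof. by move=> Cx; apply/asboolP; split=> //; rewrite subrr; exact: ideal0 hI. Qed.
Let rep_in x : C x -> inclass x (residue_rep x).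
Proof. by move=> Cx; apply: chooseP; exact: inclassxx. Qed.
Let repC x : C x -> C (residue_rep x).
Proof. by move=> /rep_in /asboolP []. Qed.
Let repM x : C x -> M (x - residue_rep x).
Proof. by move=> /rep_in /asboolP []. Qed.
Let rep_eq x y : C x -> C y -> M (x - y) -> residue_rep x = residue_rep y.
Proof.
move=> Cx Cy Mxy.
have e : inclass x =1 inclass y.
  move=> z; apply/asbool_equiv_eq; split=> -[Cz Mz]; split=> //.
    by rewrite -(subrK x y) -addrA -(opprB x y) ; apply: (idealD hI) => //; exact: (idealN hI).
  by rewrite -(subrK y x) -addrA; apply: (idealD hI).
rewrite /residue_rep (eq_choose e); apply: choose_id; last exact: inclassxx.
by rewrite -e inclassxx.
Qed.
Let rep_idem x : C x -> residue_rep (residue_rep x) = residue_rep x.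
Proof.
move=> Cx; apply: rep_eq => //; first exact: repC.
by rewrite -opprB; apply: (idealN hI); exact: repM.
Qed.

Definition is_rep (x : R) : bool := `[< C x /\ residue_rep x = x >].
Definition residue_type := {x : R | is_rep x}.
HB.instance Definition _ := [Choice of residue_type by <:].

Definition residue_map (x : R) : residue_type :=
  match pselect (C x) with
  | left Cx => exist _ (residue_rep x) (asboolT (conj (repC Cx) (rep_idem Cx)))
  | right _ => exist _ (residue_rep 0)
       (asboolT (conj (repC (subring0 hC)) (rep_idem (subring0 hC))))
  end.
Let rm_val x : C x -> val (residue_map x) = residue_rep x.
Proof. by rewrite /residue_map; case: pselect. Qed.
Let valC (z : residue_type) : C (val z).
Proof. by case: z => x /= /asboolP []. Qed.
Let valK (z : residue_type) : residue_map (val z) = z.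
Proof. by apply: val_inj; rewrite rm_val //; case: z => x /= /asboolP []. Qed.
Let rm_eq x y : C x -> C y -> residue_map x = residue_map y <-> M (x - y).
Proof.
move=> Cx Cy; split=> [|h].
  move/(congr1 val); rewrite !rm_val // => e.
  rewrite -(subrK (residue_rep x) x) -addrA {2}e -(opprB y).
  by apply: (idealB hI); apply: repM.
by apply: val_inj; rewrite !rm_val //; exact: rep_eq.
Qed.
Let vM x : C x -> M (val (residue_map x) - x).
Proof. by move=> Cx; rewrite rm_val // -opprB; apply: (idealN hI); exact: repM. Qed.

Let radd (a b : residue_type) := residue_map (val a + val b).
Let ropp (a : residue_type) := residue_map (- val a).
Let rmul (a b : residue_type) := residue_map (val a * val b).
Let rinv (a : residue_type) : residue_type :=
  match pselect (exists b, rmul b a = residue_map 1) with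
  | left h => if a == residue_map 0 then a else projT1 (cid h) | right _ => a end.
Let rmD x y : C x -> C y -> radd (residue_map x) (residue_map y) = residue_map (x + y).
Proof.
move=> Cx Cy; apply/rm_eq; rewrite ?addrACA ?opprD; try by apply: (subringD hC).
by rewrite addrACA; apply: (idealD hI); apply: vM.
Qed.
Let rmN x : C x -> ropp (residue_map x) = residue_map (- x).
Proof.
move=> Cx; apply/rm_eq; try by apply: (subringN hC).
by rewrite -opprD; apply: (idealN hI); exact: vM.
Qed.
Let rmM x y : C x -> C y -> rmul (residue_map x) (residue_map y) = residue_map (x * y).
Proof.
move=> Cx Cy; apply/rm_eq; try by apply: (subringM hC).
rewrite -(subrK (x * val (residue_map y)) (_ * _)) -mulrBl -addrA -mulrBr.
apply: (idealD hI); [apply: (idealMr hI) | apply: (idealMl hI)] => //; exact: vM.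
Qed.
Let C0 := subring0 hC.
Let C1 := subring1 hC.
Let radd_asso : associative radd.
Proof.
move=> a b c; rewrite -[a]valK -[b]valK -[c]valK !rmD ?addrA //;
  by do ?[exact: valC | apply: (subringD hC)].
Qed.
Let radd_comm : commutative radd.
Proof. by move=> a b; rewrite /radd addrC. Qed.
Let radd0 : left_id (residue_map 0) radd.
Proof. by move=> a; rewrite -[a]valK rmD ?add0r //; exact: valC. Qed.
Let raddN : left_inverse (residue_map 0) ropp radd.
Proof. by move=> a; rewrite -[a]valK rmN ?rmD ?addNr //; do ?[exact: valC | apply: (subringN hC)]. Qed.
HB.instance Definition _ := GRing.isZmodule.Build residue_type radd_asso radd_comm radd0 raddN.
Let rmul_asso : associative rmul.
Proof. move=> a b c; rewrite -[a]valK -[b]valK -[c]valK !rmM ?mulrA //;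
  by do ?[exact: valC | apply: (subringM hC)]. Qed.
Let rmul_comm : commutative rmul.
Proof. by move=> a b; rewrite /rmul mulrC. Qed.
Let rmul1 : left_id (residue_map 1) rmul.
Proof. by move=> a; rewrite -[a]valK rmM ?mul1r //; exact: valC. Qed.
Let rmulDl : left_distributive rmul radd.
Proof.
move=> a b c; rewrite -[a]valK -[b]valK -[c]valK !(rmD, rmM) ?mulrDl //;
 by do ?[exact: valC | apply: (subringD hC) | apply: (subringM hC)].
Qed.
Let rm10 : residue_map 1 != residue_map 0.
Proof. by apply/eqP => /rm_eq => /(_ C1 C0); rewrite subr0; exact: max_ideal1 hM. Qed.
HB.instance Definition _ := GRing.Zmodule_isComNzRing.Build residue_type
  rmul_asso rmul_comm rmul1 rmulDl rm10.
Let rmulV (a : residue_type) : a != 0 -> rinv a * a = 1.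
Proof.
move=> a0.
have nM : ~ M (val a).
  move=> Ma; case/eqP: a0; rewrite -[a]valK.
  by apply/(rm_eq (valC a) C0); rewrite subr0.
have [y Cy h] := max_ideal_inv hC hM (valC a) nM.
rewrite /rinv; case: pselect => [ex|[]]; first by rewrite (negPf a0); case: cid.
exists (residue_map y); rewrite -[a]valK (rmM Cy (valC a)).
by apply/(rm_eq (subringM hC Cy (valC a)) C1); rewrite mulrC.
Qed.
Let rinv0 : rinv 0 = 0.
Proof. by rewrite /rinv; case: pselect => // h; rewrite eqxx. Qed.
HB.instance Definition _ := GRing.ComNzRing_isField.Build residue_type rmulV rinv0.

(** The existential form hides the concrete type. The map [phi] is total on [R] but a morphism only
    on [C], so each of its laws carries membership hypotheses. *)
Lemma residue_field : exists (L : fieldType) (phi : R -> L),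
  [/\ phi 1 = 1,
      (forall x y, C x -> C y -> phi (x + y) = phi x + phi y),
      (forall x y, C x -> C y -> phi (x * y) = phi x * phi y),
      (forall z, exists2 x, C x & phi x = z) &
      (forall x, C x -> (phi x = 0 <-> M x))].
Proof.
exists residue_type, residue_map; split=> //.
- by move=> x y Cx Cy; rewrite -rmD.
- by move=> x y Cx Cy; rewrite -rmM.
- by move=> z; exists (val z); [exact: valC | exact: valK].
- by move=> x Cx; have := rm_eq Cx C0; rewrite subr0.
Qed.
End ResidueField.

(** * Integral closure of a valuation domain *)

Section SubringType.
Variables (R : fieldType) (C : R -> Prop) (hC : subring C).
Definition in_subring : {pred R} := fun x => `[< C x >].
Lemma in_subring_closed : subring_closed in_subring.
Proof.
split; first by apply/asboolP; exact: subring1.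
  by move=> x y /asboolP Cx /asboolP Cy; apply/asboolP; exact: subringB.
by move=> x y /asboolP Cx /asboolP Cy; apply/asboolP; exact: subringM.
Qed.
HB.instance Definition _ := GRing.isSubringClosed.Build R in_subring in_subring_closed.
Definition subring_type := {x : R | in_subring x}.
HB.instance Definition _ := SubChoice.on subring_type.
HB.instance Definition _ := [SubChoice_isSubComNzRing of subring_type by <:].
(** Turns a subring given by a predicate into a ring with an embedding, which is the form required
    by the library's [integralOver]. *)
Lemma subring_typeP : exists (A : comNzRingType) (iota : {rmorphism A -> R}),
  injective iota /\ forall x, C x <-> exists a, x = iota a.
Proof.
exists subring_type, (val : {rmorphism subring_type -> R}); split; first exact: val_inj.
move=> x; split=> [Cx|[a ->]]; last exact/asboolP/(valP a).
by exists (exist _ x (asboolT Cx)).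
Qed.
End SubringType.

Section Integral.
Variables (R : fieldType) (C : R -> Prop) (hC : subring C).

Lemma integral_over_integralOver (A : comNzRingType) (iota : {rmorphism A -> R}) :
  injective iota -> (forall x, C x <-> exists a, x = iota a) ->
  forall x, integral_over C x <-> integralOver iota x.
Proof.
move=> iota_inj hA x; split=> [[p [pm pC px]]|[p pm px]]; last first.
  exists (map_poly iota p); split=> //; first exact: monic_map.
  by move=> i; apply/hA; exists p`_i; rewrite coef_map.
apply: integral_root_monic pm px _; apply/integral_poly => i.
by have /hA [a ->] := pC i; exact: integral_id.
Qed.

Lemma integral_over_subring : subring (integral_over C).
Proof.
have [A [iota [inj hA]]] := subring_typeP hC.
have e := integral_over_integralOver inj hA.
split.
- by apply/e; exact: integral0.
- by apply/e; exact: integral1.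
- by move=> x y /e hx /e hy; apply/e; exact: integral_sub.
- by move=> x y /e hx /e hy; apply/e; exact: integral_mul.
Qed.

Lemma integral_over_id x : C x -> integral_over C x.
Proof.
have [A [iota [inj hA]]] := subring_typeP hC.
by move/hA => [a ->]; apply/(integral_over_integralOver inj hA); exact: integral_id.
Qed.

Lemma integral_over_trans (p : {poly R}) x :
  p \is monic -> (forall i, integral_over C p`_i) -> root p x -> integral_over C x.
Proof.
have [A [iota [inj hA]]] := subring_typeP hC.
have e := integral_over_integralOver inj hA.
move=> pm pC px; apply/e; apply: integral_root_monic pm px _.
by apply/integral_poly => i; apply/e.
Qed.

(** Dividing a monic equation of degree n + 1 by x^n writes x as a polynomial in x^-1 with
    coefficients in [C]. This is why valuation rings are integrally closed. *)
Lemma integral_over_inv x : integral_over C x -> C x^-1 -> C x.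
Proof.
move=> [p [pm pC px]] Cxi.
have [->|x0] := eqVneq x 0; first exact: subring0.
have sp : (1 < size p)%N by rewrite (root_size_gt1 _ px) ?monic_neq0.
have := px; rewrite /root horner_coef.
case e : (size p) sp => [//|[//|n]] _.
rewrite big_ord_recr /=.
have -> : p`_n.+1 = 1 by move/monicP: pm; rewrite /lead_coef e.
rewrite mul1r addr_eq0 => /eqP h.
have -> : x = - \sum_(i < n.+1) p`_i * (x^-1) ^+ (n - i).
  apply: (mulIf (expf_neq0 n x0)); rewrite -exprS -[LHS]opprK -h mulNr mulr_suml.
  congr (- _); apply: eq_bigr => i _.
  by rewrite -mulrA exprVn expfB_cond ?(negPf x0) ?leq_ord // invf_div divfK // expf_neq0.
apply: (subringN hC); apply: (subring_sum hC) => i _.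
by apply: (subringM hC); [exact: pC | exact: subringX].
Qed.

(** Downward induction on j, for a polynomial that need not be monic. The Horner sums satisfy h_j =
    x h_(j+1) + p_j, which makes y = h_j integral. Multiplying p(x) = 0 by y^(j-1) turns it into a
    monic equation of degree j for x y, whose coefficients involve only the p_k and y. *)
Lemma integral_horner_tail (p : {poly R}) x (j : nat) :
  (forall i, C p`_i) -> root p x ->
  integral_over C (drop_poly j p).[x] /\ integral_over C (x * (drop_poly j p).[x]).
Proof.
move=> pC px; have hS := integral_over_subring.
have hrec i : (drop_poly i p).[x] = x * (drop_poly i.+1 p).[x] + p`_i.
  have -> : drop_poly i p = drop_poly i.+1 p * 'X + (p`_i)%:P.
    by apply/polyP => -[|k]; rewrite coefD coefMX coefC !coef_drop_poly /= ?add0r ?addr0 ?addnS ?addSn.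
  by rewrite hornerD hornerM hornerX hornerC mulrC.
have base i : (size p <= i)%N -> integral_over C (drop_poly i p).[x] /\
    integral_over C (x * (drop_poly i p).[x]).
  by move=> h; rewrite drop_poly_eq0 // horner0 mulr0; split; exact: subring0.
have step i : integral_over C (x * (drop_poly i.+1 p).[x]) ->
    integral_over C (drop_poly i p).[x] /\ integral_over C (x * (drop_poly i p).[x]).
  move=> h; set y := (drop_poly i p).[x].
  have Sy : integral_over C y.
    by rewrite /y hrec; apply: subringD => //; exact: integral_over_id.
  split=> //.
  case: i => [|i] in h y Sy *.
    by rewrite /y drop_poly0l (eqP px) mulr0; exact: subring0.
  apply: (@integral_over_trans ('X^(i.+1) + \poly_(k < i.+1) (p`_k * y ^+ (i - k)))).
  - by rewrite monicE lead_coefDl ?lead_coefXn // size_polyXn ltnS size_poly.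
  - move=> k; rewrite coefD coefXn coef_poly; apply: subringD => //.
      by case: eqP => _; [exact: subring1 | exact: subring0].
    case: ifP => _; last exact: subring0.
    apply: subringM => //; [exact: integral_over_id | exact: subringX].
  - rewrite /root hornerD hornerXn horner_poly.
    have -> : \sum_(k < i.+1) p`_k * y ^+ (i - k) * (x * y) ^+ k =
              y ^+ i * (take_poly i.+1 p).[x].
      rewrite /take_poly horner_poly mulr_sumr; apply: eq_bigr => k _.
      rewrite exprMn -!mulrA [y ^+ i * _]mulrC -mulrA; congr (_ * _).
      by rewrite mulrCA -exprD subnK // -ltnS.
    rewrite exprMn [y ^+ i.+1]exprS mulrCA mulrA -[X in X + _]mulrA [_ * y ^+ i]mulrC mulrA [_ * y ^+ i]mulrC -mulrA -mulrDr.
    have := px; rewrite /root -{1}(poly_take_drop i.+1 p) hornerD hornerM hornerXn -/y.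
    by rewrite addrC mulrC => /eqP ->; rewrite mulr0.
elim: {j}(size p - j)%N {-2}j (erefl (size p - j)%N) => [|n IH] j e.
  by apply: base; rewrite -subn_eq0 e.
apply: step; apply: (proj2 (IH _ _)); rewrite subnS e //.
Qed.

End Integral.

(** * Existence of maximal ideals *)

Section Zorn.
Variables (R : fieldType) (C : R -> Prop) (hC : subring C).

Lemma exists_max_ideal I : ideal C I -> ~ I 1 ->
  exists2 M, max_ideal C M & forall x, I x -> M x.
Proof.
move=> hI I1.
pose T := {J : R -> Prop | [/\ ideal C J, ~ J 1 & forall x, I x -> J x]}.
pose le (A B : T) := `[< forall x, sval A x -> sval B x >].
have [||A totA|[M [hM M1 IM]] maxM] := @classical_sets.ZL_preorder T (exist _ I (And3 hI I1 (fun _ h => h))) le.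
- by move=> ?; apply/asboolP.
- by move=> r s t /asboolP rs /asboolP st; apply/asboolP => x /rs /st.
- case: (pselect (exists B, A B)) => [[B0 AB0]|nA]; last first.
    by exists (exist _ I (And3 hI I1 (fun _ h => h))) => s As; case: nA; exists s.
  pose U x := exists2 B : T, A B & sval B x.
  have tot B1 B2 : A B1 -> A B2 -> exists2 B, A B & (forall x, sval B1 x -> sval B x) /\ (forall x, sval B2 x -> sval B x).
    move=> A1 A2; case: (totA _ _ A1 A2) => /asboolP h; [exists B2|exists B1] => //.
  have hU : [/\ ideal C U, ~ U 1 & forall x, I x -> U x].
    split.
    - split.
      + by move=> x [B _ Bx]; case: (svalP B) => /ideal_sub h _ _; exact: h.
      + by exists B0 => //; case: (svalP B0) => /ideal0.
      + move=> x y [B1 A1 B1x] [B2 A2 B2y]; have [B AB [h1 h2]] := tot _ _ A1 A2.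
        exists B => //; by case: (svalP B) => hB _ _; have := idealB hB (h1 _ B1x) (h2 _ B2y).
      + move=> a x Ca [B AB Bx]; exists B => //; by case: (svalP B) => hB _ _; have := idealMl hB Ca Bx.
    - by case=> B _; case: (svalP B).
    - by move=> x Ix; exists B0 => //; case: (svalP B0) => _ _; exact.
  by exists (exist _ U hU) => s As; apply/asboolP => x sx; exists s.
exists M => //; split=> // N hN MN.
case: (pselect (N 1)) => N1; [by right | left].
have hN' : [/\ ideal C N, ~ N 1 & forall x, I x -> N x] by split=> // x /IM /MN.
have := maxM (exist _ N hN'); rewrite /le => /(_ (asboolT MN)) /asboolP /= h.
by move=> x; split; [exact: h | exact: MN].
Qed.

Lemma unit_max_ideal x : C x -> (forall M, max_ideal C M -> ~ M x) -> C x^-1.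
Proof.
move=> Cx h; apply: contrapT => nC.
pose I z := exists2 y, C y & z = y * x.
have hI : ideal C I.
  split.
  - by move=> _ [y Cy ->]; exact: subringM.
  - by exists 0; [exact: subring0 | rewrite mul0r].
  - by move=> _ _ [y Cy ->] [z Cz ->]; exists (y - z); [exact: subringB | rewrite mulrBl].
  - by move=> a _ Ca [y Cy ->]; exists (a * y); [exact: subringM | rewrite mulrA].
case: (@exists_max_ideal I hI).
  case=> y Cy e; apply: nC; suff -> : x^-1 = y by [].
  have x0 : x != 0 by apply/eqP => x0; move/eqP: e; rewrite x0 mulr0 oner_eq0.
  by apply: (mulIf x0); rewrite mulVf.
move=> M hM IM; apply: (h _ hM); apply: IM; exists 1; [exact: subring1 | by rewrite mul1r].
Qed.
End Zorn.

Section ValuationDomain.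
Variables (F : fieldType) (V : F -> Prop) (hV : valuation_domain V).

Lemma valuation_subring : subring V. Proof. by case: hV. Qed.

(** Divisibility is a total preorder in a valuation domain, so some member of a finite family
    divides all the others. It serves to normalize families by one of their members. *)
Lemma valuation_max (I : finType) (v : I -> F) (i0 : I) : v i0 != 0 ->
  exists2 j, v j != 0 & forall i, V (v i / v j).
Proof.
move=> vi0; have hVr := valuation_subring.
suff [j vj h] : exists2 j, v j != 0 & forall i, i \in i0 :: enum I -> V (v i / v j).
  by exists j => // i; apply: h; rewrite inE mem_enum orbT.
elim: (enum I) => [|a s [j vj IH]].
  by exists i0 => // i; rewrite inE => /eqP ->; rewrite divff //; exact: subring1.
case: (pselect (V (v a / v j))) => [h|h].
  by exists j => // i; rewrite !inE => /or3P [/eqP ->|/eqP -> //|hi];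
    apply: IH; rewrite inE ?eqxx ?hi ?orbT.
have va : v a != 0 by apply/eqP => va; apply: h; rewrite va mul0r; exact: subring0.
have hja : V (v j / v a).
  case: hV => _ /(_ (v a / v j)); rewrite mulf_neq0 ?invr_eq0 // invf_div => /(_ isT) [] //.
exists a => // i; rewrite !inE => hi.
have [->|nia] := eqVneq i a; first by rewrite divff //; exact: subring1.
have -> : v i / v a = (v i / v j) * (v j / v a) by rewrite mulrA divfK.
by apply: subringM => //; apply: IH; rewrite inE; move: hi; rewrite (negPf nia).
Qed.

Variable (K : fieldExtType F).
Local Notation inV := (fun x : K => exists v, V v /\ x = v%:A).

Lemma inK_subring : subring inV.
Proof.
have hVr := valuation_subring; split.
- by exists 0; split; [exact: subring0 | rewrite scale0r].
- by exists 1; split; [exact: subring1 | rewrite scale1r].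
- move=> _ _ [v [Vv ->]] [w [Vw ->]]; exists (v - w); split; first exact: subringB.
  by rewrite scalerBl.
- move=> _ _ [v [Vv ->]] [w [Vw ->]]; exists (v * w); split; first exact: subringM.
  by rewrite -scalerAl mul1r scalerA.
Qed.

(* Some coefficient of an equation for [x] can be made 1; the Horner partial sums [h]
   are integral together with [x * h], and one of them is a unit at [M]. *)
Lemma integral_closure_valuation (M : K -> Prop) (x : K) :
  max_ideal (integral_over inV) M ->
  exists t, [/\ integral_over inV t, ~ M t &
     integral_over inV (t * x) \/ integral_over inV (t * x^-1)].
Proof.
move=> hM; have hC := inK_subring.
pose p := minPoly 1 x.
have pm : p \is monic := monic_minPoly _ _.
have hp i : exists v : F, p`_i = v%:A by apply/vlineP/polyOverP/minPolyOver.
have [v hv] := choice hp.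
have [j vj hj] : exists2 j : 'I_(size p).+1, v j != 0 & forall i : 'I_(size p).+1, V (v i / v j).
  apply: (@valuation_max _ (fun i : 'I_(size p).+1 => v i) (inord (size p).-1)).
  rewrite inordK ?ltnS ?leq_pred //; apply/eqP => v0.
  have : p`_(size p).-1 != 0 by rewrite -lead_coefE lead_coef_eq0 monic_neq0.
  by rewrite hv v0 scale0r eqxx.
pose q : {poly K} := (v j)^-1%:A *: p.
have qV i : inV q`_i.
  exists ((v j)^-1 * v i); rewrite coefZ hv -scalerAl mul1r scalerA; split=> //.
  case: (ltnP i (size p).+1) => hi; first by rewrite mulrC; have := hj (Ordinal hi).
  have : p`_i = 0 by rewrite nth_default // ltnW.
  rewrite hv => /eqP; rewrite scaler_eq0 oner_eq0 orbF => /eqP ->.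
  by rewrite mulr0; exact: subring0 valuation_subring.
have qx : root q x.
  by rewrite /root hornerZ (eqP (root_minPoly _ _)) mulr0.
have qj : q`_j = 1 by rewrite coefZ hv -scalerAl mul1r scalerA mulVf // scale1r.
have hS := integral_over_subring hC.
have [Sh Sxh] := integral_horner_tail hC j qV qx.
have [Sh' Sxh'] := integral_horner_tail hC j.+1 qV qx.
have e : (drop_poly j q).[x] = x * (drop_poly j.+1 q).[x] + 1.
  have -> : drop_poly j q = drop_poly j.+1 q * 'X + 1.
    apply/polyP => -[|k]; rewrite coefD coefMX coef1 !coef_drop_poly /= ?add0r ?addr0 //.
    by rewrite addnS addSn.
  by rewrite hornerD hornerM hornerX hornerC mulrC.
case: (pselect (M (drop_poly j q).[x])) => Mh; last first.
  by exists (drop_poly j q).[x]; split=> //; left; rewrite mulrC.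
exists (x * (drop_poly j.+1 q).[x]); split=> //.
  move=> Mxh; apply: (max_ideal1 hM); have -> : 1 = (drop_poly j q).[x] - x * (drop_poly j.+1 q).[x].
    by rewrite e addrC addKr.
  by apply: (idealB (max_ideal_ideal hM)).
right; have [->|x0] := eqVneq x 0; first by rewrite mul0r mul0r; exact: subring0.
by rewrite mulrAC divff // mul1r.
Qed.
End ValuationDomain.

(** * Localizations *)

(** One definition gives both the local ring ([I] equal to [C]) and its maximal ideal ([I] equal to
    [M]), and it avoids fractions. *)
Definition loc_at (R : fieldType) (C M I : R -> Prop) (x : R) : Prop :=
  exists t, [/\ C t, ~ M t & I (t * x)].

Definition mx_in (R : fieldType) (C : R -> Prop) m n (A : 'M[R]_(m, n)) : Prop :=
  forall i j, C (A i j).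

Lemma ideal_sqMr (R : fieldType) (C M : R -> Prop) a b :
  ideal C M -> C b -> ideal_sq M a -> ideal_sq M (a * b).
Proof.
move=> hM Cb [m [x [y [Mx [My ->]]]]]; exists m, x, (fun i => y i * b); split=> //; split.
  by move=> i; exact: (idealMr hM).
by rewrite mulr_suml; apply: eq_bigr => i _; rewrite mulrA.
Qed.

Section Localization.
Variables (R : fieldType) (C M : R -> Prop) (hC : subring C) (hM : max_ideal C M).
Let hI := max_ideal_ideal hM.
Local Notation loc := (loc_at C M C).
Local Notation mloc := (loc_at C M M).

Lemma loc_sub x : C x -> loc x.
Proof. by move=> Cx; exists 1; split; [exact: subring1 | exact: max_ideal1 hM | rewrite mul1r]. Qed.
Lemma mloc_sub x : M x -> mloc x.
Proof. by move=> Cx; exists 1; split; [exact: subring1 | exact: max_ideal1 hM | rewrite mul1r]. Qed.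
Lemma mloc_loc x : mloc x -> loc x.
Proof. by move=> [t [Ct Mt Mtx]]; exists t; split=> //; exact: ideal_sub hI _ _. Qed.
Lemma mloc_inM x : C x -> mloc x -> M x.
Proof. by move=> Cx [t [Ct Mt /(max_ideal_prime hC hM Ct Cx) []]]. Qed.

Lemma loc_subring : subring loc.
Proof.
split.
- by apply: loc_sub; exact: subring0.
- by apply: loc_sub; exact: subring1.
- move=> x y [s [Cs Ms Csx]] [t [Ct Mt Cty]]; exists (s * t); split.
  + exact: subringM.
  + exact: (max_ideal_nM hC hM).
  + rewrite mulrBr mulrAC -[_ * t * y]mulrA; apply: subringB => //; exact: subringM.
- move=> x y [s [Cs Ms Csx]] [t [Ct Mt Cty]]; exists (s * t); split.
  + exact: subringM.
  + exact: (max_ideal_nM hC hM).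
  + by rewrite mulrACA; exact: subringM.
Qed.

Lemma mloc_ideal : ideal loc mloc.
Proof.
split.
- exact: mloc_loc.
- by apply: mloc_sub; exact: ideal0 hI.
- move=> x y [s [Cs Ms Csx]] [t [Ct Mt Cty]]; exists (s * t); split.
  + exact: subringM.
  + exact: (max_ideal_nM hC hM).
  + rewrite mulrBr mulrAC -[_ * t * y]mulrA.
    by apply: (idealB hI); [apply: (idealMr hI) | apply: (idealMl hI)].
- move=> x y [s [Cs Ms Csx]] [t [Ct Mt Cty]]; exists (s * t); split.
  + exact: subringM.
  + exact: (max_ideal_nM hC hM).
  + by rewrite mulrACA; apply: (idealMl hI).
Qed.

Lemma loc_inv x : loc x -> ~ mloc x -> x != 0 /\ loc x^-1.
Proof.
move=> [t [Ct Mt Ctx]] nx.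
have nM : ~ M (t * x) by move=> h; apply: nx; exists t.
have := max_ideal_neq0 hM nM; rewrite mulf_eq0 => /norP [t0 x0]; split=> //.
by exists (t * x); split=> //; rewrite -mulrA divff // mulr1.
Qed.

Lemma loc_inv_sub x : C x -> ~ M x -> loc x^-1.
Proof. by move=> Cx nMx; apply: (proj2 (loc_inv (loc_sub Cx) _)) => /(mloc_inM Cx). Qed.

Lemma mloc1 : ~ mloc 1.
Proof. by case=> t [Ct Mt]; rewrite mulr1. Qed.

(** The localization at [M] is a valuation ring, stated with an explicit denominator. *)
Hypothesis hval : forall x, exists t, [/\ C t, ~ M t & C (t * x) \/ C (t * x^-1)].

Lemma loc_val x : x != 0 -> loc x \/ mloc x^-1.
Proof.
move=> x0; have [t [Ct Mt [h|h]]] := hval x; first by left; exists t.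
case: (pselect (M (t * x^-1))) => Mtx; first by right; exists t.
by left; exists (t * x^-1); split=> //; rewrite -mulrA mulVf // mulr1.
Qed.
Lemma loc_total x : loc x \/ loc x^-1.
Proof.
have [->|/loc_val [|/mloc_loc]] := eqVneq x 0; [by left; exact: subring0 loc_subring|by left|by right].
Qed.

(** An element of M outside M^2 generates the maximal ideal of the localization: otherwise g / x
    would lie in that maximal ideal, and g = x (g / x) would be in its square. *)
Lemma mloc_div g x : M g -> ~ ideal_sq M g -> mloc x -> loc (x / g).
Proof.
move=> Mg Mg2 [t [Ct Mt Mtx]].
have g0 : g != 0.
  apply/eqP => g0; apply: Mg2; exists 0, (fun _ => 0), (fun _ => 0).
  by split; [case | split; [case | rewrite big_ord0]].
have [->|x0] := eqVneq x 0; first by rewrite mul0r; exact: subring0 loc_subring.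
case: (@loc_val (x / g)) => //; first by rewrite mulf_neq0 // invr_eq0.
rewrite invf_div => -[s [Cs Ms Msgx]]; case: Mg2.
(* Clearing denominators: y inverts s t modulo M, and g = (y s g / x) (t x) - (s t y - 1) g is a sum
   of two products of elements of M. *)
have [y Cy h] := max_ideal_inv hC hM (subringM hC Cs Ct) (max_ideal_nM hC hM Cs Ct Ms Mt).
exists 2, (fun i => if i == ord0 then y * (s * (g / x)) else - (s * t * y - 1)),
          (fun i => if i == ord0 then t * x else g); split; last split.
- by move=> i; case: eqP => _; [exact: (idealMl hI Cy Msgx) | exact: (idealN hI h)].
- by move=> i; case: eqP.
- by rewrite big_ord_recl big_ord1 /=; field.
Qed.
End Localization.

(** * Semilocal Bezout domains *)

Section MxIn.
Variables (R : fieldType) (C : R -> Prop) (hC : subring C).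
Lemma mx_inM m n p (A : 'M[R]_(m, n)) (B : 'M_(n, p)) : mx_in C A -> mx_in C B -> mx_in C (A *m B).
Proof. by move=> hA hB i j; rewrite mxE; apply: subring_sum => // k _; exact: subringM. Qed.
Lemma mx_inB m n (A B : 'M[R]_(m, n)) : mx_in C A -> mx_in C B -> mx_in C (A - B).
Proof. by move=> hA hB i j; rewrite !mxE; exact: subringB. Qed.
Lemma mx_in1 n : mx_in C (1%:M : 'M[R]_n).
Proof. by move=> i j; rewrite mxE; case: eqP => _; [exact: subring1 | exact: subring0]. Qed.
Lemma mx_in_delta m n i j : mx_in C (delta_mx i j : 'M[R]_(m, n)).
Proof. by move=> k l; rewrite mxE; case: andP => _; [exact: subring1 | exact: subring0]. Qed.
Lemma mx_inZ m n a (A : 'M[R]_(m, n)) : C a -> mx_in C A -> mx_in C (a *: A).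
Proof. by move=> Ca hA i j; rewrite mxE; exact: subringM. Qed.
Variables (I : R -> Prop) (hI : ideal C I).
Lemma mx_in_idealM m n p (A : 'M[R]_(m, n)) (B : 'M_(n, p)) : mx_in I A -> mx_in C B -> mx_in I (A *m B).
Proof. by move=> hA hB i j; rewrite mxE; apply: (ideal_sum hI) => // k _; apply: (idealMr hI). Qed.
Lemma mx_in_idealMl m n p (A : 'M[R]_(m, n)) (B : 'M_(n, p)) : mx_in C A -> mx_in I B -> mx_in I (A *m B).
Proof. by move=> hA hB i j; rewrite mxE; apply: (ideal_sum hI) => // k _; apply: (idealMl hI). Qed.
Lemma mx_in_idealD m n (A B : 'M[R]_(m, n)) : mx_in I A -> mx_in I B -> mx_in I (A + B).
Proof. by move=> hA hB i j; rewrite mxE; apply: (idealD hI). Qed.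
End MxIn.

Section PartialMorphism.
Variables (R L : fieldType) (C : R -> Prop) (hC : subring C) (phi : R -> L).
Hypothesis phi1 : phi 1 = 1.
Hypothesis phiD : forall x y, C x -> C y -> phi (x + y) = phi x + phi y.
Hypothesis phiM : forall x y, C x -> C y -> phi (x * y) = phi x * phi y.
Let C0 := subring0 hC. Let C1 := subring1 hC.
Lemma pmorph0 : phi 0 = 0.
Proof. by apply: (addIr (phi 0)); rewrite -phiD // !add0r. Qed.
Lemma pmorphN x : C x -> phi (- x) = - phi x.
Proof.
move=> Cx; apply: (addIr (phi x)); rewrite -phiD //; last exact: subringN.
by rewrite !addNr pmorph0.
Qed.
Lemma pmorphB x y : C x -> C y -> phi (x - y) = phi x - phi y.
Proof. by move=> Cx Cy; rewrite phiD ?pmorphN //; exact: subringN. Qed.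
Lemma pmorph_sum I (r : seq I) (P : pred I) (F : I -> R) : (forall i, P i -> C (F i)) ->
  phi (\sum_(i <- r | P i) F i) = \sum_(i <- r | P i) phi (F i).
Proof.
move=> h; suff [] : C (\sum_(i <- r | P i) F i) /\
  phi (\sum_(i <- r | P i) F i) = \sum_(i <- r | P i) phi (F i) by [].
elim/big_rec2: _ => [|i y x Pi [Cx e]]; first by split=> //; exact: pmorph0.
have Ci := h _ Pi.
by split; [exact: subringD | rewrite phiD // e].
Qed.
Lemma pmorph_prod I (r : seq I) (P : pred I) (F : I -> R) : (forall i, P i -> C (F i)) ->
  phi (\prod_(i <- r | P i) F i) = \prod_(i <- r | P i) phi (F i).
Proof.
move=> h; suff [] : C (\prod_(i <- r | P i) F i) /\
  phi (\prod_(i <- r | P i) F i) = \prod_(i <- r | P i) phi (F i) by [].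
elim/big_rec2: _ => [|i y x Pi [Cx e]]; first by split.
have Ci := h _ Pi.
by split; [exact: subringM | rewrite phiM // e].
Qed.
Lemma pmorph_nat n : phi n%:R = n%:R.
Proof.
elim: n => [|n IH]; first exact: pmorph0.
by rewrite -!natr1 phiD ?IH ?phi1 //; exact: subring_nat.
Qed.
Lemma map_mx_pmorphM m n p (A : 'M[R]_(m, n)) (B : 'M_(n, p)) : mx_in C A -> mx_in C B ->
  map_mx phi (A *m B) = map_mx phi A *m map_mx phi B.
Proof.
move=> hA hB; apply/matrixP => i j; rewrite !mxE pmorph_sum => [|k _]; last exact: subringM.
by apply: eq_bigr => k _; rewrite !mxE phiM.
Qed.
Lemma det_pmorph n (A : 'M[R]_n) : mx_in C A -> phi (\det A) = \det (map_mx phi A).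
Proof.
move=> hA; rewrite /determinant pmorph_sum => [|s _]; last first.
  by apply: subringM => //; [exact: subring_sign | apply: subring_prod].
apply: eq_bigr => s _; rewrite phiM; [|exact: subring_sign|by apply: subring_prod].
congr (_ * _); last by rewrite pmorph_prod //; apply: eq_bigr => i _; rewrite mxE.
by case: odd_perm; rewrite ?expr1 ?expr0 // pmorphN // phi1.
Qed.
Lemma det_mx_in n (A : 'M[R]_n) : mx_in C A -> C (\det A).
Proof.
move=> hA; apply: subring_sum => // s _.
by apply: subringM => //; [exact: subring_sign | apply: subring_prod].
Qed.
End PartialMorphism.

Section Semilocal.
Variables (R : fieldType) (C : R -> Prop) (hC : subring C).

(** The ideal of denominators of x is contained in no maximal ideal, hence contains 1. *)
Lemma loc_all x : (forall M, max_ideal C M -> loc_at C M C x) -> C x.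
Proof.
move=> h; pose I t := C t /\ C (t * x).
have hI : ideal C I.
  split.
  - by move=> ? [].
  - by split; rewrite ?mul0r; exact: subring0.
  - by move=> s t [? ?] [? ?]; split; rewrite ?mulrBl; exact: subringB.
  - by move=> a s Ca [? ?]; split; rewrite -?mulrA; exact: subringM.
case: (pselect (I 1)) => [[_]|I1]; first by rewrite mul1r.
have [M hM IM] := exists_max_ideal hI I1.
by have [t [Ct Mt Ctx]] := h _ hM; case: Mt; apply: IM.
Qed.

Lemma some_max_ideal : exists M, max_ideal C M.
Proof.
have [||M hM _] := @exists_max_ideal _ C (fun x => x = 0).
- split=> //; first by move=> x ->; exact: subring0.
    by move=> x y -> ->; rewrite subr0.
  by move=> a x _ ->; rewrite mulr0.
- by move/eqP; rewrite oner_eq0.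
by exists M.
Qed.

(** If the determinant lay in M, a kernel vector over the residue field would lift to a vector
    contradicting injectivity modulo M. So the determinant is a unit of [C], and the adjugate
    formula applies. *)
Lemma mx_inv_in n (P : 'M[R]_n) : mx_in C P ->
  (forall M, max_ideal C M -> forall u : 'rV_n, mx_in C u -> mx_in M (u *m P) -> mx_in M u) ->
  P \in unitmx /\ mx_in C (invmx P).
Proof.
move=> hP h.
have dC := det_mx_in hC hP.
have dM M : max_ideal C M -> ~ M (\det P).
  move=> hM; have [L [phi [phi1 phiD phiM phis phi0]]] := residue_field hC hM.
  rewrite -phi0 // (det_pmorph hC phi1 phiD phiM hP) => /eqP; apply/negP.
  rewrite -unitfE -unitmxE -row_free_unit -kermx_eq0; apply/eqP/row_matrixP => i.
  rewrite row0; set v := row i _.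
  have vP : v *m map_mx phi P = 0 by rewrite -row_mul mulmx_ker row0.
  have ex j : exists x, C x /\ phi x = v 0 j by have [x ? ?] := phis (v 0 j); exists x.
  have [u hu] := choice ex.
  pose w : 'rV_n := \row_j u j.
  have wC : mx_in C w by move=> a b; rewrite mxE; case: (hu b).
  have ew : map_mx phi w = v.
    by apply/rowP => j; rewrite [LHS]mxE [w _ _]mxE; case: (hu j).
  have Mw : mx_in M w.
    apply: h => // a b; rewrite -phi0; last exact: (mx_inM hC wC hP).
    by move: vP; rewrite -ew -(map_mx_pmorphM hC phiD phiM) // => /matrixP /(_ a b); rewrite !mxE.
  by rewrite -ew; apply/rowP => j; rewrite [RHS]mxE [LHS]mxE; apply/phi0; [case: (hu j); rewrite mxE|exact: Mw].
have Pu : P \in unitmx.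
  have [M hM] := some_max_ideal.
  by rewrite unitmxE unitfE; exact: (max_ideal_neq0 hM (dM M hM)).
split=> // i j; rewrite /invmx Pu mxE; apply: subringM => //.
  exact: unit_max_ideal.
rewrite mxE /cofactor; apply: subringM => //.
  by rewrite -signr_odd; exact: subring_sign.
by apply: det_mx_in => // a b; rewrite !mxE.
Qed.

Variables (r : nat) (Ms : 'I_r -> R -> Prop).
Hypothesis hMs : forall i, max_ideal C (Ms i).
Hypothesis Ms_inj : forall i j, (forall x, Ms i x <-> Ms j x) -> i = j.
Hypothesis Ms_all : forall M, max_ideal C M -> exists i, forall x, M x <-> Ms i x.

Lemma comaximal i j : i != j -> exists x, [/\ C x, Ms i x & Ms j (x - 1)].
Proof.
move=> ij; have [x [Mx nMx]] : exists x, Ms i x /\ ~ Ms j x.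
  apply: contrapT => h; case: (hMs i) => hi hi1 /(_ (Ms j) (max_ideal_ideal (hMs j))) [].
  - by move=> x Mx; apply: contrapT => nMx; apply: h; exists x.
  - by move=> e; case/eqP: ij; apply: Ms_inj => x; rewrite e.
  - exact: max_ideal1 (hMs j).
have Cx := ideal_sub (max_ideal_ideal (hMs i)) Mx.
have [y Cy h] := max_ideal_inv hC (hMs j) Cx nMx.
exists (x * y); split=> //; first exact: subringM.
exact: (idealMr (max_ideal_ideal (hMs i))).
Qed.

Lemma chinese (z : 'I_r -> R) : (forall i, C (z i)) ->
  exists2 x, C x & forall i, Ms i (x - z i).
Proof.
move=> Cz.
have /choice [e he] : forall j, exists e, C e /\ forall i, Ms i (e - (i == j)%:R).
  move=> j; have /choice [g hg] : forall i, exists x, C x /\ (i != j -> Ms i x /\ Ms j (x - 1)).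
    move=> i; have [->|nij] := eqVneq i j; first by exists 1; split=> //; exact: subring1.
    by have [x [? ? ?]] := comaximal nij; exists x.
  exists (\prod_(i | i != j) g i); split; first by apply: subring_prod => // i _; case: (hg i).
  move=> i; have [->|nij] := eqVneq i j.
    suff [] : C (\prod_(i | i != j) g i) /\ Ms j (\prod_(i | i != j) g i - 1) by [].
    elim/big_rec: _ => [|k x kj [Cx Mx]].
      by rewrite subrr; split; [exact: subring1 | exact: ideal0 (max_ideal_ideal (hMs j))].
    have [Cg /(_ kj) [_ Mg]] := hg k; split; first exact: subringM.
    have -> : g k * x - 1 = g k * (x - 1) + (g k - 1) by ring.
    apply: (idealD (max_ideal_ideal (hMs j))) => //.
    exact: (idealMl (max_ideal_ideal (hMs j))).
  rewrite subr0 (bigD1 i) //=; apply: (idealMr (max_ideal_ideal (hMs i))).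
    by apply: subring_prod => // k _; case: (hg k).
  by have [_ /(_ nij) []] := hg i.
exists (\sum_j e j * z j); first by apply: subring_sum => // j _; apply: subringM => //; case: (he j).
move=> i; rewrite -[X in _ - X]mul1r.
have -> : \sum_j e j * z j - 1 * z i = \sum_j (e j - (i == j)%:R) * z j.
  under [RHS]eq_bigr do rewrite mulrBl.
  rewrite sumrB; congr (_ - _); rewrite (bigD1 i) //= eqxx big1 ?addr0 // => j ji.
  by rewrite eq_sym (negPf ji) mul0r.
apply: (ideal_sum (max_ideal_ideal (hMs i))) => j _.
apply: (idealMr (max_ideal_ideal (hMs i))) => //.
by case: (he j).
Qed.

(** Matrices over a field have generalized inverses; those over the residue fields are lifted and
    glued entry by entry by the Chinese remainder theorem. *)
Lemma regular_inverse k q (B : 'M[R]_(k, q)) : mx_in C B ->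
  exists2 Q : 'M_(q, k), mx_in C Q &
    forall M, max_ideal C M -> mx_in M (B *m Q *m B - B).
Proof.
move=> hB.
have /choice [Q hQ] : forall l, exists Q : 'M_(q, k), mx_in C Q /\ mx_in (Ms l) (B *m Q *m B - B).
  move=> l; have hM := hMs l.
  have [L [phi [phi1 phiD phiM phis phi0]]] := residue_field hC hM.
  pose Bp := map_mx phi B.
  have ex (p : 'I_q * 'I_k) : exists x, C x /\ phi x = pinvmx Bp p.1 p.2.
    by have [x ? ?] := phis (pinvmx Bp p.1 p.2); exists x.
  have [u hu] := choice ex.
  pose Q : 'M_(q, k) := \matrix_(i, j) u (i, j).
  have QC : mx_in C Q by move=> i j; rewrite mxE; case: (hu (i, j)).
  have eQ : map_mx phi Q = pinvmx Bp.
    by apply/matrixP => i j; rewrite [LHS]mxE [Q _ _]mxE; case: (hu (i, j)).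
  exists Q; split=> // i j.
  have hBQB : mx_in C (B *m Q *m B) by do 2?apply: mx_inM.
  rewrite -phi0; last exact: (mx_inB hC hBQB hB).
  have e : map_mx phi (B *m Q *m B) = map_mx phi B.
    by rewrite !(map_mx_pmorphM hC phiD phiM) ?eQ ?mulmxKpV //; exact: mx_inM.
  rewrite mxE [X in _ + X]mxE (pmorphB hC phiD) //.
  by move/matrixP/(_ i j): e; rewrite !mxE => ->; rewrite subrr.
have /choice [x hx] : forall p : 'I_q * 'I_k, exists x, C x /\ forall l, Ms l (x - Q l p.1 p.2).
  move=> p; have [|x Cx hx] := @chinese (fun l => Q l p.1 p.2); last by exists x.
  by move=> l; case: (hQ l).
pose Q0 : 'M_(q, k) := \matrix_(i, j) x (i, j).
have Q0C : mx_in C Q0 by move=> i j; rewrite mxE; case: (hx (i, j)).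
exists Q0 => // M hM; have [l hl] := Ms_all hM.
suff h : mx_in (Ms l) (B *m Q0 *m B - B) by move=> i j; apply/hl; exact: h.
have [QC hQl] := hQ l; have hI := max_ideal_ideal (hMs l).
have -> : B *m Q0 *m B - B = B *m (Q0 - Q l) *m B + (B *m Q l *m B - B).
  by rewrite mulmxBr mulmxBl addrA subrK.
apply: (mx_in_idealD hI) => //; apply: (mx_in_idealM hI) => //.
apply: (mx_in_idealMl hI) => // i j; rewrite !mxE.
by have [_] := hx (i, j); apply.
Qed.

Hypothesis hval : forall M x, max_ideal C M ->
  exists t, [/\ C t, ~ M t & C (t * x) \/ C (t * x^-1)].

(** A generator of the form a + v b: v is 0 modulo the maximal ideals at which a divides b and 1
    modulo the others, so locally a + v b is a unit times a, respectively a unit times b. *)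
Lemma bezout_pair a b : exists u v p q,
  [/\ C u, C v, C p & C q] /\ a = p * (u * a + v * b) /\ b = q * (u * a + v * b).
Proof.
have C0 := subring0 hC; have C1 := subring1 hC.
have [->|a0] := eqVneq a 0.
  by exists 0, 1, 0, 1; split=> //; rewrite !mul0r !mul1r add0r.
have [->|b0] := eqVneq b 0.
  by exists 1, 0, 1, 0; split=> //; rewrite !mul0r !mul1r addr0.
pose z i : R := if pselect (loc_at C (Ms i) C (b / a)) is left _ then 0 else 1.
have [|v Cv hv] := @chinese z; first by move=> i; rewrite /z; case: pselect.
pose g := a + v * b.
have key M : max_ideal C M -> [/\ g != 0, loc_at C M C (a / g) & loc_at C M C (b / g)].
  move=> hM; have [i hi] := Ms_all hM.
  have hl := loc_subring hC hM; have hm := mloc_ideal hC hM.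
  have Mv : M (v - z i) by apply/hi.
  have m1 := mloc1 (C := C) (M := M).
  case: (pselect (loc_at C M C (b / a))) => hba.
    have Mv' : M v.
      suff e : z i = 0 by rewrite e subr0 in Mv.
      rewrite /z; case: pselect => // [[]]; case: hba => t [Ct Mt h]; exists t; split=> //.
      by move=> h'; apply: Mt; apply/hi.
    have mvb : loc_at C M M (v * (b / a)) by apply: (idealMr hm) => //; exact: mloc_sub.
    have nm : ~ loc_at C M M (1 + v * (b / a)).
      by move=> h; apply: m1; rewrite -[1](addrK (v * (b / a))); apply: (idealB hm).
    have lg : loc_at C M C (1 + v * (b / a)).
      by apply: (subringD hl); [exact: subring1 hl | exact: (mloc_loc hM mvb)].
    have [n0 ln] := loc_inv hM lg nm.
    have eg : g = a * (1 + v * (b / a)) by rewrite /g; field.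
    have lag : loc_at C M C (a / g) by rewrite eg invfM mulVKf.
    split=> //; first by rewrite eg mulf_neq0.
    have -> : b / g = (b / a) * (a / g) by rewrite mulrA divfK.
    exact: (subringM hl).
  have Mv' : M (v - 1).
    suff e : z i = 1 by rewrite e in Mv.
    rewrite /z; case: pselect => // h; case: hba; case: h => t [Ct Mt h]; exists t; split=> //.
    by move=> h'; apply: Mt; apply/hi.
  have mab : loc_at C M M (a / b).
    have [] := @loc_val _ C M (fun x => hval x hM) (b / a); rewrite ?mulf_neq0 ?invr_eq0 //.
    by rewrite invf_div.
  have nm : ~ loc_at C M M (a / b + v).
    move=> h; apply: m1.
    have -> : 1 = (a / b + v) - (v - 1) - a / b by ring.
    apply: (idealB hm) => //; apply: (idealB hm) => //; exact: mloc_sub.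
  have lg : loc_at C M C (a / b + v).
    by apply: (subringD hl); [exact: (mloc_loc hM mab) | exact: loc_sub].
  have [n0 ln] := loc_inv hM lg nm.
  have eg : g = b * (a / b + v) by rewrite /g; field.
  have lbg : loc_at C M C (b / g) by rewrite eg invfM mulVKf.
  split=> //; first by rewrite eg mulf_neq0.
  have -> : a / g = (a / b) * (b / g) by rewrite mulrA divfK.
  by apply: (subringM hl) => //; exact: (mloc_loc hM mab).
have g0 : g != 0 by have [M hM] := some_max_ideal; case: (key M hM).
exists 1, v, (a / g), (b / g); rewrite mul1r -/g !divfK //; split=> //; split=> //.
  by apply: loc_all => M /key [].
by apply: loc_all => M /key [].
Qed.

Lemma bezout_family k (c : 'cV[R]_k) : exists (g : R) (u : 'rV_k) (p : 'cV_k),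
  [/\ mx_in C u, mx_in C p, u *m c = g%:M & c = g *: p].
Proof.
elim: k c => [|k IH] c.
  exists 0, 0, 0; split; try by move=> [].
    by move=> ? [].
    by apply/matrixP => i j; rewrite !ord1 !mxE big_ord0 mul0rn.
  by apply/matrixP => [[]].
have [g [u [p [uC pC eu ep]]]] := IH (dsubmx (c : 'cV_(1 + k))).
have [s [t [m [n [[Cs Ct Cm Cn] [ea eg]]]]]] := bezout_pair (c 0 0) g.
exists (s * c 0 0 + t * g), (row_mx s%:M (t *: u)), (col_mx m%:M (n *: p)).
have C0 := subring0 hC.
have ec : c = col_mx (c 0 0)%:M (dsubmx (c : 'cV_(1 + k))).
  apply/matrixP => i j; rewrite [RHS]mxE ord1; case: split_ordP => l ->; rewrite !mxE.
    by rewrite !ord1 mulr1n; congr (c _ _); apply: val_inj.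
  by congr (c _ _).
split.
- move=> i j; rewrite mxE; case: split_ordP => l _; rewrite mxE ?mulr1n //.
    by case: eqP => _ //; rewrite ?mulr1n.
  exact: subringM.
- move=> i j; rewrite mxE; case: split_ordP => l _; rewrite mxE ?mulr1n //.
    by case: eqP => _ //; rewrite ?mulr1n.
  exact: subringM.
- have -> : row_mx s%:M (t *: u) *m c = s%:M *m (c 0 0)%:M + (t *: u) *m dsubmx (c : 'cV_(1 + k)).
    by rewrite -(@mul_row_col _ 1 1 k 1) -ec.
  rewrite -scalemxAl eu -scalar_mxM.
  by apply/matrixP => i j; rewrite !ord1 !mxE eqxx !mulr1n.
- apply/matrixP => i j; rewrite [RHS]mxE [X in _ * X]mxE ord1.
  case: split_ordP => l ->; rewrite !mxE.
    by rewrite ord1 mulr1n mulrC -ea; congr (c _ _); apply: val_inj.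
  have /matrixP /(_ l 0) := ep; rewrite !mxE mulrA [_ * n]mulrC -eg => <-.
  by congr (c _ _).
Qed.

(** Finitely generated torsion-free modules over a Bezout domain are free. The rows of [Y] are a
    basis of the row module of [W], and [Z] certifies their independence. The induction is on the
    number of nonzero columns: y = u W has the gcd of column j in position j, and W - p y loses that
    column without reviving zero columns. *)
Lemma free_span k n (W : 'M[R]_(k, n)) :
  exists q (Y : 'M_(q, n)) (Z : 'M_(n, q)) (P : 'M_(k, q)) (S : 'M_(q, k)),
  [/\ mx_in C P, mx_in C S, W = P *m Y, Y = S *m W & Y *m Z = 1%:M].
Proof.
have [m] := ubnP #|[pred j | col j W != 0]|; elim: m W => // m IH W hm.
case: (pickP [pred j | col j W != 0]) => [j /= Wj|W0]; last first.
  exists 0, 0, 0, 0, 0; split; try by move=> [].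
  - by move=> ? [].
  - rewrite mul0mx; apply/matrixP => a b; have /eqP /matrixP /(_ a 0) := negbFE (W0 b).
    by rewrite !mxE.
  - by apply/matrixP => [[]].
  - by apply/matrixP => [[]].
have [g [u [p [uC pC eu ep]]]] := bezout_family (col j W).
have g0 : g != 0 by apply/eqP => g0; move: Wj; rewrite ep g0 scale0r eqxx.
have up : u *m p = 1%:M.
  apply: (scalerI g0); rewrite scalemxAr -ep eu.
  by rewrite scale_scalar_mx mulr1.
pose y := u *m W.
pose W1 := W - p *m y.
have W1E : W1 = (1%:M - p *m u) *m W by rewrite mulmxBl mul1mx -mulmxA.
have [|q [Y [Z [P [S [PC SC eW eY eZ]]]]]] := IH W1.
  rewrite -ltnS; apply: leq_trans hm; rewrite ltnS; apply: proper_card; apply/properP; split.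
    apply/subsetP => i; rewrite !inE; apply: contra => /eqP Wi.
    by rewrite W1E colE -mulmxA -colE Wi mulmx0.
  exists j; first by [].
  rewrite inE negbK W1E colE -mulmxA -colE ep -scalemxAr mulmxBl mul1mx -mulmxA up.
  by rewrite mulmx1 subrr scaler0.
pose z := g^-1 *: (delta_mx j 0 : 'cV[R]_n).
have Wz : W *m z = p.
  by rewrite -scalemxAr -colE ep scalerA mulVf // scale1r.
have yz : y *m z = 1%:M by rewrite -mulmxA Wz.
have Yz : Y *m z = 0.
  by rewrite eY W1E -2!mulmxA Wz mulmxBl mul1mx -mulmxA up mulmx1 subrr mulmx0.
(* The correction term makes y (Z - z y Z) vanish, so that the block product is the identity. *)
exists (1 + q)%N, (col_mx y Y), (row_mx z (Z - z *m y *m Z)), (row_mx p P),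
   (col_mx u (S *m (1%:M - p *m u))); split.
- by move=> a b; rewrite mxE; case: split_ordP => l _.
- move=> a b; rewrite mxE; case: split_ordP => l _ //.
  apply: (mx_inM hC SC); apply: (mx_inB hC); [exact: mx_in1|exact: mx_inM].
- by rewrite mul_row_col -eW addrC subrK.
- by rewrite mul_col_mx -mulmxA -W1E -eY.
- have e1 : y *m (Z - z *m y *m Z) = 0 by rewrite mulmxBr !mulmxA yz mul1mx subrr.
  have e2 : Y *m (Z - z *m y *m Z) = 1%:M by rewrite mulmxBr !mulmxA Yz !mul0mx subr0.
  by rewrite mul_col_row yz Yz e1 e2 -scalar_mx_block.
Qed.
End Semilocal.

(** * Galois action and cocycles *)

Section GalComposition.
Variables (F : fieldType) (K : splittingFieldType F).
Local Notation G := (gal_of {:K}).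
Implicit Types s t r : G.

Lemma gcompE s t (x : K) : gcomp s t x = s (t x).
Proof. by rewrite /gcomp galM ?memvf. Qed.
Lemma gal1E (x : K) : (1%g : G) x = x. Proof. exact: gal_id. Qed.
Lemma gcompA s t r : gcomp s (gcomp t r) = gcomp (gcomp s t) r.
Proof. by rewrite /gcomp mulgA. Qed.
Lemma gcomp1l s : gcomp 1%g s = s. Proof. by rewrite /gcomp mulg1. Qed.
Lemma gcomp1r s : gcomp s 1%g = s. Proof. by rewrite /gcomp mul1g. Qed.
Lemma gcompVl s : gcomp s^-1%g s = 1%g. Proof. by rewrite /gcomp mulgV. Qed.
Lemma gcompVr s : gcomp s s^-1%g = 1%g. Proof. by rewrite /gcomp mulVg. Qed.
Lemma gcompK s t : gcomp (gcomp s t^-1%g) t = s.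
Proof. by rewrite -gcompA gcompVl gcomp1r. Qed.
Lemma gcompKV s t : gcomp (gcomp s t) t^-1%g = s.
Proof. by rewrite -gcompA gcompVr gcomp1r. Qed.
Lemma gcompVK s t : gcomp s^-1%g (gcomp s t) = t.
Proof. by rewrite gcompA gcompVl gcomp1l. Qed.
Lemma gcompVVK s t : gcomp s (gcomp s^-1%g t) = t.
Proof. by rewrite gcompA gcompVr gcomp1l. Qed.
Lemma galVK s (x : K) : s^-1%g (s x) = x.
Proof. by rewrite -gcompE gcompVl gal1E. Qed.
Lemma galKV s (x : K) : s (s^-1%g x) = x.
Proof. by rewrite -gcompE gcompVr gal1E. Qed.
Lemma gcomp_in (H : {group G}) s t : s \in H -> t \in H -> gcomp s t \in H.
Proof. by move=> hs ht; rewrite /gcomp groupM. Qed.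

Definition conj_pred s (M : K -> Prop) : K -> Prop := fun x => M (s^-1%g x).
Lemma conj_predE s M x : conj_pred s M (s x) <-> M x.
Proof. by rewrite /conj_pred galVK. Qed.
Lemma conj_pred_comp s t M : conj_pred (gcomp s t) M = conj_pred s (conj_pred t M).
Proof.
by apply: funext => x; rewrite /conj_pred -gcompE /gcomp invMg.
Qed.
Lemma conj_pred1 M : conj_pred 1%g M = M.
Proof. by apply: funext => x; rewrite /conj_pred invg1 gal1E. Qed.
Lemma conj_predVK s M : conj_pred s^-1%g (conj_pred s M) = M.
Proof. by rewrite -conj_pred_comp gcompVl conj_pred1. Qed.
Lemma conj_predKV s M : conj_pred s (conj_pred s^-1%g M) = M.
Proof. by rewrite -conj_pred_comp gcompVr conj_pred1. Qed.

Section Stable.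
Variables (C : K -> Prop) (s : G).
Hypothesis hs : forall x, C x -> C (s x).
Hypothesis hsV : forall x, C x -> C (s^-1%g x).
Lemma conj_pred_ideal I : ideal C I -> ideal C (conj_pred s I).
Proof.
move=> hI; split.
- by move=> x /(ideal_sub hI) /hs; rewrite galKV.
- by rewrite /conj_pred rmorph0; exact: ideal0 hI.
- by move=> x y; rewrite /conj_pred rmorphB; exact: (idealB hI).
- by move=> a x Ca Ix; rewrite /conj_pred rmorphM; exact: (idealMl hI (hsV Ca) Ix).
Qed.
End Stable.

Lemma conj_pred_max (C : K -> Prop) s M :
  (forall x, C x -> C (s x)) -> (forall x, C x -> C (s^-1%g x)) ->
  max_ideal C M -> max_ideal C (conj_pred s M).
Proof.
move=> hs hsV [hI M1 hmax]; split; first exact: conj_pred_ideal.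
  by rewrite /conj_pred rmorph1.
move=> N hN MN.
have hN' : ideal C (conj_pred s^-1%g N) by apply: conj_pred_ideal => //; rewrite invgK.
case: (hmax _ hN') => [x Mx|e|].
- by rewrite /conj_pred invgK; apply: MN; rewrite conj_predE.
- by left=> x; rewrite /conj_pred -e /conj_pred invgK galKV.
- by rewrite /conj_pred rmorph1; right.
Qed.

Lemma conj_pred_sq s M x : ideal_sq M x -> ideal_sq (conj_pred s M) (s x).
Proof.
move=> [n [a [b [Ma [Mb ->]]]]]; exists n, (s \o a), (s \o b).
split; first by move=> i; apply/conj_predE.
split; first by move=> i; apply/conj_predE.
by rewrite rmorph_sum; apply: eq_bigr => i _; rewrite rmorphM.
Qed.

Lemma conj_loc s C M I x : (forall y, C y -> C (s y)) ->
  (forall y, I y -> conj_pred s I (s y)) ->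
  loc_at C M I x -> loc_at C (conj_pred s M) (conj_pred s I) (s x).
Proof.
move=> hs _ [t [Ct Mt Itx]]; exists (s t); split; first exact: hs.
  by rewrite conj_predE.
by rewrite -rmorphM conj_predE.
Qed.

Section Cocycle.
Variables (f : G -> G -> K) (hf : normalized_cocycle f) (f0 : forall s t, f s t != 0).
Lemma cocycleE s t g : s (f t g) * f s (gcomp t g) = f s t * f (gcomp s t) g.
Proof. by case: hf. Qed.
Lemma cocycle1l s : f 1%g s = 1. Proof. by case: hf => _ /(_ s) []. Qed.
Lemma cocycle1r s : f s 1%g = 1. Proof. by case: hf => _ /(_ s) []. Qed.
Lemma cocycleV s : s (f s^-1%g s) = f s s^-1%g.
Proof. by have := cocycleE s s^-1%g s; rewrite gcompVl gcompVr cocycle1l cocycle1r !mulr1. Qed.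
Lemma cocycleV' s : s^-1%g (f s s^-1%g) = f s^-1%g s.
Proof. by rewrite -cocycleV galVK. Qed.
(** Obtained by applying s to the cocycle identity at (s^-1, s, t). As f(s, s^-1) is not in M^2, at
    most one of the two factors lies in M. *)
Lemma cocycle_dvd s t : f s t * s (f s^-1%g (gcomp s t)) = f s s^-1%g.
Proof.
have := cocycleE s^-1%g s t; rewrite gcompVl cocycle1l mulr1 => /(congr1 (fun x => s x)).
by rewrite rmorphM /= galKV cocycleV.
Qed.
End Cocycle.
End GalComposition.

(** * Splitting semilinear lattices *)

Lemma total_preorder_min (T : finType) (P : T -> Prop) (le : T -> T -> Prop) (x0 : T) :
  P x0 -> (forall x y, P x -> P y -> le x y \/ le y x) ->
  (forall x y z, P x -> P y -> P z -> le x y -> le y z -> le x z) ->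
  exists2 m, P m & forall y, P y -> le m y.
Proof.
move=> Px0 tot trans.
suff [m Pm h] : exists2 m, P m & forall y, y \in enum T -> P y -> le m y.
  by exists m => // y; apply: h; rewrite mem_enum.
elim: (enum T) => [|a s [m Pm IH]]; first by exists x0.
case: (pselect (P a)) => [Pa|nPa]; last first.
  by exists m => // y; rewrite inE => /orP [/eqP -> //|/IH].
have aa : le a a by case: (tot a a).
case: (tot m a) => // h.
  by exists m => // y; rewrite inE => /orP [/eqP -> //|/IH].
exists a => // y; rewrite inE => /orP [/eqP -> //|ys Py].
by apply: (trans _ m) => //; exact: IH.
Qed.

(** Unlike [ideal], this does not require [I] to lie inside [C], so that localizations of [C]
    qualify. *)
Definition submodule_pred (R : fieldType) (C I : R -> Prop) : Prop :=
  [/\ I 0, (forall x y, I x -> I y -> I (x + y)) & (forall a x, C a -> I x -> I (a * x))].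

Section SubmodulePred.
Variables (R : fieldType) (C : R -> Prop) (hC : subring C).
Lemma submodule_self : submodule_pred C C.
Proof. by split; [exact: subring0 | exact: subringD | exact: subringM]. Qed.
Lemma submodule_loc M : max_ideal C M -> submodule_pred C (loc_at C M C).
Proof.
move=> hM; have hl := loc_subring hC hM; split; [exact: subring0 | exact: subringD | ].
by move=> a x Ca; apply: (subringM hl); exact: loc_sub.
Qed.
Lemma submodule_mloc M : max_ideal C M -> submodule_pred C (loc_at C M M).
Proof.
move=> hM; have hm := mloc_ideal hC hM; split; [exact: ideal0 hm | exact: (idealD hm) | ].
by move=> a x Ca; apply: (idealMl hm); exact: loc_sub.
Qed.
Lemma mx_in_submodule I m n p (A : 'M[R]_(m, n)) (B : 'M_(n, p)) : submodule_pred C I ->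
  mx_in I A -> mx_in C B -> mx_in I (A *m B).
Proof.
move=> [I0 ID IM] hA hB i j; rewrite mxE; elim/big_ind: _ => // k _.
by rewrite mulrC; exact: IM.
Qed.

Section Span.
Variables (k n : nat) (W : 'M[R]_(k, n)).
(** The choice of [I] gives the lattice itself, its localization at M, or the latter multiplied by
    the maximal ideal. *)
Definition row_span (I : R -> Prop) (z : 'rV[R]_n) := exists2 u : 'rV_k, mx_in I u & z = u *m W.
Lemma row_span0 I : submodule_pred C I -> row_span I 0.
Proof. by case=> I0 _ _; exists 0; rewrite ?mul0mx // => i j; rewrite mxE. Qed.
Lemma row_spanD I a b : submodule_pred C I -> row_span I a -> row_span I b -> row_span I (a + b).
Proof.
move=> [_ ID _] [u hu ->] [v hv ->]; exists (u + v); last by rewrite mulmxDl.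
by move=> i j; rewrite mxE; exact: ID.
Qed.
Lemma row_span_sum I J (r : seq J) (P : pred J) (E : J -> 'rV_n) : submodule_pred C I ->
  (forall i, P i -> row_span I (E i)) -> row_span I (\sum_(i <- r | P i) E i).
Proof.
move=> hI h; elim/big_ind: _ => //; first exact: row_span0.
by move=> x y; exact: row_spanD.
Qed.
Lemma row_spanZ I J c z : (forall x, I x -> J (c * x)) -> row_span I z -> row_span J (c *: z).
Proof.
move=> h [u hu ->]; exists (c *: u); last by rewrite scalemxAl.
by move=> i j; rewrite mxE; exact: h.
Qed.
Lemma row_span_row j : row_span C (row j W).
Proof. by exists (delta_mx 0 j); [exact: mx_in_delta | rewrite -rowE]. Qed.
End Span.
End SubmodulePred.

Section Core.
Variables (F : fieldType) (K : splittingFieldType F).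
Local Notation G := (gal_of {:K}).
Variables (C : K -> Prop) (hC : subring C) (r : nat) (Ms : 'I_r -> K -> Prop).
Hypothesis hMs : forall i, max_ideal C (Ms i).
Hypothesis Ms_inj : forall i j, (forall x, Ms i x <-> Ms j x) -> i = j.
Hypothesis Ms_all : forall M, max_ideal C M -> exists i, forall x, M x <-> Ms i x.
Hypothesis hval : forall M x, max_ideal C M ->
  exists t, [/\ C t, ~ M t & C (t * x) \/ C (t * x^-1)].
Variables (H : {group G}) (hst : forall s x, s \in H -> C x -> C (s x)).
Variables (f : G -> G -> K) (hf : normalized_cocycle f) (f0 : forall s t, f s t != 0).
Hypothesis fC : forall s t, s \in H -> t \in H -> C (f s t).
Hypothesis fsq : forall M s, max_ideal C M -> s \in H -> ~ ideal_sq M (f s s^-1%g).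
Variables (t : K) (Ct : C t).
(** This sum is the scalar by which [Phi] acts at M modulo [Q M]; see [Phi_congr]. *)
Hypothesis ht : forall M, max_ideal C M ->
  ~ M (\sum_(s in H | ~~ `[< M (f s s^-1%g) >]) s t).

(* In the application, [xi s] is left multiplication by x_s on a left ideal. *)
Variables (n : nat) (xi : G -> 'rV[K]_n -> 'rV[K]_n).
Hypothesis xiD : forall s a b, xi s (a + b) = xi s a + xi s b.
Hypothesis xiZ : forall s (c : K) a, xi s (c *: a) = s c *: xi s a.
Hypothesis xiM : forall s u a, xi s (xi u a) = f s u *: xi (gcomp s u) a.
Hypothesis xi1 : forall a, xi 1%g a = a.

Local Notation cj := conj_pred.

Let cjmax s M : s \in H -> max_ideal C M -> max_ideal C (cj s M).
Proof. by move=> hs; apply: conj_pred_max => x; apply: hst; rewrite ?groupV. Qed.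
Let cjmaxV s M : s \in H -> max_ideal C M -> max_ideal C (cj s^-1%g M).
Proof. by move=> hs; apply: cjmax; rewrite groupV. Qed.
Let loc_cj s M x : s \in H -> loc_at C M C x -> loc_at C (cj s M) C (s x).
Proof.
move=> hs [c [Cc Mc Ccx]]; exists (s c); split; [exact: hst | by rewrite conj_predE|].
by rewrite -rmorphM; exact: hst.
Qed.
Let mloc_cj s M x : s \in H -> loc_at C M M x -> loc_at C (cj s M) (cj s M) (s x).
Proof. by move=> hs; apply: conj_loc => [y|y My]; [exact: hst|apply/conj_predE]. Qed.

Let xi0 s : xi s 0 = 0.
Proof. by rewrite -[X in xi s X](scale0r 0) xiZ rmorph0 scale0r. Qed.
Let xi_sum s I (l : seq I) (P : pred I) (E : I -> 'rV_n) :
  xi s (\sum_(i <- l | P i) E i) = \sum_(i <- l | P i) xi s (E i).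
Proof. by apply: (big_morph (xi s)) => //; exact: xi0. Qed.
Let xiN s a : xi s (- a) = - xi s a.
Proof. by rewrite -scaleN1r xiZ rmorphN1 scaleN1r. Qed.

Definition sl_rows (k : nat) (op : 'rV[K]_n -> 'rV[K]_n) (A : 'M[K]_(k, n)) : 'M_(k, n) :=
  \matrix_(i < k) op (row i A).

Let xi_mul k s (u : 'rV_k) (A : 'M_(k, n)) : xi s (u *m A) = map_mx s u *m sl_rows (xi s) A.
Proof.
rewrite !mulmx_sum_row xi_sum; apply: eq_bigr => i _.
by rewrite xiZ rowK !mxE.
Qed.

(** Left multiplication by x_s^-1, since x_(s^-1) x_s = f(s^-1, s). *)
Definition xi_inv s z := (f s^-1%g s)^-1 *: xi s^-1%g z.
Local Notation Y := xi_inv.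
Let YK s z : Y s (xi s z) = z.
Proof. by rewrite /Y xiM gcompVl xi1 scalerA mulVf ?scale1r. Qed.
Let KY s z : xi s (Y s z) = z.
Proof.
by rewrite /Y xiZ xiM gcompVr xi1 scalerA fmorphV /= (cocycleV hf) mulVf ?scale1r.
Qed.
Let xi_injective s : injective (xi s).
Proof. exact: can_inj (YK s). Qed.
Let YZ s (c : K) z : Y s (c *: z) = s^-1%g c *: Y s z.
Proof. by rewrite /Y xiZ !scalerA mulrC. Qed.
Let YD s a b : Y s (a + b) = Y s a + Y s b.
Proof. by rewrite /Y xiD scalerDr. Qed.
Let Y_mul k s (u : 'rV_k) (A : 'M_(k, n)) : Y s (u *m A) = map_mx s^-1%g u *m sl_rows (Y s) A.
Proof.
rewrite {1}/Y xi_mul scalemxAr; congr (_ *m _).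
by apply/row_matrixP => i; rewrite linearZ /= !rowK.
Qed.
Let Y1 z : Y 1%g z = z.
Proof. by apply: (xi_injective (s := 1%g)); rewrite KY xi1. Qed.

Section Basis.
Variables (k : nat) (W : 'M[K]_(k, n)) (Z0 : 'M[K]_(n, k)).
Hypothesis WZ0 : W *m Z0 = 1%:M.
Hypothesis hW : forall s j, s \in H -> row_span W C (xi s (row j W)).

Local Notation lX := (row_span W).
Local Notation loc M := (loc_at C M C).
Local Notation mloc M := (loc_at C M M).

Let lX_xi s I J z : s \in H -> submodule_pred C J -> (forall x, I x -> J (s x)) ->
  lX I z -> lX J (xi s z).
Proof.
move=> hs hJ hIJ [u hu ->]; rewrite xi_mul mulmx_sum_row.
apply: (row_span_sum _ hJ) => i _; rewrite rowK !mxE.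
apply: (@row_spanZ _ _ _ W C J) => [x Cx|]; last exact: hW.
by case: hJ => _ _ h; rewrite mulrC; apply: h => //; exact: hIJ.
Qed.
Let lX_loc s M z : s \in H -> max_ideal C M -> lX (loc M) z -> lX (loc (cj s M)) (xi s z).
Proof.
move=> hs hM; apply: lX_xi => //; last by move=> x; exact: loc_cj.
by apply: submodule_loc => //; exact: cjmax.
Qed.
Let lX_mloc s M z : s \in H -> max_ideal C M -> lX (mloc M) z -> lX (mloc (cj s M)) (xi s z).
Proof.
move=> hs hM; apply: lX_xi => //; last by move=> x; exact: mloc_cj.
by apply: submodule_mloc => //; exact: cjmax.
Qed.

(* [Q M] is the localization at M of M times the sum of the lattices x_s^{-1} X, which form a
   chain by [le_total]. *)
Let Q M z := exists2 s, s \in H & lX (mloc (cj s M)) (xi s z).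

Let Q_mloc M z : lX (mloc M) z -> Q M z.
Proof. by move=> h; exists 1%g; rewrite ?group1 // conj_pred1 xi1. Qed.
Let Q0 M : max_ideal C M -> Q M 0.
Proof. by move=> hM; apply: Q_mloc; apply: row_span0; exact: submodule_mloc. Qed.

(** Since x_(u s^-1) x_s = f(u s^-1, s) x_u, a unit value of f at u M implies that, at M, the
    lattice x_s^-1 X is contained in x_u^-1 X; this is [Q_move]. *)
Let le M s u := ~ cj u M (f (gcomp u s^-1%g) s).

(** For q = u s^-1, [cocycle_dvd] factors f(q, q^-1) as f(q, s) times a conjugate of f(q^-1, u). If
    both comparisons failed, both factors would lie in u M and the product in its square. *)
Let le_total M s u : max_ideal C M -> s \in H -> u \in H -> le M s u \/ le M u s.
Proof.
move=> hM hs hu; apply: contrapT => /not_orP [/contrapT h1 /contrapT h2].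
pose q := gcomp u s^-1%g.
have hq : q \in H by rewrite gcomp_in ?groupV.
apply: (fsq (cjmax hu hM) hq); exists 1, (fun _ => f q s), (fun _ => q (f q^-1%g u)); split=> //.
split; last by rewrite big_ord1 -(cocycle_dvd hf q s) gcompK.
move=> _; have : cj q (cj s M) (q (f (gcomp s u^-1%g) u)) by apply/conj_predE.
by rewrite -conj_pred_comp gcompK /q /gcomp invMg invgK.
Qed.

Let le_trans M a b c : max_ideal C M -> a \in H -> b \in H -> c \in H ->
  le M a b -> le M b c -> le M a c.
Proof.
move=> hM ha hb hc h1 h2 h3; have hcM := cjmax hc hM.
have hin x y : x \in H -> y \in H -> gcomp x y^-1%g \in H.
  by move=> hx hy; rewrite gcomp_in ?groupV.
have := cocycleE hf (gcomp c b^-1%g) (gcomp b a^-1%g) a.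
rewrite gcompK gcompA gcompK => e.
have : ~ cj c M ((gcomp c b^-1%g) (f (gcomp b a^-1%g) a) * f (gcomp c b^-1%g) b).
  apply: (max_ideal_nM hC hcM) => //.
  - by apply: hst; [exact: hin | apply: fC => //; exact: hin].
  - by apply: fC => //; exact: hin.
  - have -> : cj c M = cj (gcomp c b^-1%g) (cj b M) by rewrite -conj_pred_comp gcompK.
    by rewrite conj_predE.
apply; rewrite e; apply: (idealMl (max_ideal_ideal hcM)) => //.
by apply: fC; exact: hin.
Qed.

Let Q_move M a b z : max_ideal C M -> a \in H -> b \in H -> le M a b ->
  lX (mloc (cj a M)) (xi a z) -> lX (mloc (cj b M)) (xi b z).
Proof.
move=> hM ha hb hab hz; pose q := gcomp b a^-1%g.
have hq : q \in H by rewrite gcomp_in ?groupV.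
have -> : xi b z = (f q a)^-1 *: xi q (xi a z).
  by rewrite xiM gcompK scalerA mulVf // scale1r.
have -> : cj b M = cj q (cj a M) by rewrite -conj_pred_comp gcompK.
have hM' : max_ideal C (cj q (cj a M)) by rewrite -conj_pred_comp gcompK; exact: cjmax.
apply: (@row_spanZ _ _ _ W (mloc (cj q (cj a M)))); last first.
  by apply: lX_mloc => //; exact: cjmax.
move=> x; apply: (idealMl (mloc_ideal hC hM')); apply: loc_inv_sub => //; first exact: fC.
by rewrite -conj_pred_comp gcompK.
Qed.

Let QD M x y : max_ideal C M -> Q M x -> Q M y -> Q M (x + y).
Proof.
move=> hM [a ha hx] [b hb hy]; case: (le_total hM ha hb) => h; [exists b|exists a] => //;
  rewrite xiD; apply: row_spanD => //; try by apply: submodule_mloc => //; exact: cjmax.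
  exact: (Q_move hM ha hb h hx).
exact: (Q_move hM hb ha h hy).
Qed.
Let Q_sum M I (l : seq I) (P : pred I) (E : I -> 'rV_n) : max_ideal C M ->
  (forall i, P i -> Q M (E i)) -> Q M (\sum_(i <- l | P i) E i).
Proof.
move=> hM h; elim/big_ind: _ => //; [exact: Q0 | by move=> x y; exact: QD].
Qed.
Let QZ M c z : max_ideal C M -> loc M c -> Q M z -> Q M (c *: z).
Proof.
move=> hM hc [s hs h]; exists s => //; rewrite xiZ; apply: (row_spanZ _ h) => x.
by apply: (idealMl (mloc_ideal hC (cjmax hs hM))); exact: loc_cj.
Qed.
Let Q_xi M s z : max_ideal C M -> s \in H -> Q M z -> Q (cj s M) (xi s z).
Proof.
move=> hM hs [a ha h]; pose q := gcomp a s^-1%g.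
have hq : q \in H by rewrite gcomp_in ?groupV.
exists q => //; rewrite -conj_pred_comp xiM gcompK; apply: (row_spanZ _ h) => x.
apply: (idealMl (mloc_ideal hC (cjmax ha hM))); apply: loc_sub => //; [exact: cjmax|exact: fC].
Qed.
Let Q_Y M s j c : max_ideal C M -> s \in H -> mloc M c -> Q M (c *: Y s (row j W)).
Proof.
move=> hM hs hc; exists s => //; rewrite xiZ KY.
apply: (row_spanZ _ (row_span_row hC W j)) => x Cx.
apply: (idealMr (mloc_ideal hC (cjmax hs hM))); [exact: (loc_sub hC (cjmax hs hM) Cx) | exact: mloc_cj].
Qed.

(** The map p is z -> z N W. With Yb a basis of X' and D 1 the coordinates of the basis W of X in
    it, N takes coordinates in Yb and then applies a generalized inverse Qm of D 1. On X the error
    is governed by D 1 Qm D 1 - D 1, whose entries lie in every maximal ideal. *)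
Let projector : exists2 N : 'M[K]_(n, k),
  (forall s, s \in H -> mx_in C (sl_rows (Y s) W *m N)) &
  (forall M z, max_ideal C M -> lX (loc M) z -> Q M (z *m N *m W - z)).
Proof.
(* The rows generate X', the sum of the x_s^-1 X over s in H; indices outside H contribute zero
   rows. *)
pose W' : 'M[K]_(#|{: G * 'I_k}|, n) :=
  \matrix_i (let p := enum_val i in if p.1 \in H then Y p.1 (row p.2 W) else 0).
have [q [Yb [Z [P [S [PC SC eW eY eZ]]]]]] := free_span hC hMs Ms_inj Ms_all hval W'.
pose D s : 'M_(k, q) := \matrix_(j, l) P (enum_rank (s, j)) l.
have DC s : mx_in C (D s) by move=> i j; rewrite mxE.
have eD s : s \in H -> sl_rows (Y s) W = D s *m Yb.
  move=> hs; apply/row_matrixP => j; rewrite rowK row_mul.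
  have -> : row j (D s) = row (enum_rank (s, j)) P by apply/rowP => l; rewrite !mxE.
  by rewrite -row_mul -eW rowK enum_rankK /= hs.
have eW1 : W = D 1%g *m Yb.
  by rewrite -eD ?group1 //; apply/row_matrixP => j; rewrite rowK Y1.
have [Qm QC hQm] := regular_inverse hC hMs Ms_inj Ms_all (DC 1%g).
exists (Z *m Qm) => [s hs|M z hM [u hu ->]].
  by rewrite eD // -mulmxA (mulmxA Yb) eZ mul1mx; exact: mx_inM.
have -> : u *m W *m (Z *m Qm) *m W - u *m W =
    (u *m (D 1%g *m Qm *m D 1%g - D 1%g)) *m S *m W'.
  rewrite -[_ *m S *m W']mulmxA -eY [in LHS]eW1 mulmxBr mulmxBl !mulmxA; congr (_ - _).
  by rewrite -[u *m _ *m Yb *m Z]mulmxA eZ mulmx1.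
set v := _ *m S.
have hv : mx_in (mloc M) v.
  apply: (mx_in_submodule (submodule_mloc hC hM)) => //.
  have hD := hQm _ hM => i j; rewrite mxE; apply: (ideal_sum (mloc_ideal hC hM)) => l _.
  apply: (idealMl (mloc_ideal hC hM)); [exact: hu | apply: mloc_sub => //; exact: hD].
rewrite mulmx_sum_row; apply: Q_sum => // i _; rewrite rowK /=.
case: ifP => hi; last by rewrite scaler0; exact: Q0.
by apply: Q_Y => //; exact: hv.
Qed.

Section Phi.
Variable N : 'M[K]_(n, k).
Hypothesis hN1 : forall s, s \in H -> mx_in C (sl_rows (Y s) W *m N).
Hypothesis hN2 : forall M z, max_ideal C M -> lX (loc M) z -> Q M (z *m N *m W - z).

Let Phi z := \sum_(s in H) xi s (t *: (Y s z *m N *m W)).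

Let PhiD a b : Phi (a + b) = Phi a + Phi b.
Proof.
rewrite /Phi -big_split; apply: eq_bigr => s _ /=.
by rewrite YD !mulmxDl scalerDr xiD.
Qed.
Let PhiZ c a : Phi (c *: a) = c *: Phi a.
Proof.
rewrite /Phi scaler_sumr; apply: eq_bigr => s _.
by rewrite YZ -2!scalemxAl scalerA mulrC -scalerA xiZ galKV.
Qed.
Let Phi_sum I (l : seq I) (P : pred I) (E : I -> 'rV_n) :
  Phi (\sum_(i <- l | P i) E i) = \sum_(i <- l | P i) Phi (E i).
Proof.
apply: (big_morph Phi) => //; rewrite -[X in Phi X](scale0r 0) PhiZ scale0r //.
Qed.
Let Phi_mul m (u : 'rV_m) (A : 'M_(m, n)) : Phi (u *m A) = u *m sl_rows Phi A.
Proof.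
rewrite !mulmx_sum_row Phi_sum; apply: eq_bigr => i _.
by rewrite PhiZ rowK.
Qed.
(** Composition with s permutes the summands, and the scalars it introduces pass through the
    K-linear map given by N W. *)
Let Phi_xi s z : s \in H -> Phi (xi s z) = xi s (Phi z).
Proof.
move=> hs; rewrite /Phi xi_sum.
rewrite (reindex_inj (h := fun u => gcomp s u)) /=; last first.
  by move=> a b e; rewrite -[a](gcompVK s) e gcompVK.
apply: eq_big => [u|u hu].
  by rewrite /gcomp groupMr.
rewrite xiM; have -> : Y (gcomp s u) (xi s z) = (gcomp s u)^-1%g (f s u) *: Y u z.
  apply: (xi_injective (s := gcomp s u)).
  by rewrite KY xiZ galKV -xiM KY.
by rewrite -2!scalemxAl scalerA mulrC -scalerA xiZ galKV.
Qed.

Let Y_span s M z : s \in H -> max_ideal C M -> lX (loc M) z ->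
  lX (loc (cj s^-1%g M)) (t *: (Y s z *m N *m W)).
Proof.
move=> hs hM [u hu ->]; rewrite Y_mul -(mulmxA _ _ N).
have hM' := cjmaxV hs hM; have hl := submodule_loc hC hM'.
exists (t *: (map_mx s^-1%g u *m (sl_rows (Y s) W *m N))); last by rewrite scalemxAl.
move=> i j; rewrite mxE; have [_ _ h] := hl; apply: h => //.
apply: (mx_in_submodule hl); last exact: hN1.
by move=> a b; rewrite mxE; apply: loc_cj; rewrite ?groupV.
Qed.

Let Phi_lX z : lX C z -> lX C (Phi z).
Proof.
have hcm := submodule_self hC.
move=> [u hu ->]; apply: (row_span_sum _ hcm) => s hs.
apply: (@lX_xi s C C) => // [x|]; first exact: hst.
rewrite Y_mul -(mulmxA _ _ N).
exists (t *: (map_mx s^-1%g u *m (sl_rows (Y s) W *m N))); last by rewrite scalemxAl.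
apply: mx_inZ => //; apply: (mx_in_submodule hcm); last exact: hN1.
by move=> i j; rewrite mxE; apply: hst; rewrite ?groupV.
Qed.

(** If f(s, s^-1) is in M, the summand of s falls into [Q M], because x_(s^-1) x_s contributes a
    factor in s^-1 M. Otherwise x_s^-1 z still lies in the lattice at s^-1 M, where p is the
    identity modulo [Q], and the summand is s(t) z. *)
Let Phi_congr M z : max_ideal C M -> lX (loc M) z ->
  Q M (Phi z - (\sum_(s in H | ~~ `[< M (f s s^-1%g) >]) s t) *: z).
Proof.
move=> hM hz; rewrite big_mkcondr scaler_suml -sumrB; apply: Q_sum => // s hs.
have hM' := cjmaxV hs hM; have hsV : s^-1%g \in H by rewrite groupV.
have fV : cj s^-1%g M (f s^-1%g s) <-> M (f s s^-1%g).
  by rewrite -(cocycleV' hf) conj_predE.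
case: asboolP => hg /=.
  rewrite scale0r subr0; exists s^-1%g => //; rewrite xiM gcompVl xi1.
  apply: (row_spanZ _ (Y_span hs hM hz)) => x lx.
  by apply: (idealMr (mloc_ideal hC hM') lx); apply: mloc_sub => //; apply/fV.
have -> : xi s (t *: (Y s z *m N *m W)) - s t *: z =
    xi s (t *: (Y s z *m N *m W - Y s z)).
  by rewrite scalerBr xiD xiN [xi s (t *: Y s z)]xiZ KY.
rewrite -[M](conj_predKV s); apply: Q_xi => //; apply: QZ => //; first exact: loc_sub.
apply: hN2 => //; apply: (@row_spanZ _ _ _ W (loc (cj s^-1%g M))); last exact: lX_loc.
move=> x; apply: (subringM (loc_subring hC hM')); apply: loc_inv_sub => //; first exact: fC.
by rewrite fV.
Qed.

Let Q_Phi M z : max_ideal C M -> lX (loc M) z -> Q M (Phi z) -> Q M z.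
Proof.
move=> hM hz hP; set c := \sum_(s in H | ~~ `[< M (f s s^-1%g) >]) s t.
have Cc : C c by apply: subring_sum => // s /andP [hs _]; exact: hst.
have c0 : c != 0 := max_ideal_neq0 hM (ht hM).
have -> : z = c^-1 *: (Phi z + -1 *: (Phi z - c *: z)).
  by rewrite scaleN1r opprB addrC subrK scalerA mulVf ?scale1r.
apply: QZ => //; first exact: loc_inv_sub (ht hM).
apply: QD => //; apply: QZ => //; last exact: Phi_congr.
by apply: loc_sub => //; apply: subringN => //; exact: subring1.
Qed.


(* Among the [s] with [xi s z] in the maximal ideal times the lattice, take [rho] minimal and
   divide [z] by a generator: the result violates [Q_Phi]. *)
Let mloc_Phi M z : max_ideal C M -> lX (loc M) z -> lX (mloc M) (Phi z) -> lX (mloc M) z.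
Proof.
move=> hM hz hP; apply: contrapT => nz.
have [s0 hs0 h0] := Q_Phi hM hz (Q_mloc hP).
pose Pr s := s \in H /\ lX (mloc (cj s M)) (xi s z).
have [||rho [hr hrz] hmin] := @total_preorder_min G Pr (le M) s0 (conj hs0 h0).
- by move=> a b [ha _] [hb _]; exact: le_total.
- by move=> a b c [ha _] [hb _] [hc _]; exact: le_trans.
have hrV : rho^-1%g \in H by rewrite groupV.
pose g := f rho^-1%g rho.
have Cg : C g by exact: fC.
have g0 : g != 0 by exact: f0.
have hN := cjmax hr hM; set N' := cj rho M in hN.
(* If g were a unit at M, multiplication by x_(rho^-1) would bring x_rho z back to z without leaving
   the maximal ideal times the lattice. *)
have Mg : M g.
  apply: contrapT => nMg; apply: nz.
  have -> : z = g^-1 *: xi rho^-1%g (xi rho z).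
    by rewrite xiM gcompVl xi1 scalerA mulVf ?scale1r.
  apply: (@row_spanZ _ _ _ W (mloc M)) => [x|].
    by apply: (idealMl (mloc_ideal hC hM)); exact: loc_inv_sub.
  by rewrite -[M](conj_predVK rho); apply: lX_mloc.
pose y := xi rho (g^-1 *: z).
have ey : y = (f rho rho^-1%g)^-1 *: xi rho z.
  by rewrite /y xiZ fmorphV /= (cocycleV hf).
have Ng : N' (f rho rho^-1%g) by rewrite -(cocycleV hf) /N' conj_predE.
have hy : lX (loc N') y.
  rewrite ey; apply: (row_spanZ _ hrz) => x hx; rewrite mulrC.
  by apply: (mloc_div hC hN (fun x => hval x hN)) => //; exact: fsq.
(* The division by g is arranged so that x_(rho^-1) Phi(y) is exactly Phi(z), which lies in the
   maximal ideal times the lattice by assumption. *)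
have Qy : Q N' y.
  apply: Q_Phi => //; exists rho^-1%g => //.
  rewrite Phi_xi // PhiZ xiM gcompVl xi1 scalerA mulfV // scale1r.
  by rewrite conj_predVK.
case: Qy => kap hk hky; pose lam := gcomp kap rho.
have hl : lam \in H by exact: gcomp_in.
have eP : cj kap N' = cj lam M by rewrite /lam conj_pred_comp.
rewrite eP in hky; have hlM := cjmax hl hM.
have fk0 : f kap rho != 0 by exact: f0.
have lg0 : lam g != 0 by rewrite fmorph_eq0.
have e : xi lam z = (lam g / f kap rho) *: xi kap y.
  by rewrite /y xiM xiZ !scalerA fmorphV /= divfK // divff // scale1r.
(* If f(kap, rho) is a nonunit at lam M, it generates the maximal ideal there and divides lam(g).
   Then lam competes with rho, and the minimality of rho says that f(kap, rho) is a unit, a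
   contradiction. *)
case: (pselect (cj lam M (f kap rho))) => hfP.
  have hf2 : ~ ideal_sq (cj lam M) (f kap rho).
    move=> h; apply: (fsq hlM hk); rewrite -(cocycle_dvd hf kap rho).
    apply: (ideal_sqMr (max_ideal_ideal hlM)) => //.
    by apply: hst => //; apply: fC; rewrite ?groupV.
  have Plam : Pr lam.
    split=> //; rewrite e; apply: (row_spanZ _ hky) => x.
    apply: (idealMl (mloc_ideal hC hlM)).
    apply: (mloc_div hC hlM (fun x => hval x hlM)) => //.
    by apply: mloc_sub => //; rewrite conj_predE.
  by apply: (hmin _ Plam); rewrite /lam gcompKV.
(* Now f(kap, rho) is a unit at lam M. The quotient g / f(lam^-1, lam) is integral at M, because g
   is in M and the denominator is a unit or a generator of the maximal ideal. *)
apply: nz.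
have -> : z = (g / f lam^-1%g lam) *: xi lam^-1%g ((f kap rho)^-1 *: xi kap y).
  rewrite -{1}[z](YK lam) e /Y xiZ rmorphM /= galVK [in RHS]xiZ !scalerA; congr (_ *: _).
  by rewrite mulrCA mulrA.
apply: (@row_spanZ _ _ _ W (mloc M)) => [x|].
  apply: (idealMl (mloc_ideal hC hM)).
  case: (pselect (M (f lam^-1%g lam))) => hfl.
    apply: (mloc_div hC hM (fun x => hval x hM)) => //; last exact: mloc_sub.
    by rewrite -{2}[lam]invgK; apply: fsq; rewrite ?groupV.
  apply: (subringM (loc_subring hC hM)); first exact: loc_sub.
  by apply: loc_inv_sub => //; apply: fC; rewrite ?groupV.
rewrite -[M](conj_predVK lam); apply: lX_mloc => //; first by rewrite groupV.
apply: (row_spanZ _ hky) => x; apply: (idealMl (mloc_ideal hC hlM)).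
by apply: loc_inv_sub => //; exact: fC.
Qed.

(** The dual basis comes from writing the identity as Phi^-1 Phi: the functionals are t times the
    coordinates of N, and the vectors w_j are the images of the basis W under Phi^-1. *)
Lemma splitting_of_projector : exists m (c : 'I_m -> 'cV[K]_n) (w : 'I_m -> 'rV[K]_n),
  [/\ forall j, lX C (w j),
      forall z s j, s \in H -> lX C z -> C ((Y s z *m c j) 0 0) &
      forall z, lX C z -> \sum_(s in H) xi s (\sum_j (Y s z *m c j) 0 0 *: w j) = z].
Proof.
have hcm := submodule_self hC.
pose P := sl_rows Phi W *m Z0.
have PhiW j : exists u : 'rV_k, mx_in C u /\ Phi (row j W) = u *m W.
  by have [|u hu e] := @Phi_lX (row j W); [exact: row_span_row | exists u].
have rP j : exists u : 'rV_k, [/\ mx_in C u, Phi (row j W) = u *m W & row j P = u].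
  have [u [hu e]] := PhiW j; exists u; split=> //.
  by rewrite row_mul rowK e -mulmxA WZ0 mulmx1.
have PC : mx_in C P.
  move=> i j; have [u [hu _ e]] := rP i.
  by move/rowP/(_ j): e; rewrite mxE => ->.
have eP : sl_rows Phi W = P *m W.
  by apply/row_matrixP => i; rewrite rowK row_mul; have [u [_ -> ->]] := rP i.
(* P is the matrix of Phi in the basis W, and [mloc_Phi] says that it is injective modulo every
   maximal ideal. *)
have [Pu PVC] : P \in unitmx /\ mx_in C (invmx P).
  apply: mx_inv_in => // M hM u uC hu.
  have [|||v hv e] := @mloc_Phi M (u *m W) => //.
  - by exists u => // i j; apply: loc_sub.
  - exists (u *m P); last by rewrite Phi_mul eP mulmxA.
    by move=> i j; apply: mloc_sub.
  - have -> : u = v by rewrite -[u]mulmx1 -[v]mulmx1 -WZ0 !mulmxA e.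
    move=> i j; apply: (mloc_inM hC hM); last exact: hv.
    have -> : v = u by rewrite -[u]mulmx1 -[v]mulmx1 -WZ0 !mulmxA e.
    exact: uC.
have Phi_inj u v : Phi (u *m W) = Phi (v *m W) -> u *m W = v *m W.
  rewrite !Phi_mul eP !mulmxA => /(congr1 (mulmx^~ Z0)).
  rewrite -!mulmxA WZ0 !mulmx1 => /(congr1 (mulmx^~ (invmx P))).
  by rewrite !mulmxK // => ->.
have entry s z j : (Y s z *m (t *: (N *m delta_mx j (0 : 'I_1)))) 0 0 = t * (Y s z *m N) 0 j.
  rewrite -scalemxAr mxE mulmxA; congr (_ * _); rewrite mxE (bigD1 j) //= [X in _ * X + _]mxE !eqxx mulr1.
  by rewrite big1 ?addr0 // => i ij; rewrite [X in _ * X]mxE (negPf ij) mulr0.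
exists k, (fun j => t *: (N *m delta_mx j (0 : 'I_1))), (fun j => row j (invmx P *m W)); split.
- move=> j; exists (row j (invmx P)); last by rewrite row_mul.
  by move=> a b; rewrite mxE.
- move=> z s j hs [u hu ->]; rewrite entry; apply: subringM => //.
  rewrite Y_mul -mulmxA; apply: (mx_in_submodule hcm); last exact: hN1.
  by move=> a b; rewrite mxE; apply: hst; rewrite ?groupV.
move=> z [u hu ez].
pose Th := \sum_(s in H) xi s (t *: (Y s z *m N *m (invmx P *m W))).
have -> : \sum_(s in H) xi s (\sum_j (Y s z *m (t *: (N *m delta_mx j (0 : 'I_1)))) 0 0 *:
     row j (invmx P *m W)) = Th.
  rewrite /Th; apply: eq_bigr => s _; congr (xi s _).
  rewrite mulmx_sum_row scaler_sumr; apply: eq_bigr => j _.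
  by rewrite entry scalerA.
have hT : submodule_pred C (fun _ => True) by split.
have [v _ eT] : lX (fun _ => True) Th.
  apply: (row_span_sum _ hT) => s hs.
  apply: (lX_xi (I := fun _ => True)) => //.
  by rewrite mulmxA scalemxAl; eexists; last by [].
(* Phi commutes with each x_s and maps the rows of P^-1 W to those of W, so applying it to both
   sides compares the summands one by one. *)
rewrite eT ez; apply: Phi_inj; rewrite -eT -ez /Th Phi_sum /Phi; apply: eq_bigr => s hs.
rewrite -/(Phi _) Phi_xi // PhiZ Phi_mul; congr (xi s (_ *: _)).
have -> : sl_rows Phi (invmx P *m W) = W.
  apply/row_matrixP => i; rewrite rowK row_mul Phi_mul eP mulmxA -!row_mul.
  by rewrite mulVmx // mul1mx.
by [].
Qed.
End Phi.

Lemma splitting_of_basis : exists m (c : 'I_m -> 'cV[K]_n) (w : 'I_m -> 'rV[K]_n),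
  [/\ forall j, lX C (w j),
      forall z s j, s \in H -> lX C z -> C ((Y s z *m c j) 0 0) &
      forall z, lX C z -> \sum_(s in H) xi s (\sum_j (Y s z *m c j) 0 0 *: w j) = z].
Proof. by have [N hN1 hN2] := projector; exact: (splitting_of_projector hN1 hN2). Qed.
End Basis.

(** The rows of [W] are only generators here; [free_span] replaces them by a basis of the same
    lattice. *)
Lemma semilinear_splitting k (W : 'M[K]_(k, n)) :
  (forall s j, s \in H -> row_span W C (xi s (row j W))) ->
  exists m (c : 'I_m -> 'cV[K]_n) (w : 'I_m -> 'rV[K]_n),
  [/\ forall j, row_span W C (w j),
      forall z s j, s \in H -> row_span W C z -> C ((xi_inv s z *m c j) 0 0) &
      forall z, row_span W C z ->
        \sum_(s in H) xi s (\sum_j (xi_inv s z *m c j) 0 0 *: w j) = z].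
Proof.
move=> hW; have [q [W0 [Z [P [S [PC SC eW eW0 eZ]]]]]] := free_span hC hMs Ms_inj Ms_all hval W.
have hcm := submodule_self hC.
have spanE z : row_span W C z <-> row_span W0 C z.
  split=> -[u hu ->].
    by rewrite eW mulmxA; exists (u *m P) => //; exact: mx_inM.
  by rewrite eW0 mulmxA; exists (u *m S) => //; exact: mx_inM.
have hW0 s j : s \in H -> row_span W0 C (xi s (row j W0)).
  move=> hs; apply/spanE; rewrite eW0 row_mul xi_mul mulmx_sum_row.
  apply: (row_span_sum _ hcm) => i _; rewrite rowK !mxE.
  apply: (@row_spanZ _ _ _ W C C) => [x|]; last exact: hW.
  by apply: subringM => //; exact: hst.
have [m [c [w [h1 h2 h3]]]] := splitting_of_basis eZ hW0.
exists m, c, w; split.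
- by move=> j; apply/spanE.
- by move=> z s j hs /spanE; exact: h2.
- by move=> z /spanE; exact: h3.
Qed.
End Core.

(** * Crossed products *)

Section CrossedProduct.
Variables (F : fieldType) (K : splittingFieldType F).
Local Notation G := (gal_of {:K}).
Local Notation A := {ffun G -> K}.
Variables (f : G -> G -> K) (hf : normalized_cocycle f) (f0 : forall s t, f s t != 0).
Local Notation "a ** b" := (cp_mul f a b) (at level 40).

Lemma cp_mulE a b r : (a ** b) r = \sum_s a s * s (b (gcomp s^-1%g r)) * f s (gcomp s^-1%g r).
Proof.
rewrite ffunE; apply: eq_bigr => s _.
rewrite (bigD1 (gcomp s^-1%g r)) //= gcompVVK eqxx big1 ?addr0 // => t /eqP nt.
by case: eqP => // e; case: nt; rewrite -e gcompVK.
Qed.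
Lemma cp_mulDl a b c : (a + b) ** c = a ** c + b ** c.
Proof.
apply/ffunP => r; rewrite [RHS]ffunE !cp_mulE -big_split; apply: eq_bigr => s _.
by rewrite ffunE !mulrDl.
Qed.
Lemma cp_mulDr a b c : a ** (b + c) = a ** b + a ** c.
Proof.
apply/ffunP => r; rewrite [RHS]ffunE !cp_mulE -big_split; apply: eq_bigr => s _.
by rewrite ffunE rmorphD /= mulrDr mulrDl.
Qed.
Lemma cp_mul0 a : a ** 0 = 0.
Proof. by apply: (addIr (a ** 0)); rewrite -cp_mulDr !add0r. Qed.
Lemma cp_0mul a : 0 ** a = 0.
Proof. by apply: (addIr (0 ** a)); rewrite -cp_mulDl !add0r. Qed.
Lemma cp_mul_sumr I (l : seq I) (P : pred I) (E : I -> A) a :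
  a ** (\sum_(i <- l | P i) E i) = \sum_(i <- l | P i) a ** E i.
Proof. by apply: (big_morph (cp_mul f a)); [exact: cp_mulDr | exact: cp_mul0]. Qed.

Lemma cp_mulA a b c : a ** (b ** c) = (a ** b) ** c.
Proof.
apply/ffunP => r; rewrite !cp_mulE.
under [RHS]eq_bigr do rewrite cp_mulE !mulr_suml.
rewrite [RHS]exchange_big /=; apply: eq_bigr => s _.
rewrite cp_mulE rmorph_sum mulr_sumr mulr_suml (reindex_inj (h := fun u => gcomp s^-1%g u)) /=; last first.
  by move=> x y e; rewrite -[x](gcompVVK s) e gcompVVK.
apply: eq_bigr => u _; set v := gcomp s^-1%g u; set w := gcomp u^-1%g r.
have ew : gcomp v^-1%g (gcomp s^-1%g r) = w by rewrite /v /w /gcomp invMg invgK mulgA mulgKV.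
rewrite ew; have := cocycleE hf s v w.
have -> : gcomp v w = gcomp s^-1%g r by rewrite -ew gcompVVK.
have eu : gcomp s v = u by rewrite gcompVVK.
rewrite eu !rmorphM /= -gcompE eu => e.
have -> : a s * (s (b v) * u (c w) * s (f v w)) * f s (gcomp s^-1%g r) =
  a s * (s (b v) * u (c w)) * (s (f v w) * f s (gcomp s^-1%g r)) by ring.
by rewrite e; ring.
Qed.

Definition cp_single (u : G) (c : K) : A := [ffun r => if r == u then c else 0].
Lemma cp_single_mul u c b r : (cp_single u c ** b) r = c * u (b (gcomp u^-1%g r)) * f u (gcomp u^-1%g r).
Proof.
rewrite cp_mulE (bigD1 u) //= ffunE eqxx big1 ?addr0 // => s /negPf h.
by rewrite ffunE h !mul0r.
Qed.
Lemma cp_mul_single u c b r :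
  (b ** cp_single u c) r = b (gcomp r u^-1%g) * (gcomp r u^-1%g) c * f (gcomp r u^-1%g) u.
Proof.
rewrite cp_mulE (bigD1 (gcomp r u^-1%g)) //= ffunE.
have -> : gcomp (gcomp r u^-1%g)^-1%g r = u by rewrite /gcomp invMg invgK mulgA mulgV mul1g.
rewrite eqxx big1 ?addr0 // => s ns; rewrite ffunE; case: eqP => [e|_]; last by rewrite rmorph0 mulr0 mul0r.
by case/eqP: ns; rewrite -e /gcomp invMg invgK mulgKV.
Qed.
Lemma cp_1mul b : cp_single 1%g 1 ** b = b.
Proof.
by apply/ffunP => r; rewrite cp_single_mul invg1 gcomp1l (cocycle1l hf) mul1r mulr1 gal1E.
Qed.

Section Left.
Variables (C : K -> Prop) (hC : subring C) (r : nat) (Ms : 'I_r -> K -> Prop).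
Hypothesis hMs : forall i, max_ideal C (Ms i).
Hypothesis Ms_inj : forall i j, (forall x, Ms i x <-> Ms j x) -> i = j.
Hypothesis Ms_all : forall M, max_ideal C M -> exists i, forall x, M x <-> Ms i x.
Hypothesis hval : forall M x, max_ideal C M ->
  exists t, [/\ C t, ~ M t & C (t * x) \/ C (t * x^-1)].
Variables (H : {group G}) (hst : forall s x, s \in H -> C x -> C (s x)).
Hypothesis fC : forall s t, s \in H -> t \in H -> C (f s t).
Hypothesis fsq : forall M s, max_ideal C M -> s \in H -> ~ ideal_sq M (f s s^-1%g).
Variables (t : K) (Ct : C t).
Hypothesis ht : forall M, max_ideal C M ->
  ~ M (\sum_(s in H | ~~ `[< M (f s s^-1%g) >]) s t).

Let n := #|{: G}|.
Let toR (a : A) : 'rV[K]_n := \row_i a (enum_val i).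
Let ofR (v : 'rV[K]_n) : A := [ffun s => v 0 (enum_rank s)].
Let toRK : cancel toR ofR.
Proof. by move=> a; apply/ffunP => s; rewrite ffunE mxE enum_rankK. Qed.
Let ofRK : cancel ofR toR.
Proof. by move=> v; apply/rowP => i; rewrite mxE ffunE enum_valK. Qed.
Let toRD a b : toR (a + b) = toR a + toR b.
Proof. by apply/rowP => i; rewrite !mxE ffunE. Qed.
Let toR0 : toR 0 = 0.
Proof. by apply/rowP => i; rewrite !mxE ffunE. Qed.
Let toR_sum I (l : seq I) (P : pred I) (E : I -> A) :
  toR (\sum_(i <- l | P i) E i) = \sum_(i <- l | P i) toR (E i).
Proof. exact: (big_morph toR toRD toR0). Qed.

Let xi (s : G) (v : 'rV[K]_n) : 'rV[K]_n :=
  \row_i (s (v 0 (enum_rank (gcomp s^-1%g (enum_val i)))) * f s (gcomp s^-1%g (enum_val i))).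
Let xiD (s : G) a b : xi s (a + b) = xi s a + xi s b.
Proof. by apply/rowP => i; rewrite !mxE rmorphD mulrDl. Qed.
Let xiZ s (c : K) a : xi s (c *: a) = s c *: xi s a.
Proof. by apply/rowP => i; rewrite !mxE rmorphM mulrA. Qed.
Let xiM s u a : xi s (xi u a) = f s u *: xi (gcomp s u) a.
Proof.
apply/rowP => i; rewrite !mxE enum_rankK rmorphM /= -gcompE.
set q := enum_val i; set w := gcomp u^-1%g (gcomp s^-1%g q).
have ew : gcomp (gcomp s u)^-1%g q = w by rewrite /w /gcomp invMg mulgA.
by rewrite ew; have := cocycleE hf s u w; rewrite gcompVVK -mulrA => ->; rewrite mulrCA.
Qed.
Let xi1 a : xi 1%g a = a.
Proof.
by apply/rowP => i; rewrite mxE invg1 gcomp1l (cocycle1l hf) mulr1 gal1E enum_valK.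
Qed.
Let toR_mul a b : toR (a ** b) = \sum_s a s *: xi s (toR b).
Proof.
apply/rowP => i; rewrite mxE summxE cp_mulE; apply: eq_bigr => s _.
by rewrite !mxE enum_rankK mulrA.
Qed.

Local Notation P := (cp_set C (fun s => s \in H)).
Let Pin a s : P a -> s \in H -> C (a s).
Proof. by move=> h; case: (h s). Qed.
Let Pout a s : P a -> s \notin H -> a s = 0.
Proof. by move=> h /negP; case: (h s). Qed.
Let toR_mulP a b : P a -> toR (a ** b) = \sum_(s in H) a s *: xi s (toR b).
Proof.
move=> Pa; rewrite toR_mul [RHS]big_mkcond; apply: eq_bigr => s _.
by case: ifPn => // hs; rewrite (Pout Pa hs) scale0r.
Qed.

(** A functional c on the coordinates is averaged to the left A-linear functional z -> sum_s x_s
    c(x_s^-1 z). Applied to the c_j of [semilinear_splitting] this gives the section, and the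
    projection sends (u_j) to the sum of the u_j w_j. *)
Lemma lspan_lprojective k (b : 'I_k -> A) : (forall i, P (b i)) ->
  lprojective P (cp_mul f) (lspan P (cp_mul f) b).
Proof.
move=> Pb; have hcm := submodule_self hC.
pose W : 'M[K]_(#|{: G * 'I_k}|, n) :=
  \matrix_i (let p := enum_val i in if p.1 \in H then xi p.1 (toR (b p.2)) else 0).
have Wxi s i : s \in H -> row_span W C (xi s (toR (b i))).
  move=> hs; have := row_span_row hC W (enum_rank (s, i)).
  by rewrite rowK enum_rankK /= hs.
have spanE x : lspan P (cp_mul f) b x <-> row_span W C (toR x).
  split=> [[c [Pc ->]]|[u hu e]].
    rewrite toR_sum; apply: (row_span_sum _ hcm) => i _; rewrite toR_mulP //.
    apply: (row_span_sum _ hcm) => s hs; apply: row_spanZ (Wxi s i hs) => y.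
    by apply: subringM => //; exact: Pin.
  pose c i : A := [ffun s => if s \in H then u 0 (enum_rank (s, i)) else 0].
  have Pc i : P (c i) by move=> s; split=> [hs|/negP/negPf hs]; rewrite ffunE hs.
  exists c; split=> //; apply: (can_inj toRK); rewrite e toR_sum.
  under [RHS]eq_bigr do rewrite toR_mulP //.
  rewrite mulmx_sum_row (reindex enum_rank) /=; last by apply: onW_bij; exact: enum_rank_bij.
  transitivity (\sum_(s : G) \sum_(i < k) u 0 (enum_rank (s, i)) *: row (enum_rank (s, i)) W).
    by rewrite pair_bigA; apply: eq_bigr => -[].
  rewrite exchange_big /=; apply: eq_bigr => i _; rewrite [RHS]big_mkcond; apply: eq_bigr => s _.
  by rewrite rowK enum_rankK /= ffunE; case: ifP => _ //; rewrite scaler0.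
have hW s j : s \in H -> row_span W C (xi s (row j W)).
  move=> hs; rewrite rowK /=; case: ifP => h; last first.
    have -> : xi s 0 = 0 by rewrite -[X in xi s X](scale0r 0) xiZ rmorph0 scale0r.
    exact: row_span0 hcm.
  rewrite xiM; apply: row_spanZ (Wxi _ _ (gcomp_in hs h)) => y.
  by apply: subringM => //; exact: fC.
have [m [c [w [h1 h2 h3]]]] := semilinear_splitting hC hMs Ms_inj Ms_all hval hst hf f0 fC fsq Ct ht
  xiD xiZ xiM xi1 hW.
pose Y := xi_inv f xi.
have spanX s x : s \in H -> row_span W C x -> row_span W C (xi s x).
  move=> hs [u hu ->].
  have -> : xi s (u *m W) = \sum_i s (u 0 i) *: xi s (row i W).
    rewrite mulmx_sum_row; elim/big_rec2: _ => [|i z1 z2 _ <-].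
      by rewrite -[X in xi s X](scale0r 0) xiZ rmorph0 scale0r.
    by rewrite xiD xiZ.
  apply: (row_span_sum _ hcm) => i _; apply: row_spanZ (hW s i hs) => y.
  by apply: subringM => //; exact: hst.
have spanP a x : P a -> row_span W C (toR x) -> row_span W C (toR (a ** x)).
  move=> Pa hx; rewrite toR_mulP //; apply: (row_span_sum _ hcm) => s hs.
  by apply: row_spanZ (spanX s _ hs hx) => y; apply: subringM => //; exact: Pin.
pose sg (x : A) (j : 'I_m) : A :=
  [ffun s => if s \in H then s ((Y s (toR x) *m c j) 0 0) else 0].
pose p (u : 'I_m -> A) := \sum_j u j ** ofR (w j).
(* With v = u^-1 s this is x_s^-1 x_u = s^-1(f(u, v)) x_v^-1, the identity behind the A-linearity of
   the section. *)
have YX s u x : Y s (xi u x) = s^-1%g (f u (gcomp u^-1%g s)) *: Y (gcomp u^-1%g s) x.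
  pose v := gcomp u^-1%g s; have es : s = gcomp u v by rewrite /v gcompVVK.
  have YK q z : Y q (xi q z) = z.
    by rewrite /Y /xi_inv xiM gcompVl xi1 scalerA mulVf ?scale1r.
  have KY q z : xi q (Y q z) = z.
    by rewrite /Y /xi_inv xiZ xiM gcompVr xi1 scalerA fmorphV /= (cocycleV hf) mulVf ?scale1r.
  by rewrite -/v; apply: (can_inj (YK s)); rewrite KY xiZ galKV {1}es -xiM KY.
exists m, p, sg; split.
- move=> u Pu; apply/spanE; rewrite toR_sum; apply: (row_span_sum _ hcm) => j _.
  by apply: spanP => //; rewrite ofRK.
- move=> x /spanE hx j s; split=> [hs|/negP/negPf hs]; rewrite ffunE hs //.
  by apply: hst => //; apply: h2.
- move=> a u v Pa Pu Pv; rewrite /p cp_mul_sumr -big_split; apply: eq_bigr => j _ /=.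
  by rewrite cp_mulDl cp_mulA.
- move=> a x y Pa /spanE hx /spanE hy j; apply/ffunP => s; rewrite [RHS]ffunE cp_mulE !ffunE.
  case: ifPn => hs; last first.
    rewrite addr0 big1 // => u _; case: (boolP (u \in H)) => hu.
      rewrite ffunE ifN ?rmorph0 ?mulr0 ?mul0r //; apply: contra hs => h.
      by rewrite -(gcompVVK u s) gcomp_in.
    by rewrite (Pout Pa hu) !mul0r.
  rewrite toRD toR_mul.
  have YD q a1 b1 : Y q (a1 + b1) = Y q a1 + Y q b1 by rewrite /Y /xi_inv xiD scalerDr.
  rewrite YD mulmxDl [X in s X]mxE rmorphD; congr (_ + _).
  have -> : Y s (\sum_u a u *: xi u (toR x)) =
     \sum_u (s^-1%g (a u) * s^-1%g (f u (gcomp u^-1%g s))) *: Y (gcomp u^-1%g s) (toR x).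
    elim/big_rec2: _ => [|u z1 z2 _ e].
      by rewrite /Y /xi_inv -[X in xi _ X](scale0r 0) xiZ rmorph0 scale0r scaler0.
    by rewrite YD e -scalerA -YX /Y /xi_inv xiZ !scalerA mulrC.
  rewrite mulmx_suml summxE rmorph_sum; apply: eq_bigr => u _ /=.
  rewrite -scalemxAl mxE !rmorphM /= !galKV ffunE.
  case: (boolP (u \in H)) => hu; last by rewrite (Pout Pa hu) !mul0r.
  by rewrite gcomp_in ?groupV // -gcompE gcompVVK mulrAC.
- move=> x /spanE hx; apply: (can_inj toRK); rewrite toR_sum -[RHS](h3 _ hx).
  have Ps j : P (sg x j).
    move=> s; split=> [hs|/negP/negPf hs]; rewrite ffunE hs //.
    by apply: hst => //; apply: h2.
  under eq_bigr do rewrite toR_mulP // ofRK.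
  rewrite exchange_big /=; apply: eq_bigr => s hs.
  have xi0 : xi s 0 = 0 by rewrite -[X in xi s X](scale0r 0) xiZ rmorph0 scale0r.
  rewrite (big_morph (xi s) (xiD s) xi0); apply: eq_bigr => j _.
  by rewrite ffunE hs xiZ.
Qed.
End Left.
End CrossedProduct.

Section OppositeCocycle.
Variables (F : fieldType) (K : splittingFieldType F).
Local Notation G := (gal_of {:K}).
Local Notation A := {ffun G -> K}.
Variables (f : G -> G -> K) (hf : normalized_cocycle f) (f0 : forall s t, f s t != 0).

(* The opposite ring is the crossed product with basis [y_s = x_{s^-1}]. *)
Definition opp_cocycle (s t : G) : K := gcomp s t (f t^-1%g s^-1%g).
Definition cp_opp (a : A) : A := [ffun r => (r : G) (a r^-1%g)].

Lemma opp_cocycleP : normalized_cocycle opp_cocycle.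
Proof.
split=> [s t g|s]; last first.
  by rewrite /opp_cocycle invg1 (cocycle1l hf) (cocycle1r hf) !rmorph1.
rewrite /opp_cocycle.
have e : gcomp (gcomp g^-1%g t^-1%g) s^-1%g = (gcomp s (gcomp t g))^-1%g.
  by rewrite /gcomp !invMg mulgA.
have := congr1 (fun x => gcomp s (gcomp t g) x) (cocycleE hf g^-1%g t^-1%g s^-1%g).
rewrite !rmorphM /=.
have -> : gcomp s (gcomp t g) (g^-1%g (f t^-1%g s^-1%g)) = gcomp s t (f t^-1%g s^-1%g).
  by rewrite -gcompE gcompA gcompKV.
have -> : (gcomp t g)^-1%g = gcomp g^-1%g t^-1%g by rewrite /gcomp invMg.
have -> : (gcomp s t)^-1%g = gcomp t^-1%g s^-1%g by rewrite /gcomp invMg.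
by rewrite -!gcompE -!gcompA.
Qed.

Lemma cp_oppK : involutive cp_opp.
Proof. by move=> a; apply/ffunP => r; rewrite !ffunE invgK galKV. Qed.
Lemma cp_oppD a b : cp_opp (a + b) = cp_opp a + cp_opp b.
Proof. by apply/ffunP => r; rewrite !ffunE rmorphD. Qed.
Lemma cp_opp0 : cp_opp 0 = 0.
Proof. by apply/ffunP => r; rewrite !ffunE rmorph0. Qed.
Lemma cp_opp_sum I (l : seq I) (P : pred I) (E : I -> A) :
  cp_opp (\sum_(i <- l | P i) E i) = \sum_(i <- l | P i) cp_opp (E i).
Proof. exact: (big_morph cp_opp cp_oppD cp_opp0). Qed.
Lemma cp_opp_mul a b : cp_opp (cp_mul f a b) = cp_mul opp_cocycle (cp_opp b) (cp_opp a).
Proof.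
apply/ffunP => r; rewrite ffunE !cp_mulE rmorph_sum.
rewrite (reindex_inj (h := fun u => gcomp r^-1%g u)) /=; last first.
  by move=> x y e; rewrite -[x](gcompVK r^-1%g) e gcompVK.
apply: eq_bigr => u _; rewrite !ffunE !rmorphM /= -!gcompE.
have e1 : gcomp (gcomp r^-1%g u)^-1%g r^-1%g = u^-1%g.
  by rewrite /gcomp invMg invgK mulgA mulVg mul1g.
have e2 : (gcomp u^-1%g r)^-1%g = gcomp r^-1%g u by rewrite /gcomp invMg invgK.
rewrite e1 e2 /opp_cocycle e2 !gcompVVK.
ring.
Qed.
End OppositeCocycle.

(** * Sufficiency: left and right ideals together *)

Section Sufficient.
Variables (F : fieldType) (K : splittingFieldType F).
Local Notation G := (gal_of {:K}).
Local Notation A := {ffun G -> K}.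
Variables (f : G -> G -> K) (hf : normalized_cocycle f) (f0 : forall s t, f s t != 0).
Variables (C : K -> Prop) (hC : subring C) (r : nat) (Ms : 'I_r -> K -> Prop).
Hypothesis hMs : forall i, max_ideal C (Ms i).
Hypothesis Ms_inj : forall i j, (forall x, Ms i x <-> Ms j x) -> i = j.
Hypothesis Ms_all : forall M, max_ideal C M -> exists i, forall x, M x <-> Ms i x.
Hypothesis hval : forall M x, max_ideal C M ->
  exists t, [/\ C t, ~ M t & C (t * x) \/ C (t * x^-1)].
Variables (H : {group G}) (hst : forall s x, s \in H -> C x -> C (s x)).
Hypothesis fC : forall s t, s \in H -> t \in H -> C (f s t).
Hypothesis fsq : forall M s, max_ideal C M -> s \in H -> ~ ideal_sq M (f s s^-1%g).
Variables (t : K) (Ct : C t).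
Hypothesis ht : forall M, max_ideal C M ->
  ~ M (\sum_(s in H | ~~ `[< M (f s s^-1%g) >]) s t).

Local Notation P := (cp_set C (fun s => s \in H)).

Lemma cp_opp_in a : P a -> P (cp_opp a).
Proof.
move=> h s; have [h1 h2] := h s^-1%g; rewrite groupV in h1 h2; split=> hs; rewrite ffunE.
  by apply: hst => //; apply: h1.
by rewrite h2 // rmorph0.
Qed.

(** The opposite cocycle takes the same values at the pairs (s, s^-1), so the hypotheses of the
    left-sided result carry over to it unchanged. *)
Theorem semihereditary_crossed_product : semihereditary P (cp_mul f).
Proof.
move=> k b Pb; split.
  exact: (lspan_lprojective hf f0 hC hMs Ms_inj Ms_all hval hst fC fsq Ct ht).
pose f' := opp_cocycle f.
have hf' : normalized_cocycle f' := opp_cocycleP hf.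
have f0' s u : f' s u != 0 by rewrite fmorph_eq0.
have fC' s u : s \in H -> u \in H -> C (f' s u).
  by move=> hs hu; apply: hst; [exact: gcomp_in | apply: fC; rewrite groupV].
have eg s : f' s s^-1%g = f s s^-1%g by rewrite /f' /opp_cocycle gcompVr gal1E invgK.
have fsq' M s : max_ideal C M -> s \in H -> ~ ideal_sq M (f' s s^-1%g) by rewrite eg; exact: fsq.
have ht' M : max_ideal C M -> ~ M (\sum_(s in H | ~~ `[< M (f' s s^-1%g) >]) s t).
  by move=> hM; under eq_bigl do rewrite eg; exact: ht.
have Pb' i : P (cp_opp (b i)) by exact: cp_opp_in.
have oppM a c : cp_opp (cp_mul f a c) = cp_mul f' (cp_opp c) (cp_opp a) by exact: cp_opp_mul.
have spanE x : rspan P (cp_mul f) b x -> lspan P (cp_mul f') (fun i => cp_opp (b i)) (cp_opp x).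
  move=> [c [Pc ->]]; exists (fun i => cp_opp (c i)); split; first by move=> i; exact: cp_opp_in.
  by rewrite cp_opp_sum; apply: eq_bigr => i _.
have spanE' x : lspan P (cp_mul f') (fun i => cp_opp (b i)) x -> rspan P (cp_mul f) b (cp_opp x).
  move=> [c [Pc ->]]; exists (fun i => cp_opp (c i)); split; first by move=> i; exact: cp_opp_in.
  by rewrite cp_opp_sum; apply: eq_bigr => i _; rewrite -{1}[c i]cp_oppK -oppM cp_oppK.
have [m [p [sg [h1 h2 h3 h4 h5]]]] :=
  lspan_lprojective hf' f0' hC hMs Ms_inj Ms_all hval hst fC' fsq' Ct ht' Pb'.
exists m, (fun u => cp_opp (p (fun i => cp_opp (u i)))), (fun x i => cp_opp (sg (cp_opp x) i)); split.
- by move=> u Pu; apply: spanE'; apply: h1 => i; exact: cp_opp_in.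
- by move=> x /spanE hx i; apply: cp_opp_in; exact: h2.
- move=> a u v Pa Pu Pv.
  have -> : (fun i => cp_opp (cp_mul f (u i) a + v i)) =
     (fun i => cp_mul f' (cp_opp a) (cp_opp (u i)) + cp_opp (v i)).
    by apply: funext => i; rewrite cp_oppD oppM.
  rewrite (h3 _ _ _ (cp_opp_in Pa) (fun i => cp_opp_in (Pu i)) (fun i => cp_opp_in (Pv i))).
  by rewrite cp_oppD; congr (_ + _); rewrite -[p _ in LHS]cp_oppK -oppM cp_oppK.
- move=> a x y Pa /spanE hx /spanE hy i; rewrite cp_oppD oppM h4 //; last exact: cp_opp_in.
  by rewrite cp_oppD -[sg _ i in X in X + _]cp_oppK -oppM cp_oppK.
- move=> x /spanE hx.
  have -> : (fun i => cp_opp (cp_opp (sg (cp_opp x) i))) = sg (cp_opp x).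
    by apply: funext => i; rewrite cp_oppK.
  by rewrite h5 // cp_oppK.
Qed.
End Sufficient.

(** * Necessity: a nonprojective ideal from a value in M^2 *)

Lemma ideal_sq_factor (R : fieldType) (C M : R -> Prop) g : subring C -> max_ideal C M ->
  (forall x, exists t, [/\ C t, ~ M t & C (t * x) \/ C (t * x^-1)]) ->
  ideal_sq M g -> exists a z, [/\ M a, loc_at C M M z & g = a * z].
Proof.
move=> hC hM hval [n [x [y [Mx [My ->]]]]].
have hm := mloc_ideal hC hM.
elim: n x y Mx My => [|n IH] x y Mx My.
  rewrite big_ord0; exists 0, 0; rewrite mul0r; split=> //.
    exact: ideal0 (max_ideal_ideal hM).
  exact: ideal0 hm.
rewrite big_ord_recl.
have [a [z [Ma hz ->]]] := IH _ _ (fun i => Mx (lift ord0 i)) (fun i => My (lift ord0 i)).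
have hy : loc_at C M M (y ord0) by exact: mloc_sub.
have [x0|x0] := eqVneq (x ord0) 0; first by exists a, z; rewrite x0 mul0r add0r.
have [->|a0] := eqVneq a 0; first by exists (x ord0), (y ord0); rewrite mul0r addr0.
(* Of the two first factors, the one dividing the other in the valuation ring is kept, so that the
   sum remains a single product. *)
case: (loc_total hC hM hval (a / x ord0)) => h.
  exists (x ord0), (y ord0 + a / x ord0 * z); split=> //; last by field.
  by apply: (idealD hm) => //; exact: (idealMl hm).
rewrite invf_div in h; exists a, (x ord0 / a * y ord0 + z); split=> //; last by field.
by apply: (idealD hm) => //; exact: (idealMl hm).
Qed.

Section Necessity.
Variables (F : fieldType) (K : splittingFieldType F).
Local Notation G := (gal_of {:K}).
Local Notation A := {ffun G -> K}.
Variables (f : G -> G -> K) (hf : normalized_cocycle f) (f0 : forall s t, f s t != 0).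
Variables (C M : K -> Prop) (hC : subring C) (hM : max_ideal C M).
Hypothesis hval : forall x, exists t, [/\ C t, ~ M t & C (t * x) \/ C (t * x^-1)].
Variables (H : {group G}) (hst : forall s x, s \in H -> C x -> C (s x)).
Hypothesis fC : forall s t, s \in H -> t \in H -> C (f s t).
Local Notation P := (cp_set C (fun s => s \in H)).
Local Notation "a ** b" := (cp_mul f a b) (at level 40).

Let Pin a s : P a -> s \in H -> C (a s).
Proof. by move=> h; case: (h s). Qed.
Let Pout a s : P a -> s \notin H -> a s = 0.
Proof. by move=> h /negP; case: (h s). Qed.

Lemma cp_single_in u c : u \in H -> C c -> P (cp_single u c).
Proof.
move=> hu Cc s; rewrite ffunE; split=> [hs|hs]; case: eqP => // e.
  exact: subring0.
by case: hs; rewrite e.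
Qed.
Lemma cp_set0 : P 0.
Proof. by move=> s; rewrite ffunE; split=> // _; exact: subring0. Qed.

(* A projective left ideal contains 1 = sum w_i p_i with [X w_i] integral; for
   [X = A a + A x_{s^-1}] every term of the coefficient of 1 lies in the maximal ideal. *)
Theorem semihereditary_nideal_sq s : semihereditary P (cp_mul f) -> s \in H ->
  ~ ideal_sq M (f s s^-1%g).
Proof.
move=> hA hs hsq.
have [a [y [Ma hy eg]]] := ideal_sq_factor hC hM hval hsq.
have a0 : a != 0 by apply/eqP => a0; move/eqP: (f0 s s^-1%g); apply; rewrite eg a0 mul0r.
have Ca := ideal_sub (max_ideal_ideal hM) Ma.
have hsV : s^-1%g \in H by rewrite groupV.
pose one : A := cp_single 1%g 1.
have Pone : P one by apply: cp_single_in; [exact: group1 | exact: subring1].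
pose b (i : 'I_2) : A := if i == ord0 then cp_single 1%g a else cp_single s^-1%g 1.
have Pb i : P (b i).
  rewrite /b; case: eqP => _; first exact: (cp_single_in (group1 H) Ca).
  exact: (cp_single_in hsV (subring1 hC)).
have [[m [p [sg [h1 h2 h3 h4 h5]]]] _] := hA 2 b Pb.
have Xb i : lspan P (cp_mul f) b (b i).
  exists (fun j => if j == i then one else 0); split.
    by move=> j; case: eqP => _; [exact: Pone | exact: cp_set0].
  rewrite (bigD1 i) //= eqxx cp_1mul // big1 ?addr0 // => j /negPf ->.
  exact: cp_0mul.
have X0 : lspan P (cp_mul f) b 0.
  exists (fun _ => 0); split; first by move=> _; exact: cp_set0.
  by rewrite big1 // => j _; exact: cp_0mul.
pose E (i j : 'I_m) : A := if j == i then one else 0.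
have PE i j : P (E i j) by rewrite /E; case: eqP => _; [exact: Pone | exact: cp_set0].
have p0 : p (fun _ => 0) = 0.
  have := h3 one (fun _ => 0) (fun _ => 0) Pone (fun _ => cp_set0) (fun _ => cp_set0).
  have -> : (fun _ : 'I_m => one ** 0 + 0) = (fun _ => 0).
    by apply: funext => i; rewrite cp_mul0 addr0.
  rewrite /one cp_1mul // => e; apply: (addrI (p (fun _ => 0))).
  by rewrite -e addr0.
have pE u : (forall i, P (u i)) -> p u = \sum_i u i ** p (E i).
  move=> Pu.
  (* The linearity of p is given for one scalar and one summand at a time, hence the induction over
     a list of coordinates. *)
  have key l : uniq l -> p (fun i => if i \in l then u i else 0) = \sum_(i <- l) u i ** p (E i).
    elim: l => [_|x l IH /= /andP [xl ul]]; first by rewrite big_nil -[RHS]p0.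
    rewrite big_cons -IH // -h3 //.
      congr p; apply: funext => i; rewrite inE /E; case: eqP => [->|_] /=.
        by rewrite (negPf xl) addr0 -[LHS](cp_1mul hf) /one; apply/ffunP => r;
           rewrite cp_mul_single cp_single_mul !invg1 !gcomp1l !gcomp1r (cocycle1l hf) (cocycle1r hf) rmorph1 !mulr1 mul1r gal1E.
      by rewrite cp_mul0 add0r.
    by move=> i; case: ifP => _; [exact: Pu | exact: cp_set0].
  rewrite -big_enum /= -key ?enum_uniq //; congr p.
  by apply: funext => i; rewrite mem_enum.
have sg0 i : sg 0 i = 0.
  have := h4 one 0 0 Pone X0 X0 i; rewrite cp_mul0 addr0 /one cp_1mul // => e.
  by apply: (addrI (sg 0 i)); rewrite -e addr0.
have sgM c x i : P c -> lspan P (cp_mul f) b x -> sg (c ** x) i = c ** sg x i.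
  by move=> Pc hx; have := h4 c x 0 Pc hx X0 i; rewrite addr0 sg0 addr0.
pose q i := sg (b ord0) i.
pose r i := sg (b ord_max) i.
have Pq i : P (q i) by apply: h2.
have Pr i : P (r i) by apply: h2.
have eqr i w : w \in H -> q i w * s (f s^-1%g w) = a * s (r i (gcomp s^-1%g w)).
  move=> hw.
  (* The generators satisfy x_(s^-1) a = s^-1(a) x_(s^-1); the section turns this into a relation
     between their coordinates. *)
  have e : b ord_max ** b ord0 = cp_single 1%g (s^-1%g a) ** b ord_max.
    rewrite /b /=; apply/ffunP => v; rewrite !cp_single_mul !ffunE invgK invg1 gcomp1l.
    rewrite (cocycle1l hf) mulr1 gal1E mul1r.
    case: (v =P s^-1%g) => [->|nv].
      by rewrite gcompVr eqxx (cocycle1r hf) !mulr1.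
    case: eqP => [e|_]; last by rewrite rmorph0 mul0r mulr0.
    by case: nv; rewrite -[v](gcompVK s) e gcomp1r.
  have := congr1 (fun x => sg x i) e; rewrite !sgM //; last first.
    by apply: cp_single_in; [exact: group1|exact: hst].
  move/ffunP/(_ (gcomp s^-1%g w)); rewrite -/(q i) -/(r i) /b /= !cp_single_mul.
  rewrite invg1 gcomp1l (cocycle1l hf) mulr1 gal1E mul1r invgK gcompVVK.
  by move/(congr1 (fun x => s x)); rewrite !rmorphM /= !galKV.
have ep : b ord0 = \sum_i q i ** p (E i) by rewrite -pE // h5.
have hl := loc_subring hC hM; have hm := mloc_ideal hC hM.
(* These are the terms of the coefficient of x_1 in a = sum_i q_i p(E_i), divided by a; they add up
   to 1. *)
suff key i w : loc_at C M M (q i w * w (p (E i) (gcomp w^-1%g 1%g)) * f w (gcomp w^-1%g 1%g) / a).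
  apply: (@mloc1 _ C M).
  have -> : 1 = (b ord0) 1%g / a by rewrite /b /= ffunE eqxx divff.
  rewrite ep sum_ffunE mulr_suml; apply: (ideal_sum hm) => i _.
  by rewrite cp_mulE mulr_suml; apply: (ideal_sum hm) => w _.
rewrite gcomp1r; case: (boolP (w \in H)) => hw; last first.
  by rewrite (Pout (Pq i) hw) !mul0r; exact: ideal0 hm.
have hwV : w^-1%g \in H by rewrite groupV.
have [c [Pc ec]] := h1 _ (PE i).
have Cq : C (q i w) by exact: Pin.
have wC v : C v -> C (w v) by exact: hst.
have hwVs : gcomp w^-1%g s \in H by exact: gcomp_in.
rewrite ec big_ord_recl big_ord1 /= ffunE !cp_mul_single invg1 gcomp1r invgK (cocycle1r hf) mulr1 rmorph1 mulr1.
rewrite rmorphD !rmorphM /= galKV.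
set c0 := w (c ord0 _); set c1 := w (c _ _); set q' := w (f _ _).
have Cc0 : C c0 by apply: wC; exact: Pin.
have Cc1 : C c1 by apply: wC; exact: Pin.
(* The contribution of the generator x_(s^-1) acquires the factor f(s, s^-1) = a y, of which y in
   the maximal ideal survives the division by a. *)
have eq' : q' * f w w^-1%g = f w (gcomp w^-1%g s) * (a * y).
  rewrite -eg /q'; have := cocycleE hf w (gcomp w^-1%g s) s^-1%g.
  by rewrite gcompKV gcompVVK.
have -> : q i w * (c0 * a + c1 * q') * f w w^-1%g / a =
   q i w * c0 * f w w^-1%g + q i w * c1 * f w (gcomp w^-1%g s) * y.
  have -> : q i w * (c0 * a + c1 * q') * f w w^-1%g / a =
   q i w * c0 * f w w^-1%g * (a / a) + q i w * c1 * (q' * f w w^-1%g) / a by ring.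
  by rewrite eq'; field.
apply: (idealD hm); last first.
  apply: (idealMl hm) => //; apply: loc_sub => //; apply: subringM => //; last exact: fC.
  exact: subringM.
(* In the contribution of the generator a, either f(w, w^-1) is in M, or its divisor s(f(s^-1, w))
   is a unit at M and [eqr] makes q_i(w) a multiple of a. *)
case: (pselect (M (f w w^-1%g))) => hg.
  by apply: (idealMl hm); [apply: loc_sub => //; exact: subringM | exact: mloc_sub].
have ew : f w w^-1%g = s (f s^-1%g w) * s (f (gcomp s^-1%g w) w^-1%g).
  have := cocycleE hf s^-1%g w w^-1%g; rewrite gcompVr (cocycle1r hf) mulr1 => /(congr1 (fun x => s x)).
  by rewrite rmorphM /= galKV.
have hsw : gcomp s^-1%g w \in H by exact: gcomp_in.
have Cb : C (s (f s^-1%g w)) by apply: hst => //; exact: fC.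
have nb : ~ M (s (f s^-1%g w)).
  move=> h; apply: hg; rewrite ew; apply: (idealMr (max_ideal_ideal hM)) => //.
  by apply: hst => //; exact: fC.
have b0 := max_ideal_neq0 hM nb.
have -> : q i w = a * s (r i (gcomp s^-1%g w)) * (s (f s^-1%g w))^-1 by rewrite -eqr // mulfK.
rewrite -!mulrA; apply: (idealMr hm); last exact: mloc_sub.
apply: (subringM hl); first by apply: loc_sub => //; apply: hst => //; exact: Pin.
apply: (subringM hl); first exact: loc_inv_sub.
by apply: (subringM hl); apply: loc_sub => //; exact: fC.
Qed.
End Necessity.

(** * Decomposition and inertia groups *)

(* The characters may be repeated, so only the sums of the coefficients over classes of equal
   characters vanish. *)
Lemma dedekind_independence (R L : fieldType) (C : R -> Prop) (I : finType) (A : {set I})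
    (chi : I -> R -> L) (c : I -> L) :
  subring C -> (forall i, i \in A -> chi i 1 = 1) ->
  (forall i x y, i \in A -> C x -> C y -> chi i (x * y) = chi i x * chi i y) ->
  (forall x, C x -> \sum_(i in A) c i * chi i x = 0) ->
  forall j, j \in A ->
    \sum_(i in A | `[< forall x, C x -> chi i x = chi j x >]) c i = 0.
Proof.
move=> hC; have [m] := ubnP #|A|; elim: m A c => // m IH A c hA chi1 chiM h j Aj.
case: (pselect (exists i, i \in A /\ exists y, C y /\ chi i y <> chi j y)) => [|nex]; last first.
  rewrite -[RHS](h 1 (subring1 hC)) big_mkcondr; apply: eq_bigr => i Ai.
  rewrite chi1 // mulr1 asboolT // => x Cx.
  by apply: contrapT => nx; apply: nex; exists i; split=> //; exists x.
move=> [k [Ak [y [Cy nky]]]].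
pose A' := [set i in A | chi i y != chi k y].
have sA : A' \subset A by apply/subsetP => i; rewrite inE => /andP [].
have Aj' : j \in A' by rewrite inE Aj eq_sym; apply/eqP.
have hA' : (#|A'| < m)%N.
  rewrite -ltnS; apply: leq_trans hA; rewrite ltnS; apply: proper_card; apply/properP; split=> //.
  by exists k => //; rewrite inE eqxx andbF.
have e0 : \sum_(i in A' | `[< forall x, C x -> chi i x = chi j x >]) c i * (chi i y - chi k y) = 0.
  apply: (IH A' (fun i => c i * (chi i y - chi k y)) hA') => //.
  - by move=> i /(subsetP sA); exact: chi1.
  - by move=> i x z /(subsetP sA); exact: chiM.
  move=> x Cx.
  have e1 : \sum_(i in A) c i * (chi i y - chi k y) * chi i x = 0.
    have e2 := h _ (subringM hC Cy Cx); have e3 := congr1 (fun z => z * chi k y) (h _ Cx).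
    rewrite mul0r mulr_suml in e3.
    transitivity (\sum_(i in A) c i * chi i (y * x) - \sum_(i in A) c i * chi i x * chi k y).
      by rewrite -sumrB; apply: eq_bigr => i Ai; rewrite chiM //; ring.
    by rewrite e2 e3 subrr.
  rewrite -[RHS]e1 [RHS](bigID (fun i => chi i y != chi k y)) /=.
  rewrite [X in _ = _ + X]big1 => [|i /andP [_ /negbNE /eqP ->]]; last by rewrite subrr mulr0 mul0r.
  by rewrite addr0; apply: eq_bigl => i; rewrite inE.
have e : \sum_(i in A' | `[< forall x, C x -> chi i x = chi j x >]) c i * (chi i y - chi k y) =
   (\sum_(i in A | `[< forall x, C x -> chi i x = chi j x >]) c i) * (chi j y - chi k y).
  rewrite mulr_suml; apply: eq_big => [i|i /andP [_ /asboolP e]]; last by rewrite e.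
  rewrite inE; case: asboolP => e; rewrite ?andbF ?andbT //.
  by rewrite e // eq_sym; case: (i \in A) => //=; apply/eqP.
move/eqP: e0; rewrite e mulf_eq0 subr_eq0 => /orP [/eqP //|/eqP e'].
by case: nky.
Qed.

(** * Reduction of polynomials *)

Section PartialMorphismPoly.
Variables (R L : fieldType) (C : R -> Prop) (hC : subring C) (phi : R -> L).
Hypothesis phi1 : phi 1 = 1.
Hypothesis phiD : forall x y, C x -> C y -> phi (x + y) = phi x + phi y.
Hypothesis phiM : forall x y, C x -> C y -> phi (x * y) = phi x * phi y.
Let phi0 := pmorph0 hC phiD.
Local Notation "p ^f" := (map_poly phi p).
Local Notation over p := (forall i, C p`_i).
Implicit Types p q : {poly R}.

Let coefE p i : (p ^f)`_i = phi p`_i.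
Proof. exact: coef_map_id0. Qed.
Lemma poly_overM p q : over p -> over q -> over (p * q).
Proof.
move=> hp hq i; rewrite coefM; apply: subring_sum => // j _; exact: subringM.
Qed.
Lemma poly_overXsubC c : C c -> over ('X - c%:P).
Proof.
move=> Cc i; rewrite coefB coefX coefC; apply: subringB => //.
  by case: eqP => _; [exact: subring1 | exact: subring0].
by case: eqP => _ //; exact: subring0.
Qed.
Lemma poly_over_prod (I : finType) (c : I -> R) : (forall i, C (c i)) ->
  over (\prod_i ('X - (c i)%:P)).
Proof.
move=> hc; elim/big_ind: _ => [i|p q|i _]; last exact: poly_overXsubC.
  by rewrite coef1; case: eqP => _; [exact: subring1 | exact: subring0].
exact: poly_overM.
Qed.
Lemma map_poly_pmorphD p q : over p -> over q -> (p + q) ^f = p ^f + q ^f.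
Proof. by move=> hp hq; apply/polyP => i; rewrite coefD !coefE coefD phiD. Qed.
Lemma map_poly_pmorphM p q : over p -> over q -> (p * q) ^f = p ^f * q ^f.
Proof.
move=> hp hq; apply/polyP => i; rewrite coefE !coefM (pmorph_sum hC phiD) => [|j _]; last exact: subringM.
by apply: eq_bigr => j _; rewrite !coefE phiM.
Qed.
Lemma map_poly_pmorph_deriv p : over p -> (p^`()) ^f = (p ^f)^`().
Proof.
move=> hp; apply/polyP => i; rewrite coefE !coef_deriv coefE -[in LHS]mulr_natr -[RHS]mulr_natr.
rewrite (phiM (hp i.+1) (subring_nat hC i.+1)); congr (_ * _).
exact: (pmorph_nat hC phi1 phiD).
Qed.
Lemma map_poly_pmorph_XsubC c : C c -> ('X - c%:P) ^f = 'X - (phi c)%:P.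
Proof.
move=> Cc; apply/polyP => i; rewrite coefE !coefB !coefX !coefC (pmorphB hC phiD).
- by case: eqP => _; case: eqP => _; rewrite ?phi1 ?phi0.
- by case: eqP => _; [exact: subring1 | exact: subring0].
- by case: eqP => _ //; exact: subring0.
Qed.
Lemma map_poly_pmorph_prod (I : finType) (c : I -> R) : (forall i, C (c i)) ->
  (\prod_i ('X - (c i)%:P)) ^f = \prod_i ('X - (phi (c i))%:P).
Proof.
move=> hc.
have h : over (\prod_i ('X - (c i)%:P)) /\
   (\prod_i ('X - (c i)%:P)) ^f = \prod_i ('X - (phi (c i))%:P).
  elim/big_rec2: _ => [|i p q _ [hq e]].
    split=> [i|]; first by rewrite coef1; case: eqP => _; [exact: subring1 | exact: subring0].
    by apply/polyP => i; rewrite coefE !coef1; case: eqP => _; rewrite ?phi1 ?phi0.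
  have hX := poly_overXsubC (hc i).
  by split; [exact: poly_overM | rewrite map_poly_pmorphM // e map_poly_pmorph_XsubC].
by case: h.
Qed.
Lemma horner_pmorph p x : over p -> C x -> phi p.[x] = (p ^f).[phi x].
Proof.
move=> hp Cx; have s : (size (p ^f) <= size p)%N.
  by apply/leq_sizeP => i hi; rewrite coefE nth_default.
rewrite (horner_coef_wide _ s) horner_coef (pmorph_sum hC phiD) => [|i _]; last first.
  by apply: subringM => //; exact: subringX.
apply: eq_bigr => i _; rewrite phiM //; last exact: subringX.
rewrite coefE; congr (_ * _).
elim: (i : nat) => [|j IH]; first by rewrite !expr0.
by rewrite !exprS phiM ?IH //; exact: subringX.
Qed.
End PartialMorphismPoly.

Section SubfieldType.
Variables (L : fieldType) (k : L -> Prop) (hk : subring k) (hkV : forall x, k x -> k x^-1).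
Definition in_subfield : {pred L} := fun x => `[< k x >].
Lemma in_subfield_closed : divring_closed in_subfield.
Proof.
split; first by apply/asboolP; exact: subring1.
  by move=> x y /asboolP kx /asboolP ky; apply/asboolP; exact: subringB.
by move=> x y /asboolP kx /asboolP ky; apply/asboolP; apply: subringM => //; exact: hkV.
Qed.
HB.instance Definition _ := GRing.isDivringClosed.Build L in_subfield in_subfield_closed.
Definition subfield_type := {x : L | in_subfield x}.
HB.instance Definition _ := SubChoice.on subfield_type.
HB.instance Definition _ := [SubChoice_isSubIntegralDomain of subfield_type by <:].
HB.instance Definition _ := [SubIntegralDomain_isSubField of subfield_type by <:].
Lemma subfield_typeP : exists (E : fieldType) (iota : {rmorphism E -> L}),
  forall x, k x <-> exists a, x = iota a.
Proof.
exists subfield_type, (val : {rmorphism subfield_type -> L}).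
move=> x; split=> [kx|[a ->]]; last exact/asboolP/(valP a).
by exists (exist _ x (asboolT kx)).
Qed.
End SubfieldType.

(* gcd(p, q) is an associate of X^j (X - y). *)
Lemma simple_common_root (k L : fieldType) (iota : {rmorphism k -> L}) (p q : {poly k}) (y : L) a b :
  root (map_poly iota p) y -> (map_poly iota p)^`().[y] != 0 ->
  map_poly iota q = ('X - y%:P) ^+ a.+1 * 'X ^+ b -> exists z, y = iota z.
Proof.
move=> py py' eq.
have [->|y0] := eqVneq y 0; first by exists 0; rewrite rmorph0.
set g := gcdp p q; set G := map_poly iota g.
have eG : G = gcdp (map_poly iota p) (map_poly iota q) by rewrite /G /g gcdp_map.
have Gy : root G y.
  by rewrite eG root_gcd py eq /root hornerM horner_exp hornerXsubC subrr expr0n mul0r eqxx.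
have [g1 eg1] := factor_theorem _ _ Gy.
have g1y : ~~ root g1 y.
  apply/negP => /factor_theorem [g2 eg2].
  have : ('X - y%:P) ^+ 2 %| map_poly iota p.
    apply: (@dvdp_trans _ G); last by rewrite eG dvdp_gcdl.
    by rewrite eg1 eg2 -mulrA -expr2 dvdp_mulIr.
  case/dvdpP => g3 e3; move/eqP: py'; apply; rewrite e3 derivM deriv_exp derivXsubC.
  by rewrite hornerD !hornerM hornerMn !hornerM !horner_exp hornerXsubC subrr /= expr1 !(mulr0, mul0rn) addr0.
have G0 : G != 0.
  rewrite eG gcdp_eq0 negb_and; apply/orP; left; apply/eqP => e; move: py'.
  by rewrite e deriv0 horner0 eqxx.
have : g1 %| 'X ^+ b.
  have cop : coprimep g1 (('X - y%:P) ^+ a.+1).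
    by apply: coprimep_expr; rewrite coprimep_XsubC.
  rewrite -(Gauss_dvdpr _ cop) -eq; apply: (@dvdp_trans _ G); last by rewrite eG dvdp_gcdr.
  by rewrite eg1 dvdp_mulIl.
rewrite -['X]subr0 => /dvdp_exp_XsubCP [j _]; rewrite subr0 => ej.
have [c c0 ec] := eqpf_eq _ _ ej.
have eG' : G = c *: ('X^j * ('X - y%:P)) by rewrite eg1 ec scalerAl.
have cf i : G`_i = c * ((i == j.+1)%:R - (i == j)%:R * y).
  by rewrite eG' coefZ mulrBr -exprSr coefB coefMC !coefXn.
have ej1 : iota g`_j.+1 = c.
  by rewrite -coef_map -/G cf eqxx eqn_leq ltnn mul0r subr0 mulr1.
have ej0 : iota g`_j = - (c * y).
  by rewrite -coef_map -/G cf eqxx eqn_leq ltnn andbF mul1r sub0r mulrN.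
(* The gcd has coefficients in the small field, and its two nonzero ones are c and - c y. *)
exists (- g`_j / g`_j.+1); rewrite rmorphM fmorphV rmorphN /= ej1 ej0 opprK.
by rewrite mulrAC divff // mul1r.
Qed.

(** * Localizations as local rings *)

Section LocalRing.
Variables (R : fieldType) (C M : R -> Prop) (hC : subring C) (hM : max_ideal C M).

Lemma localizeE : localize C M = loc_at C M C.
Proof.
apply: funext => x; apply: propext; split=> [[s [t [Cs Ct Mt ->]]]|[t [Ct Mt Ctx]]].
  by exists t; split=> //; rewrite mulrC divfK // (max_ideal_neq0 hM).
exists (t * x), t; split=> //; by rewrite mulrAC divff ?mul1r // (max_ideal_neq0 hM).
Qed.

Lemma jacobson_loc : jacobson (loc_at C M C) = loc_at C M M.
Proof.
have hl := loc_subring hC hM; have hm := mloc_ideal hC hM.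
apply: funext => x; apply: propext; split=> [[lx h]|mx].
  apply: contrapT => nx; have [x0 lxi] := loc_inv hM lx nx.
  by have [_] := h _ lxi; rewrite divff // subrr eqxx.
split=> [|y ly]; first exact: (mloc_loc hM).
have l1 : loc_at C M C (1 - x * y).
  apply: (subringB hl); first exact: subring1 hl.
  by apply: (subringM hl) => //; exact: (mloc_loc hM).
have [|n0 li] := loc_inv hM l1; last by split.
move=> h; apply: (@mloc1 _ C M); rewrite -[1](subrK (x * y)); apply: (idealD hm) => //.
exact: (idealMr hm).
Qed.

Lemma max_ideal_loc : max_ideal (loc_at C M C) (loc_at C M M).
Proof.
have hl := loc_subring hC hM; have hm := mloc_ideal hC hM.
split=> //; first exact: mloc1.
move=> N hN MN; case: (pselect (exists x, N x /\ ~ loc_at C M M x)) => [[x [Nx nx]]|h].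
  right; have [x0 lx] := loc_inv hM (ideal_sub hN Nx) nx.
  by rewrite -[1](mulVf x0); exact: (idealMl hN).
left=> x; split; last exact: MN.
by move=> Nx; apply: contrapT => nx; apply: h; exists x.
Qed.
End LocalRing.

(** * Galois action on the maximal ideals of the integral closure *)

Section IntegralClosure.
Variables (F : fieldType) (K : splittingFieldType F) (V : F -> Prop).
Hypotheses (hV : valuation_domain V) (hgal : galois 1%VS {:K}).
Local Notation G := (gal_of {:K}).
Local Notation S := (integral_over (@inK F K V)).
Let hVr := valuation_subring hV.

Lemma int_closure_subring : subring S.
Proof. exact: (integral_over_subring (inK_subring hV K)). Qed.
Let hS := int_closure_subring.

Lemma int_closure_id v : V v -> S v%:A.
Proof. by move=> Vv; apply: (integral_over_id (inK_subring hV K)); exists v. Qed.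

Lemma gal_scalar (s : G) (v : F) : s v%:A = v%:A.
Proof. by rewrite linearZ /= rmorph1. Qed.

Lemma int_closure_gal (s : G) x : S x -> S (s x).
Proof.
move=> [p [pm pV px]]; exists (map_poly s p); split.
- exact: monic_map.
- move=> i; have [v [Vv e]] := pV i; exists v; split=> //.
  by rewrite coef_map /= e gal_scalar.
- by rewrite fmorph_root.
Qed.

Lemma gal_fixed x : (forall s : G, s x = x) -> exists v : F, x = v%:A.
Proof.
move=> h; apply/vlineP; rewrite -(galois_fixedField hgal).
by apply/fixedFieldP => [|s _]; [exact: memvf | exact: h].
Qed.

Lemma int_closure_base v : S v%:A -> V v.
Proof.
case: (hV) => _ h; have [->|v0] := eqVneq v 0; first by move=> _; exact: subring0.
case: (h v v0) => // Vi Sv.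
have [|w [Vw /eqP]] := integral_over_inv (inK_subring hV K) Sv.
  by exists v^-1; split=> //; rewrite -in_algE -fmorphV.
by rewrite -subr_eq0 -scalerBl scaler_eq0 oner_eq0 orbF subr_eq0 => /eqP ->.
Qed.

Lemma int_closure_fixed x : S x -> (forall s : G, s x = x) -> exists2 v : F, V v & x = v%:A.
Proof.
by move=> Sx /gal_fixed [v e]; exists v => //; apply: int_closure_base; rewrite -e.
Qed.

Lemma norm_fixed x (s : G) : s (\prod_(u : G) u x) = \prod_(u : G) u x.
Proof.
rewrite rmorph_prod [RHS](reindex_inj (mulIg s)) /=.
by apply: eq_bigr => u _; rewrite -gcompE.
Qed.

(* For z inverse to v modulo M, the norm of [1 - v z] is [1 - v w] with w in V. *)
Lemma base_unit M v : max_ideal S M -> V v -> ~ M v%:A -> V v^-1.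
Proof.
move=> hM Vv nMv; have v0 : v != 0.
  by apply/eqP => v0; apply: nMv; rewrite v0 scale0r; exact: ideal0 (max_ideal_ideal hM).
have hI := max_ideal_ideal hM; have Sv := int_closure_id Vv.
have [z Sz Mz] := max_ideal_inv hS hM Sv nMv.
pose a := 1 - v%:A * z.
have Ma : M a by rewrite /a -opprB; exact: (idealN hI).
have [y Sy ey] : exists2 y, S y & \prod_(u : G) u a = 1 - v%:A * y.
  elim/big_ind: _ => [|x1 x2 [y1 Sy1 ->] [y2 Sy2 ->]|u _].
  - by exists 0; [exact: subring0 | rewrite mulr0 subr0].
  - exists (y1 + y2 - v%:A * y1 * y2); last by ring.
    by apply: subringB => //; [exact: subringD | do 2?apply: subringM => //].
  - exists (u z); first exact: int_closure_gal.
    by rewrite /a rmorphB rmorph1 rmorphM /= gal_scalar.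
have vA0 : v%:A != 0 :> K by rewrite scaler_eq0 oner_eq0 orbF.
have [w Vw ew] : exists2 w : F, V w & y = w%:A.
  apply: int_closure_fixed => // s; apply: (mulfI vA0).
  have e : v%:A * y = 1 - \prod_(u : G) u a by rewrite ey opprB addrC subrK.
  by rewrite -{1}(gal_scalar s v) -rmorphM /= e rmorphB rmorph1 /= norm_fixed.
have Mn : M (1 - v * w)%:A.
  have -> : (1 - v * w)%:A = 1 - v%:A * y :> K.
    by rewrite ew scalerBl scale1r -scalerAl mul1r scalerA.
  rewrite -ey (bigD1 1%g) //= gal1E; apply: (idealMr hI) => //.
  by apply: subring_prod => // u _; apply: int_closure_gal; exact: (ideal_sub hI).
set nn := 1 - v * w in Mn.
have [n0|n0] := eqVneq nn 0.
  suff -> : v^-1 = w by [].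
  by apply: (mulfI v0); rewrite mulfV //; apply/eqP; rewrite -subr_eq0 -/nn n0.
(* If nn / v is in V, then v^-1 = w + nn / v is too. If v / nn is in V, then nn^-1 = (v / nn) w + 1
   is in V, impossible as nn lies in M. *)
have := hV; case=> _ /(_ (v / nn)); rewrite mulf_neq0 ?invr_eq0 // => /(_ isT) [Vq|Vq]; last first.
  have -> : v^-1 = w + (v / nn)^-1 by rewrite /nn in n0 *; field; rewrite v0 n0.
  exact: subringD.
case: (max_ideal1 hM); have Vn : V nn^-1.
  have -> : nn^-1 = v / nn * w + 1 by rewrite /nn in n0 *; field.
  by apply: subringD => //; [exact: subringM | exact: subring1].
have -> : 1 = nn^-1%:A * nn%:A :> K by rewrite -scalerAl mul1r scalerA mulVf // scale1r.
by apply: (idealMl hI) => //; exact: int_closure_id.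
Qed.

(** Every maximal ideal of the integral closure lies over the maximal ideal of V; in particular the
    trace of M on V is independent of M. *)
Lemma jacobson_base M v : max_ideal S M -> V v -> (jacobson V v <-> M v%:A).
Proof.
move=> hM Vv; have hI := max_ideal_ideal hM; split=> [[_ h]|Mv].
  apply: contrapT => nM; have [_] := h _ (base_unit hM Vv nM).
  rewrite divff ?subrr ?eqxx //; apply/eqP => v0; apply: nM.
  by rewrite v0 scale0r; exact: ideal0 hI.
split=> // y Vy.
have Vn : V (1 - v * y) by apply: subringB => //; [exact: subring1 | exact: subringM].
have nM : ~ M (1 - v * y)%:A.
  rewrite scalerBl scale1r => h; apply: (max_ideal1 hM).
  rewrite -[1](subrK (v * y)%:A); apply: (idealD hI) => //.
  have -> : (v * y)%:A = y%:A * v%:A :> K by rewrite -scalerAl mul1r scalerA mulrC.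
  by apply: (idealMl hI) => //; exact: int_closure_id.
split=> //; last exact: (base_unit hM Vn nM).
by apply/eqP => n0; apply: nM; rewrite n0 scale0r; exact: ideal0 hI.
Qed.

Lemma conj_max_int_closure (s : G) M : max_ideal S M -> max_ideal S (conj_pred s M).
Proof. by apply: conj_pred_max => x; exact: int_closure_gal. Qed.

Section Finite.
Variables (r : nat) (Ms : 'I_r -> K -> Prop).
Hypothesis hMs : forall i, max_ideal S (Ms i).
Hypothesis Ms_inj : forall i j, (forall x, Ms i x <-> Ms j x) -> i = j.
Hypothesis Ms_all : forall M, max_ideal S M -> exists i, forall x, M x <-> Ms i x.

(** If M' were not conjugate to M, some x in M' would lie in no conjugate of M. Its norm is in V and
    in M', hence in M, against primality. *)
Lemma gal_transitive M M' : max_ideal S M -> max_ideal S M' -> exists s : G, conj_pred s M = M'.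
Proof.
move=> hM hM'; apply: contrapT => nex.
have [i0 hi0] := Ms_all hM'.
have [|x Sx hx] := chinese hS hMs Ms_inj (z := fun i => if i == i0 then 0 else 1).
  by move=> i; case: eqP => _; [exact: subring0 | exact: subring1].
have M'x : M' x by apply/hi0; have := hx i0; rewrite eqxx subr0.
have nx (s : G) : ~ conj_pred s M x.
  move=> h; have [i hi] := Ms_all (conj_max_int_closure s hM).
  have ni : i != i0.
    apply/eqP => e; apply: nex; exists s; apply: funext => y; apply: propext.
    by rewrite hi hi0 e.
  have := hx i; rewrite (negPf ni) => h1; apply: (max_ideal1 (hMs i)).
  by rewrite -[1](subKr x); apply: (idealB (max_ideal_ideal (hMs i))) => //; apply/hi.
have SN : S (\prod_(u : G) u x) by apply: subring_prod => // u _; exact: int_closure_gal.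
have [v Vv ev] := int_closure_fixed SN (norm_fixed x).
have M'v : M' v%:A.
  rewrite -ev (bigD1 1%g) //= gal1E; apply: (idealMr (max_ideal_ideal hM')) => //.
  by apply: subring_prod => // u _; apply: int_closure_gal.
have Mv : M v%:A by apply/(jacobson_base hM Vv)/(jacobson_base hM' Vv).
move: Mv; rewrite -ev; apply: (max_ideal_prod hS hM) => u _; split; first exact: int_closure_gal.
by move=> h; apply: (nx u^-1%g); rewrite /conj_pred invgK.
Qed.

Variables (M : K -> Prop) (hM : max_ideal S M).
Definition decomp : {set G} := [set s | `[< conj_pred s M = M >]].
Lemma decompP s : reflect (conj_pred s M = M) (s \in decomp).
Proof. by rewrite inE; exact: asboolP. Qed.
Lemma decomp_group_set : group_set decomp.
Proof.
apply/group_setP; split; first by apply/decompP; exact: conj_pred1.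
move=> s t /decompP hs /decompP ht; apply/decompP.
by rewrite -[(s * t)%g]/(gcomp t s) conj_pred_comp hs ht.
Qed.

(** The fibres of s -> s(M) over the r maximal ideals are cosets of the decomposition group. *)
Lemma card_gal_decomp : #|{: G}| = (r * #|decomp|)%N.
Proof.
have /choice [psi hpsi] : forall s : G, exists i, conj_pred s M = Ms i.
  move=> s; have [i hi] := Ms_all (conj_max_int_closure s hM).
  by exists i; apply: funext => x; apply: propext.
have -> : #|{: G}| = #|[set: G]| by rewrite cardsT.
rewrite -sum1_card (partition_big psi xpredT) //=.
rewrite -[r in RHS]card_ord -sum_nat_const; apply: eq_bigr => i _.
have [s0 hs0] := gal_transitive hM (hMs i).
rewrite sum1_card -(card_imset decomp (f := fun d => gcomp s0 d)); last first.
  by move=> a b e; rewrite -[a](gcompVK s0) e gcompVK.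
apply: eq_card => s; rewrite unfold_in /= inE /=; apply/eqP/imsetP => [e|[d /decompP hd ->]].
  exists (gcomp s0^-1%g s); last by rewrite gcompVVK.
  by apply/decompP; rewrite conj_pred_comp hpsi e -hs0 conj_predVK.
apply: Ms_inj => x; rewrite -hpsi conj_pred_comp hd hs0 //.
Qed.
End Finite.
End IntegralClosure.

(** * The inertia group and the residue extension *)

Section Inertia.
Variables (F : fieldType) (K : splittingFieldType F) (V : F -> Prop).
Hypotheses (hV : valuation_domain V) (hgal : galois 1%VS {:K}).
Local Notation G := (gal_of {:K}).
Local Notation S := (integral_over (@inK F K V)).
Let hS : subring S := int_closure_subring K hV.
Variables (M : K -> Prop) (hM : max_ideal S M).
Local Notation O := (loc_at S M S).
Local Notation m := (loc_at S M M).
Implicit Types s t u : G.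
Let hO : subring O := loc_subring hS hM.
Let hm : ideal O m := mloc_ideal hS hM.
Let hI := max_ideal_ideal hM.

Definition inertia : {set G} := [set s : G | `[< forall x, O x -> m (s x - x) >]].
Local Notation T := inertia.
Lemma inertiaP s : reflect (forall x, O x -> m (s x - x)) (s \in T).
Proof. by rewrite inE; exact: asboolP. Qed.

Lemma GT_inertia s : GT S M s <-> s \in T.
Proof.
rewrite /GT (localizeE hM) (jacobson_loc hS hM).
by split=> [h|/inertiaP //]; apply/inertiaP.
Qed.

Lemma decomp_M s (x : K) : s \in decomp M -> M (s x) <-> M x.
Proof. by move=> /decompP h; rewrite -{1}h conj_predE. Qed.
Lemma decomp_loc s x : s \in decomp M -> O x -> O (s x).
Proof.
move=> hs [t [St Mt Stx]]; exists (s t); split.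
- exact: int_closure_gal.
- by rewrite decomp_M.
- by rewrite -rmorphM; exact: int_closure_gal.
Qed.
Lemma decomp_mloc s x : s \in decomp M -> m x -> m (s x).
Proof.
move=> hs [t [St Mt Stx]]; exists (s t); split.
- exact: int_closure_gal.
- by rewrite decomp_M.
- by rewrite -rmorphM decomp_M.
Qed.
Lemma inertia_decomp s : s \in T -> s \in decomp M.
Proof.
move=> /inertiaP hs; apply/decompP; apply: funext => y; apply: propext.
have key x : S x -> M x <-> M (s x).
  move=> Sx; have Ssx := int_closure_gal s Sx.
  have h : M (s x - x).
    apply: (mloc_inM hS hM); first exact: subringB.
    by apply: hs; exact: loc_sub.
  by split=> h'; [rewrite -(subrK x (s x)); apply: (idealD hI) | exact: (idealBl hI h h')].
rewrite /conj_pred; split=> h.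
  have := ideal_sub hI h => Sx; have /(key _ Sx) := h; by rewrite galKV.
apply/key; last by rewrite galKV.
by apply: int_closure_gal; exact: (ideal_sub hI).
Qed.
Lemma inertia_loc s x : s \in T -> O x -> O (s x).
Proof. by move=> /inertia_decomp; exact: decomp_loc. Qed.
Lemma inertia_group_set : group_set T.
Proof.
apply/group_setP; split; first by apply/inertiaP => x _; rewrite gal1E subrr; exact: ideal0 hm.
move=> s t hs ht; apply/inertiaP => x Ox.
rewrite -[(s * t)%g]/(gcomp t s) gcompE -[t (s x)](subrK (s x)) -addrA.
apply: (idealD hm); [|exact: (inertiaP _ hs)].
by apply: (inertiaP _ ht); exact: inertia_loc.
Qed.

Let DG : {group G} := Group (decomp_group_set M).
Let TG : {group G} := Group inertia_group_set.
Let TD : TG \subset DG.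
Proof. by apply/subsetP => s; exact: inertia_decomp. Qed.

Variables (L : fieldType) (phi : K -> L).
Hypothesis phi1 : phi 1 = 1.
Hypothesis phiD : forall x y, O x -> O y -> phi (x + y) = phi x + phi y.
Hypothesis phiM : forall x y, O x -> O y -> phi (x * y) = phi x * phi y.
Hypothesis phi_surj : forall z, exists2 x, O x & phi x = z.
Hypothesis phi_ker : forall x, O x -> (phi x = 0 <-> m x).
Let phi0 := pmorph0 hO phiD.

Lemma phi_eq x y : O x -> O y -> phi x = phi y <-> m (x - y).
Proof.
move=> Ox Oy; rewrite -phi_ker ?(pmorphB hO phiD) //; last exact: subringB.
by split=> [->|/eqP]; [rewrite subrr | rewrite subr_eq0 => /eqP].
Qed.

Let OV v : V v -> O v%:A.
Proof. by move=> Vv; apply: loc_sub => //; exact: int_closure_id. Qed.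

Section Fixed.
Variables (r : nat) (Ms : 'I_r -> K -> Prop).
Hypothesis hMs : forall i, max_ideal S (Ms i).
Hypothesis Ms_inj : forall i j, (forall x, Ms i x <-> Ms j x) -> i = j.
Hypothesis Ms_all : forall M, max_ideal S M -> exists i, forall x, M x <-> Ms i x.
Hypothesis hsep : res_separable V O.

(* Lift the residue to an element of S lying in all other maximal ideals: the reduction of
   its characteristic polynomial is [(X - y)^|D| X^(n - |D|)]. *)
Lemma fixed_residue z : O z -> (forall s, s \in decomp M -> phi (s z) = phi z) ->
  exists2 v : F, V v & phi z = phi v%:A.
Proof.
move=> Oz hz.
have [i0 hi0] := Ms_all hM.
have [x0 Sx0 hx0] : exists2 x, S x & m (z - x).
  have [t [St Mt Stz]] := Oz.
  have [u Su Mu] := max_ideal_inv hS hM St Mt.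
  exists (u * (t * z)); first exact: subringM.
  have -> : z - u * (t * z) = - ((t * u - 1) * z) by ring.
  by apply: (idealN hm); apply: (idealMr hm) => //; exact: mloc_sub.
have [|x Sx hx] := chinese hS hMs Ms_inj (z := fun i => if i == i0 then x0 else 0).
  by move=> i; case: eqP => _ //; exact: subring0.
have Ox := loc_sub hS hM Sx.
have mx : m (x - z).
  have -> : x - z = (x - x0) - (z - x0) by ring.
  apply: (idealB hm) => //; apply: mloc_sub => //.
  by apply/hi0; have := hx i0; rewrite eqxx.
have phis s : s \in decomp M -> phi (s x) = phi z.
  move=> hs; rewrite -(hz s hs); apply/phi_eq; [exact: decomp_loc|exact: decomp_loc|].
  by rewrite -rmorphB; exact: decomp_mloc.
have phin s : s \notin decomp M -> phi (s x) = 0.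
  move=> hs; apply/phi_ker; first by apply: loc_sub => //; exact: int_closure_gal.
  apply: mloc_sub => //.
  have [i hi] := Ms_all (conj_max_int_closure s^-1%g hM).
  have ni : i != i0.
    apply: contra hs => /eqP e; apply/decompP.
    have e' : conj_pred s^-1%g M = M by apply: funext => w; apply: propext; rewrite hi e hi0.
    by rewrite -{1}e' conj_predKV.
  have := hx i; rewrite (negPf ni) subr0 => /hi; by rewrite /conj_pred invgK.
pose P : {poly K} := \prod_(s : G) ('X - (s x)%:P).
have Oc (s : G) : O (s x) by apply: loc_sub => //; exact: int_closure_gal.
have PS i : S P`_i.
  by apply: (poly_over_prod hS) => s; exact: int_closure_gal.
have Pfix (s : G) : map_poly s P = P.
  rewrite rmorph_prod [RHS](reindex_inj (mulIg s)) /=; apply: eq_bigr => u _.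
  by rewrite rmorphB /= map_polyX map_polyC /= -gcompE.
have /choice [c hc] : forall i, exists v : F, V v /\ P`_i = v%:A.
  move=> i; have [|v Vv e] := int_closure_fixed hV hgal (PS i); last by exists v.
  by move=> s; rewrite -coef_map Pfix.
pose k w := exists2 v : F, V v & w = phi v%:A.
have hk : subring k.
  have hVr := valuation_subring hV; split.
  - by exists 0; [exact: subring0 | rewrite scale0r].
  - by exists 1; [exact: subring1 | rewrite scale1r].
  - move=> _ _ [a Va ->] [b Vb ->]; exists (a - b); first exact: subringB.
    by rewrite scalerBl (pmorphB hO phiD) //; exact: OV.
  - move=> _ _ [a Va ->] [b Vb ->]; exists (a * b); first exact: subringM.
    by rewrite -phiM; [rewrite -scalerAl mul1r scalerA| exact: OV| exact: OV].
have hkV w : k w -> k w^-1.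
  move=> [a Va ea]; have [->|w0] := eqVneq w 0.
    by rewrite invr0; exact: subring0.
  have nMa : ~ M a%:A.
    move=> h; move/eqP: w0; apply; rewrite ea; apply/phi_ker; first exact: OV.
    exact: mloc_sub.
  have Vai := base_unit hV hgal hM Va nMa.
  have a0 : a != 0.
    by apply/eqP => a0; apply: nMa; rewrite a0 scale0r; exact: ideal0 hI.
  exists a^-1 => //; apply: (mulfI w0); rewrite mulfV // ea -phiM; try exact: OV.
  by rewrite -scalerAl mul1r scalerA mulfV // scale1r phi1.
have [k' [iota hiota]] := subfield_typeP hk hkV.
have lift (q : {poly L}) : (forall i, k q`_i) -> exists q', q = map_poly iota q'.
  move=> hq; have /choice [g hg] : forall i, exists a, q`_i = iota a by move=> i; apply/hiota.
  exists (\poly_(i < size q) g i); apply/polyP => i; rewrite coef_map coef_poly.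
  by case: ltnP => hi; [exact: hg | rewrite /= rmorph0 nth_default].
(* Separability supplies a polynomial over V with the residue of z as a simple root; its gcd with
   the reduction of P isolates that root, even though it is repeated in P. *)
have [p [a [b [pm pV abV hab]]]] := hsep Oz; rewrite (jacobson_loc hS hM) => hroot.
pose psi v := phi v%:A.
have hVr := valuation_subring hV.
have psi1 : psi 1 = 1 by rewrite /psi scale1r.
have psiD v w : V v -> V w -> psi (v + w) = psi v + psi w.
  by move=> Vv Vw; rewrite /psi scalerDl phiD //; exact: OV.
have psiM v w : V v -> V w -> psi (v * w) = psi v * psi w.
  move=> Vv Vw; rewrite /psi -phiM; try exact: OV.
  by rewrite -scalerAl mul1r scalerA.
have psi0 := pmorph0 hVr psiD.
have aV i : V a`_i by case: (abV i).
have bV i : V b`_i by case: (abV i).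
have p'V i : V (p^`())`_i.
  by rewrite coef_deriv -mulr_natr; apply: subringM => //; exact: subring_nat.
set y := phi z.
have py : root (map_poly psi p) y.
  have e : map_poly phi (map_poly (in_alg K) p) = map_poly psi p.
    by apply/polyP => i; rewrite !coef_map_id0 ?rmorph0.
  rewrite /root -e -(horner_pmorph hO phi1 phiD phiM) //; last first.
    by move=> i; rewrite coef_map; exact: OV.
  apply/eqP/phi_ker => //; rewrite horner_coef; apply: subring_sum => // i _.
  by apply: subringM => //; [rewrite coef_map; exact: OV | exact: subringX].
have py' : (map_poly psi p)^`().[y] != 0.
  have e : map_poly psi (a * p + b * p^`()) = 1.
    apply/polyP => i; rewrite coef_map_id0 // coef1.
    have Vq : V (a * p + b * p^`())`_i.
      by rewrite coefD; apply: subringD => //; exact: (poly_overM hVr).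
    have Vd : V (i == 0%N)%:R by exact: subring_nat.
    have := hab i; rewrite coefB coef1 => hJ.
    have : psi ((a * p + b * p^`())`_i - (i == 0%N)%:R) = 0.
      apply/phi_ker; first by apply: OV; exact: subringB.
      by apply: mloc_sub => //; apply/(jacobson_base hV hgal hM) => //; exact: subringB.
    rewrite (pmorphB hVr psiD) // (pmorph_nat hVr psi1 psiD) => /eqP.
    by rewrite subr_eq0 => /eqP.
  have := congr1 (fun q => q.[y]) e.
  rewrite (map_poly_pmorphD hVr psiD); try exact: (poly_overM hVr).
  rewrite !(map_poly_pmorphM hVr psiD psiM) // hornerD !hornerM (eqP py) mulr0 add0r.
  rewrite (map_poly_pmorph_deriv hVr psi1 psiD psiM) // hornerC => e1.
  by apply/eqP => e2; move/eqP: e1; rewrite e2 mulr0 eq_sym oner_eq0.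
have [p0 ep0] : exists p0, map_poly psi p = map_poly iota p0.
  by apply: lift => i; rewrite coef_map_id0 //; exists p`_i.
have [q0 eq0] : exists q0, map_poly phi P = map_poly iota q0.
  by apply: lift => i; rewrite coef_map_id0 //; have [Vc ec] := hc i; exists (c i); rewrite ?ec.
have D0 : (0 < #|decomp M|)%N by have := cardG_gt0 DG.
have eP : map_poly iota q0 = ('X - y%:P) ^+ (#|decomp M|.-1).+1 *
     'X ^+ #|[predC mem (decomp M)]|.
  rewrite -eq0 (map_poly_pmorph_prod hO phi1 phiD phiM) // prednK //.
  rewrite (bigID (fun s => s \in decomp M)) /=; congr (_ * _).
    rewrite -prodr_const; apply: eq_bigr => s hs; by rewrite phis.
  rewrite -prodr_const; apply: eq_big => [s|s hs]; first by rewrite !inE.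
  by rewrite phin // subr0.
rewrite ep0 in py py'.
have [w ew] := simple_common_root py py' eP.
have : k y by apply/hiota; exists w.
by [].
Qed.
End Fixed.

Let cosetE s t : s \in DG -> t \in DG ->
  (forall x, O x -> phi (s x) = phi (t x)) <-> (s * t^-1)%g \in TG.
Proof.
move=> hs ht; have htV : t^-1%g \in decomp M by rewrite -[decomp M]/(gval DG) groupV.
rewrite -[(s * t^-1)%g]/(gcomp t^-1%g s); split=> [h|/inertiaP h x Ox].
  apply/inertiaP => x Ox; rewrite gcompE -{2}[x](galVK t) -rmorphB.
  by apply: decomp_mloc => //; apply/phi_eq; [exact: decomp_loc|exact: decomp_loc|exact: h].
apply/phi_eq; [exact: decomp_loc|exact: decomp_loc|].
have := h x Ox; rewrite gcompE => /(decomp_mloc ht).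
by rewrite rmorphB /= galKV.
Qed.

(** The decomposition group acts on the residue field through cosets of the inertia group. With one
    representative from each coset, the induced automorphisms are pairwise distinct, as independence
    of characters requires. *)
Let rep s := repr (TG :* s)%g.
Let repE s : (TG :* rep s)%g = (TG :* s)%g. Proof. exact: rcoset_repr. Qed.
Let rep_in s : s \in DG -> rep s \in DG.
Proof.
move=> hs; have /rcosetP [t ht ->] : rep s \in (TG :* s)%g by rewrite -repE rcoset_refl.
by rewrite groupM // (subsetP TD).
Qed.
Let rep_phi s x : s \in DG -> O x -> phi (s x) = phi (rep s x).
Proof.
move=> hs; apply: (proj2 (cosetE hs (rep_in hs))).
by rewrite -mem_rcoset repE rcoset_refl.
Qed.
Let rep_eq s t : s \in DG -> t \in DG -> (forall x, O x -> phi (s x) = phi (t x)) -> rep s = rep t.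
Proof.
by move=> hs ht /(cosetE hs ht) h; rewrite /rep; congr repr; apply: rcoset_eqP; rewrite mem_rcoset.
Qed.
Let repK s : rep (rep s) = rep s. Proof. by rewrite {1}/rep repE. Qed.
Let R := rep @: DG.
Let RD s : s \in R -> s \in DG. Proof. by case/imsetP => t ht ->; exact: rep_in. Qed.
Let R_rep s : s \in R -> rep s = s. Proof. by case/imsetP => t ht ->. Qed.
Let card_R : (#|TG| * #|R|)%N = #|DG|.
Proof.
rewrite -(Lagrange TD); congr (_ * _)%N; rewrite -[LHS](card_in_imset (f := fun s => (TG :* s)%g)).
  congr #|pred_of_set _|; apply/setP => A; apply/imsetP/rcosetsP => [[s /RD hs ->]|[s hs ->]].
    by exists s.
  by exists (rep s); rewrite ?repE //; apply: imset_f.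
by move=> s t /R_rep hs /R_rep ht; rewrite -{2}hs -{2}ht /rep => ->.
Qed.
Let R_inj s t : s \in R -> t \in R -> (forall x, O x -> phi (s x) = phi (t x)) -> s = t.
Proof. by move=> hs ht /(rep_eq (RD hs) (RD ht)); rewrite !R_rep. Qed.

Let ev (a : 'I_#|R|) : G := enum_val a.
Let ev_in a : ev a \in R. Proof. exact: enum_valP. Qed.
Let evD a : ev a \in decomp M. Proof. exact: RD (ev_in a). Qed.
Let dedekind (c : 'I_#|R| -> L) :
  (forall x, O x -> \sum_a c a * phi (ev a x) = 0) -> forall a, c a = 0.
Proof.
move=> h a.
rewrite -[RHS](@dedekind_independence _ _ O _ [set: 'I_#|R|] (fun a x => phi (ev a x)) c hO _ _ _ a).
- rewrite (bigD1 a) ?inE ?asboolT //= big1 ?addr0 // => b /andP [/andP [_ /asboolP e] nba].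
  by case/eqP: nba; apply: enum_val_inj; exact: R_inj e.
- by move=> b _; rewrite rmorph1.
- by move=> b x y _ Ox Oy; rewrite rmorphM phiM //; exact: decomp_loc.
- by move=> x Ox; rewrite -[RHS](h x Ox); apply: eq_bigl => b; rewrite inE.
- by rewrite inE.
Qed.

Section Degree.
Variables (r : nat) (Ms : 'I_r -> K -> Prop).
Hypothesis hMs : forall i, max_ideal S (Ms i).
Hypothesis Ms_inj : forall i j, (forall x, Ms i x <-> Ms j x) -> i = j.
Hypothesis Ms_all : forall M, max_ideal S M -> exists i, forall x, M x <-> Ms i x.
Variable d : nat.
Hypotheses (hsep : res_separable V O) (hdeg : res_degree V O d).

(** The matrix B of residues of the conjugates s(b_i), with s in [R], is square. Its rows are
    independent by Dedekind's theorem. Its columns are independent by Artin's argument: a relation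
    is averaged to one with coefficients in the residue field of V, where the b_i are
    independent. *)
Lemma card_decomp_inertia : #|decomp M| = (#|T| * d)%N.
Proof.
have [b [Ob bfree bspan]] := hdeg; rewrite (jacobson_loc hS hM) in bfree bspan.
pose B : 'M[L]_(#|R|, d) := \matrix_(a, i) phi (ev a (b i)).
have phiV v x : V v -> O x -> phi (v%:A * x) = phi v%:A * phi x.
  by move=> Vv Ox; rewrite phiM //; exact: OV.
have Rd : (#|R| <= d)%N.
  suff /eqP <- : row_free B by exact: rank_leq_col.
  apply: inj_row_free => u uB; apply/rowP => a; rewrite [RHS]mxE.
  apply: (dedekind (c := fun a => u 0 a)) => x Ox.
  have [w [Vw mw]] := bspan x Ox.
  have Ow : O (\sum_i (w i)%:A * b i).
    by apply: subring_sum => // i _; apply: subringM => //; exact: OV.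
  have e a1 : phi (ev a1 x) = \sum_i phi (w i)%:A * B a1 i.
    have -> : phi (ev a1 x) = phi (ev a1 (\sum_i (w i)%:A * b i)).
      apply/phi_eq; [exact: decomp_loc|exact: decomp_loc|].
      by rewrite -rmorphB; exact: decomp_mloc.
    rewrite rmorph_sum (pmorph_sum hO phiD) => [|i _]; last first.
      by apply: decomp_loc => //; apply: subringM => //; exact: OV.
    by apply: eq_bigr => i _; rewrite rmorphM /= gal_scalar phiV ?mxE //; exact: decomp_loc.
  under eq_bigr do rewrite e mulr_sumr.
  rewrite exchange_big big1 //= => i _.
  have := congr1 (fun A : 'rV_d => A 0 i) uB; rewrite !mxE => e1.
  transitivity (phi (w i)%:A * \sum_j u 0 j * B j i); last by rewrite e1 mulr0.
  by rewrite mulr_sumr; apply: eq_bigr => j _; rewrite mulrCA.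
have dR : (d <= #|R|)%N.
  suff /eqP <- : row_free B^T by exact: rank_leq_col.
  apply: inj_row_free => c cB; apply/rowP => i0; rewrite [RHS]mxE.
  apply: contrapT => ci0.
  have cD s : s \in DG -> \sum_i c 0 i * phi (s (b i)) = 0.
    move=> hs; have hr : rep s \in R by apply: imset_f.
    have := congr1 (fun A : 'rV_#|R| => A 0 (enum_rank_in hr (rep s))) cB; rewrite !mxE => e.
    rewrite -[RHS]e; apply: eq_bigr => i _; rewrite !mxE rep_phi //.
    by rewrite /ev enum_rankK_in.
  have /choice [g hg] : forall i, exists x, O x /\ phi x = c 0 i.
    by move=> i; have [x Ox e] := phi_surj (c 0 i); exists x.
  have Og i : O (g i) by case: (hg i).
  (* The multiplier keeps the averaged relation nontrivial at i0; it exists by independence of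
     characters because c_(i0) is nonzero. *)
  have [al [Oal nal]] : exists al, O al /\ \sum_(s in R) phi (s (al * g i0)) <> 0.
    apply: contrapT => nex; apply: ci0; have [_ <-] := hg i0.
    have h1 : rep 1%g \in R by apply: imset_f; exact: group1.
    have hD := RD h1.
    have h x : O x -> \sum_a phi (ev a (g i0)) * phi (ev a x) = 0.
      move=> Ox; apply: contrapT => nz; apply: nex; exists x; split=> //.
      rewrite big_enum_val => e; apply: nz; rewrite -[RHS]e; apply: eq_bigr => a _.
      by rewrite rmorphM phiM 1?mulrC //; apply: decomp_loc => //; exact: evD.
    have := dedekind h (enum_rank_in h1 (rep 1%g)).
    rewrite /ev enum_rankK_in // => /(phi_ker (decomp_loc hD (Og i0))) mg.
    apply/phi_ker => //.
    have := decomp_mloc (s := (rep 1%g)^-1%g) _ mg; rewrite galVK; apply.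
    by rewrite -[decomp M]/(gval DG) groupV.
  (* Composition with an element of the decomposition group permutes the cosets of T, so these
     traces are fixed modulo the maximal ideal and [fixed_residue] applies. *)
  pose z i := \sum_(s in R) s (al * g i).
  have Oz i : O (z i).
    by apply: subring_sum => // s /RD hs; apply: decomp_loc => //; exact: subringM.
  have phiz i : phi (z i) = \sum_(s in R) phi (s (al * g i)).
    by rewrite /z (pmorph_sum hO phiD) // => s /RD hs; apply: decomp_loc => //; exact: subringM.
  have zfix i s : s \in decomp M -> phi (s (z i)) = phi (z i).
    move=> hs; have Ox : O (al * g i) by exact: subringM.
    rewrite [RHS]phiz rmorph_sum (pmorph_sum hO phiD) => [|u /RD hu]; last first.
      by do 2!apply: decomp_loc => //.
    pose h u := rep (u * s)%g.
    have hR u : u \in R -> h u \in R by move=> /RD hu; apply: imset_f; exact: groupM.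
    have h_inj : {in R &, injective h}.
      move=> u v hu hv e; rewrite -(R_rep hu) -(R_rep hv) /rep; congr repr.
      have : (TG :* (u * s) = TG :* (v * s))%g by rewrite -repE -/(h u) e repE.
      by rewrite !rcosetM => /rcoset_inj.
    have im : h @: R = R.
      have cR : #|h @: R| = #|R| by exact: card_in_imset.
      apply/eqP; rewrite eqEcard cR leqnn andbT.
      by apply/subsetP => _ /imsetP [u hu ->]; exact: hR.
    have e := big_imset (fun u : G => phi (u (al * g i))) h_inj; rewrite im /= in e.
    rewrite e; apply: eq_bigr => u hu.
    by rewrite /= -gcompE -[gcomp s u]/(u * s)%g rep_phi //; apply: groupM => //; exact: RD.
  have /choice [v hv] : forall i, exists v : F, V v /\ phi (z i) = phi v%:A.
    by move=> i; have [|v Vv e] := fixed_residue hMs Ms_inj Ms_all hsep (Oz i); [exact: zfix|exists v].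
  have Vv i : V (v i) by case: (hv i).
  have mv : m (\sum_i (v i)%:A * b i).
    apply/phi_ker; first by apply: subring_sum => // i _; apply: subringM => //; exact: OV.
    rewrite (pmorph_sum hO phiD) => [|i _]; last by apply: subringM => //; exact: OV.
    transitivity (\sum_i \sum_(s in R) phi (s al) * (phi (s (g i)) * phi (b i))).
      apply: eq_bigr => i _; rewrite phiV //; have [_ <-] := hv i; rewrite phiz mulr_suml.
      by apply: eq_bigr => s /RD hs; rewrite rmorphM phiM ?mulrA //; exact: decomp_loc.
    rewrite exchange_big big1 //= => s /RD hs; rewrite -mulr_sumr.
    have hsV : s^-1%g \in DG by rewrite groupV.
    suff -> : \sum_i phi (s (g i)) * phi (b i) = 0 by rewrite mulr0.
    have Oi i : O (g i * s^-1%g (b i)) by apply: subringM => //; exact: decomp_loc.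
    have Os : O (\sum_i g i * s^-1%g (b i)) by exact: subring_sum.
    transitivity (phi (s (\sum_i g i * s^-1%g (b i)))).
      rewrite rmorph_sum (pmorph_sum hO phiD) => [|i _]; last exact: decomp_loc.
      by apply: eq_bigr => i _; rewrite rmorphM /= galKV phiM //; exact: decomp_loc.
    apply/phi_ker; first exact: decomp_loc.
    apply: decomp_mloc => //; apply/phi_ker => //.
    rewrite (pmorph_sum hO phiD) // -[RHS](cD _ hsV); apply: eq_bigr => i _.
    by have [_ <-] := hg i; rewrite phiM //; exact: decomp_loc.
  have hJ := bfree v Vv mv i0.
  apply: nal; rewrite -phiz; have [_ ->] := hv i0; apply/phi_ker; first exact: OV.
  by apply: mloc_sub => //; apply/(jacobson_base hV hgal hM).
rewrite -[RHS]/(#|TG| * d)%N -[LHS]/(#|DG|) -card_R; congr (_ * _)%N.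
by apply/eqP; rewrite eqn_leq Rd dR.
Qed.
End Degree.
End Inertia.

(** * Tame ramification *)

Section Tame.
Variables (F : fieldType) (K : splittingFieldType F) (V : F -> Prop).
Hypotheses (hV : valuation_domain V) (hgal : galois 1%VS {:K}).
Local Notation G := (gal_of {:K}).
Local Notation S := (integral_over (@inK F K V)).
Let hS : subring S := int_closure_subring K hV.
Variables (M : K -> Prop) (hM : max_ideal S M).
Local Notation O := (loc_at S M S).
Local Notation m := (loc_at S M M).
Local Notation T := (inertia V M).
Let hO : subring O := loc_subring hS hM.
Let hm : ideal O m := mloc_ideal hS hM.
Let hI := max_ideal_ideal hM.
Let hval x : exists t, [/\ S t, ~ M t & S (t * x) \/ S (t * x^-1)].
Proof. exact: (integral_closure_valuation hV x hM). Qed.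

Lemma dim_gal : \dim {:K} = #|{: G}|.
Proof.
have := galois_dim hgal; rewrite dimv1 divn1 => ->.
rewrite -cardsT; apply: eq_card => s; rewrite inE.
by rewrite gal_kHom ?sub1v // k1HomE; apply/ahom_inP; split=> [x y|]; rewrite ?rmorphM ?rmorph1.
Qed.

(** Needed because tameness is stated in terms of primes that vanish in the residue field. *)
Lemma nat_prime_factor_in n : (0 < n)%N -> M n%:R -> exists2 p, prime p /\ (p %| n)%N & M p%:R.
Proof.
have [b] := ubnP n; elim: b n => // b IH n hn n0 Mn.
have n1 : (1 < n)%N.
  by case: n n0 Mn {hn} => [|[|n]] // _; rewrite mulr1n => /(max_ideal1 hM).
have pp := pdiv_prime n1; have /dvdnP [k ek] := pdiv_dvd n.
have k0 : (0 < k)%N by case: k ek => // e; rewrite e mul0n in n0.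
move: Mn; rewrite {1}ek natrM => /(max_ideal_prime hS hM) [||Mk|Mp]; try exact: subring_nat.
  have [|p [hp dp] Mp] := IH k _ k0 Mk.
    rewrite -ltnS; apply: leq_trans hn; rewrite ltnS {1}ek -{1}[k]muln1 ltn_mul2l k0 /=.
    exact: prime_gt1.
  by exists p => //; split=> //; rewrite ek; exact: dvdn_mulr.
by exists (pdiv n) => //; split=> //; exact: pdiv_dvd.
Qed.

Section Card.
Variables (r : nat) (Ms : 'I_r -> K -> Prop).
Hypothesis hMs : forall i, max_ideal S (Ms i).
Hypothesis Ms_inj : forall i j, (forall x, Ms i x <-> Ms j x) -> i = j.
Hypothesis Ms_all : forall M, max_ideal S M -> exists i, forall x, M x <-> Ms i x.

(** Comparing |G| = r |T| d with the degree e d r gives |T| = e; this is where the extension being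
    defectless enters. *)
Lemma inertia_tame e d : res_degree V O d -> \dim {:K} = (e * d * r)%N ->
  res_char_ndvd V e -> res_separable V O -> ~ M #|T|%:R.
Proof.
move=> hd hdim he hsep.
have [L [phi [phi1 phiD phiM phis phi0]]] := residue_field hO (max_ideal_loc hS hM).
have eD := card_decomp_inertia hV hgal hM phi1 phiD phiM phis phi0 hMs Ms_inj Ms_all hsep hd.
have eG := card_gal_decomp hV hgal hMs Ms_inj Ms_all hM.
have G0 : (0 < #|{: G}|)%N by apply/card_gt0P; exists 1%g.
have eT : #|T| = e.
  move: hdim; rewrite dim_gal eG eD => h.
  have : (0 < r * (#|T| * d))%N by rewrite -eD -eG.
  rewrite !muln_gt0 => /and3P [r0 _ d0].
  apply/eqP; rewrite -(eqn_pmul2r d0) -(eqn_pmul2r r0); apply/eqP; rewrite -h; ring.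
rewrite eT => Me.
have e0 : (0 < e)%N.
  by move: G0; rewrite -dim_gal hdim; case: (e) => //; rewrite !mul0n.
have [p [pp dp] Mp] := nat_prime_factor_in e0 Me.
have Vp : V p%:R by apply: subring_nat; exact: valuation_subring.
have := he p pp; rewrite dp => h; suff: false by []; apply: h.
apply/(jacobson_base hV hgal hM) => //.
by rewrite scaler_nat.
Qed.
End Card.

Hypothesis tameT : ~ M #|T|%:R.
Let OT s x : s \in T -> O x -> O (s x). Proof. exact: inertia_loc. Qed.
Let mT s x : s \in T -> O x -> m (s x - x). Proof. by move/inertiaP; exact. Qed.
Let mlocT s x : s \in T -> m x -> m (s x).
Proof. by move/(inertia_decomp hV hM); exact: decomp_mloc. Qed.

Section Wild.
Variables (e : nat) (hram : ram_index V O e) (hfg : fin_gen_module V S).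
Variables (pi : K) (mpi : m pi) (pi0 : pi != 0) (hpi : forall x, m x -> O (x / pi)).

(** The wild inertia group: the s in T for which the residue of s(pi) / pi is 1. *)
Definition wild : {set G} := [set s in T | `[< m (s pi / pi - 1) >]].
Let wildP s : s \in wild -> s \in T /\ m (s pi / pi - 1).
Proof. by rewrite inE => /andP [hs /asboolP]. Qed.
Let m1O x : m (x - 1) -> O x.
Proof. by move=> h; rewrite -[x](subrK 1); apply: (subringD hO); [exact: (mloc_loc hM) | exact: subring1]. Qed.

Lemma wild_group_set : group_set wild.
Proof.
apply/group_setP; split.
  rewrite inE; apply/andP; split; first by have /group_setP [] := inertia_group_set hV hM.
  by apply/asboolP; rewrite gal1E divff // subrr; exact: ideal0 hm.
move=> s t /wildP [hs hs'] /wildP [ht ht']; rewrite inE; apply/andP; split.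
  by have /group_setP [_] := inertia_group_set hV hM; apply.
apply/asboolP; rewrite -[(s * t)%g]/(gcomp t s) gcompE.
have -> : t (s pi) / pi - 1 = t (s pi / pi - 1) * (t pi / pi) + (t pi / pi - 1).
  rewrite rmorphB rmorphM fmorphV rmorph1 /=; field.
  by rewrite pi0 fmorph_eq0 pi0.
apply: (idealD hm) => //; apply: (idealMr hm); [exact: m1O | exact: mlocT].
Qed.
Let WG : {group G} := Group wild_group_set.
Let tameW : ~ M #|wild|%:R.
Proof.
have WT : WG \subset Group (inertia_group_set hV hM) by apply/subsetP => s /wildP [].
move=> h; apply: tameT; have /dvdnP [k ->] : (#|wild| %| #|T|)%N := cardSg WT.
by rewrite natrM; apply: (idealMl hI) => //; exact: subring_nat.
Qed.
Let o : K := #|wild|%:R.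
Let o0 : o != 0 := max_ideal_neq0 hM tameW.
Let So : S o := subring_nat hS _.
Let Oo : O o^-1 := loc_inv_sub hS hM So tameW.

Let tr x := \sum_(s in WG) s x.
Let trB x y : tr (x - y) = tr x - tr y.
Proof. by rewrite /tr -sumrB; apply: eq_bigr => s _; rewrite rmorphB. Qed.
Let tr_fixed s x : s \in wild -> s (tr x) = tr x.
Proof.
move=> hs; rewrite /tr rmorph_sum [RHS](reindex_inj (mulIg s)) /=.
by apply: eq_big => [u|u _]; [rewrite -[RHS]/((u * s)%g \in WG) groupMr | rewrite -gcompE].
Qed.
Let tr_scal x y : (forall s, s \in wild -> s y = y) -> tr (x * y) = tr x * y.
Proof. by move=> h; rewrite mulr_suml; apply: eq_bigr => s hs; rewrite rmorphM /= h. Qed.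

Let pik k : pi ^+ k != 0 := expf_neq0 k pi0.

(* W acts trivially on each [pi^k O / pi^{k+1} O], so an element of trace zero is divisible by
   all powers of [pi]. *)
Let wild_step k s x : s \in wild -> O (x / pi ^+ k) -> m ((s x - x) / pi ^+ k).
Proof.
move=> /wildP [hs hs'] Ox.
have hk : m ((s pi / pi) ^+ k - 1).
  elim: k {Ox} => [|k IH]; first by rewrite expr0 subrr; exact: ideal0 hm.
  have -> : (s pi / pi) ^+ k.+1 - 1 = (s pi / pi - 1) * (s pi / pi) ^+ k + ((s pi / pi) ^+ k - 1).
    by rewrite exprS; ring.
  apply: (idealD hm) => //; apply: (idealMr hm) => //; apply: (subringX hO); exact: m1O.
set a := x / pi ^+ k in Ox.
have ex : x = a * pi ^+ k by rewrite /a divfK.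
have -> : (s x - x) / pi ^+ k = ((s pi / pi) ^+ k - 1) * s a + (s a - a).
  rewrite ex rmorphM rmorphXn /= expr_div_n; field.
  by rewrite pik.
by apply: (idealD hm); [apply: (idealMr hm) => //; exact: OT | exact: mT].
Qed.

Let trace0_divisible k x : O x -> tr x = 0 -> O (x / pi ^+ k).
Proof.
move=> Ox x0; elim: k => [|k IH]; first by rewrite expr0 divr1.
have : m (\sum_(s in WG) (s x - x) / pi ^+ k).
  by apply: (ideal_sum hm) => s hs; exact: wild_step.
rewrite -mulr_suml sumrB -/(tr x) x0 sub0r sumr_const -mulr_natl -/o => h.
have mx : m (x / pi ^+ k).
  have -> : x / pi ^+ k = - (o^-1 * (- (o * x) / pi ^+ k)) by field; rewrite pik o0.
  by apply: (idealN hm); apply: (idealMl hm).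
have := hpi mx; congr O; rewrite exprS; field.
by rewrite pi0 pik.
Qed.

(** Pigeonhole: two of the e + 1 powers pi^0, ..., pi^e fall into the same of the e classes of the
    value group modulo that of V. *)
Let base_elt : exists k v, [/\ (0 < k)%N, v != 0 & unit_of O (pi ^+ k / v%:A)].
Proof.
have [c [c0 cl _]] := hram.
have /choice [i hi] : forall k : 'I_e.+1, exists i, exists v u,
    [/\ v != 0, unit_of O u & pi ^+ k = c i * v%:A * u].
  by move=> k; exact: cl.
have /injectivePn [a [b nab eab]] : ~~ injectiveb i.
  by apply/negP => /injectiveP /leq_card; rewrite !card_ord ltnn.
wlog lab : a b nab eab / (a < b)%N.
  move=> h; case: (ltngtP a b) => hab; first exact: h hab.
    by apply: (h b a); rewrite // eq_sym.
  by case/eqP: nab; apply: val_inj.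
have [va [ua [va0 [Oua ua0 Ouai] ea]]] := hi a.
have [vb [ub [vb0 [Oub ub0 Oubi] eb]]] := hi b.
exists (b - a)%N, (vb / va); split; [by rewrite subn_gt0 | by rewrite mulf_neq0 ?invr_eq0|].
have vA0 (v : F) : v != 0 -> v%:A != 0 :> K by move=> h; rewrite scaler_eq0 oner_eq0 orbF.
have -> : pi ^+ (b - a) / (vb / va)%:A = ub / ua.
  have -> : (vb / va)%:A = vb%:A / va%:A :> K by rewrite -!in_algE fmorph_div.
  rewrite expfB // ea eb eab; field.
  by rewrite ua0 c0 !vA0.
split; first exact: (subringM hO).
  by rewrite mulf_neq0 ?invr_eq0.
by rewrite invf_div; exact: (subringM hO).
Qed.

(** The map x -> o x - tr(x) sends S into elements of trace zero, and by finite generation the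
    images [ee] of the generators have a member x dividing all of them in [O]. As x has trace zero
    it is divisible by pi^k, hence by some v of V in the maximal ideal. A multiple t x / v in S
    again has trace zero, so o t x / v is a combination of the [ee] and divisible by x; thus v
    divides the unit o t. If all [ee] vanish, the wild group fixes S and therefore K. *)
Lemma wild_trivial s : s \in wild -> s = 1%g.
Proof.
have [k [v [k0 v0 [Oq q0 Oqi]]]] := base_elt.
have vA0 : v%:A != 0 :> K by rewrite scaler_eq0 oner_eq0 orbF.
have mv : m v%:A.
  have -> : v%:A = (pi ^+ k / v%:A)^-1 * pi ^+ k by rewrite invf_div divfK.
  apply: (idealMl hm) => //; case: (k) k0 => // k' _; rewrite exprS; apply: (idealMr hm) => //.
  by apply: (subringX hO); exact: (mloc_loc hM).
have [n [g hg]] := hfg.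
have Sg i : S (g i).
  apply/hg; exists (fun j => (j == i)%:R); split=> [j|]; first exact: (subring_nat (valuation_subring hV)).
  rewrite (bigD1 i) //= eqxx scale1r mul1r big1 ?addr0 // => j /negPf ->.
  by rewrite scale0r mul0r.
pose ee i := o * g i - tr (g i).
have Str x : S x -> S (tr x) by move=> Sx; apply: subring_sum => // u _; exact: int_closure_gal.
have See i : S (ee i) by apply: subringB; [|apply: subringM|apply: Str].
have tr_o x : tr (o * x - tr x) = 0.
  rewrite trB; have -> : tr (tr x) = o * tr x.
    by rewrite {1}/tr (eq_bigr (fun _ => tr x)) ?sumr_const ?mulr_natl // => u; exact: tr_fixed.
  by rewrite mulrC tr_scal ?[tr x * o]mulrC ?subrr // => u _; rewrite rmorph_nat.
have proj x : S x -> exists2 w : 'I_n -> F, (forall i, V (w i)) & o * x - tr x = \sum_i (w i)%:A * ee i.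
  move=> /hg [w [Vw ->]]; exists w => //.
  have -> : tr (\sum_i (w i)%:A * g i) = \sum_i (w i)%:A * tr (g i).
    rewrite /tr (eq_bigr (fun u : G => \sum_i u ((w i)%:A * g i))) => [|u _]; last exact: rmorph_sum.
    rewrite exchange_big; apply: eq_bigr => i _.
    by rewrite mulr_sumr; apply: eq_bigr => u _; rewrite rmorphM /= gal_scalar.
  by rewrite mulr_sumr -sumrB; apply: eq_bigr => i _; rewrite /ee; ring.
case: (pselect (exists i, ee i != 0)) => [[i1 hi1]|nex]; last first.
  move=> hs; have Sfix x : S x -> s x = x.
    move=> /proj [w Vw ew].
    have : o * x - tr x = 0.
      rewrite ew big1 // => i _; have -> : ee i = 0; last by rewrite mulr0.
      by apply: contrapT => h; apply: nex; exists i; apply/eqP.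
    move/eqP; rewrite subr_eq0 => /eqP etr; apply: (mulfI o0).
    by rewrite -{1}[o](rmorph_nat s) -rmorphM /= etr tr_fixed.
  apply/eqP/gal_eqP => x _; rewrite gal1E.
  have [t [St Mt]] := hval x; have t0 := max_ideal_neq0 hM Mt.
  have [->|x0] := eqVneq x 0; first by rewrite rmorph0.
  case=> /Sfix; rewrite rmorphM /= Sfix // => /(mulfI t0) //.
  by rewrite fmorphV => /invr_inj.
have [j ej0 hj] : exists2 j, ee j != 0 & forall i, O (ee i / ee j).
  have hOv : valuation_domain O by split=> // y _; exact: loc_total.
  exact: (@valuation_max _ _ hOv _ ee i1).
set x := ee j in ej0 hj.
have Oxv : O (x / v%:A).
  have -> : x / v%:A = (x / pi ^+ k) * (pi ^+ k / v%:A) by field; rewrite vA0 pik.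
  apply: (subringM hO) => //; apply: trace0_divisible; last exact: tr_o.
  by apply: loc_sub => //; exact: See.
have [t0 [St0 Mt0 Stx]] := Oxv.
(* The denominator is made invariant under the wild group, so that multiplying by it preserves trace
   zero. *)
pose t := \prod_(u in WG) u t0.
have St : S t by apply: subring_prod => // u _; exact: int_closure_gal.
have Mt : ~ M t.
  apply: (max_ideal_prod hS hM) => u /wildP [hu _]; split; first exact: int_closure_gal.
  by rewrite (decomp_M _ (inertia_decomp hV hM hu)).
have tfix u : u \in wild -> u t = t.
  move=> hu; rewrite /t rmorph_prod [RHS](reindex_inj (mulIg u)) /=.
  by apply: eq_big => [w|w _]; [rewrite -[RHS]/((w * u)%g \in WG) groupMr | rewrite -gcompE].
have Sy : S (t * (x / v%:A)).
  rewrite /t (bigD1 1%g) ?group1 //= gal1E mulrAC; apply: subringM => //.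
  by apply: subring_prod => // u _; exact: int_closure_gal.
have [w Vw ew] := proj _ Sy.
have try : tr (t * (x / v%:A)) = 0.
  rewrite mulrC tr_scal // tr_scal ?tr_o ?mul0r // => u _.
  by rewrite fmorphV /= gal_scalar.
rewrite try subr0 in ew.
have Oov : O (o * t / v%:A).
  have -> : o * t / v%:A = \sum_i (w i)%:A * (ee i / x).
    rewrite (eq_bigr (fun i => (w i)%:A * ee i / x)) => [|i _]; last by rewrite mulrA.
    by rewrite -mulr_suml -ew; field; rewrite vA0 ej0.
  apply: (subring_sum hO) => i _; apply: (subringM hO) => //.
  by apply: loc_sub => //; exact: int_closure_id.
case: (max_ideal_nM hS hM So St tameW Mt); apply: (mloc_inM hS hM); first exact: subringM.
by rewrite -[o * t](divfK vA0); exact: (idealMl hm).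
Qed.
End Wild.

Section Cocycle.
Variables (f : G -> G -> K) (hf : normalized_cocycle f) (f0 : forall s t, f s t != 0).
Hypothesis fS : forall s t, S (f s t).
Hypothesis fsq : forall s, s \in T -> ~ ideal_sq M (f s s^-1%g).
Variables (e : nat) (hram : ram_index V O e) (hfg : fin_gen_module V S).

(* If [pi = f(s, s^-1)] is a nonunit, it generates the maximal ideal, and
   [prod_(i < q) f(s^i, s) = u pi^j] is fixed by s with 0 < j < q = #[s]. Hence
   (s pi / pi)^j = 1 in the residue field, i.e. s^j is wild. *)
Lemma inertia_cocycle_unit s : s \in T -> ~ M (f s s^-1%g).
Proof.
move=> hs Mpi; pose TG : {group G} := Group (inertia_group_set hV hM).
have hsX i : (s ^+ i)%g \in T by exact: (@groupX _ TG s i hs).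
set pi := f s s^-1%g in Mpi.
have pi0 : pi != 0 by exact: f0.
have hpi x : m x -> O (x / pi) by exact: (mloc_div hS hM hval Mpi (fsq hs)).
have mpi : m pi by exact: mloc_sub.
have OS x : S x -> O x by exact: loc_sub.
pose c i := f (s ^+ i)%g s.
have cdvd i : exists2 y, S y & c i * y = f (s ^+ i)%g (s ^+ i)^-1%g.
  exists ((s ^+ i)%g (f (s ^+ i)^-1%g (gcomp (s ^+ i)%g s))); first exact: int_closure_gal.
  exact: cocycle_dvd.
have csq i : ~ ideal_sq M (c i).
  have [y Sy ey] := cdvd i => h; apply: (fsq (hsX i)); rewrite -ey.
  exact: (ideal_sqMr hI Sy h).
(* Since c i is not in M^2, it is a unit or a unit times pi; [nu i] is its exponent of pi. *)
pose nu i : nat := `[< M (c i) >].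
pose u i := c i / pi ^+ nu i.
have hu i : unit_of O (u i).
  rewrite /u /nu; case: asboolP => hc; rewrite ?expr1 ?expr0 ?divr1.
    split; [by apply: hpi; exact: mloc_sub | by rewrite mulf_neq0 ?invr_eq0 ?f0|].
    by rewrite invf_div; apply: (mloc_div hS hM hval) => //; exact: csq.
  split; [exact: (OS _ (fS _ _)) | exact: f0 | by apply: loc_inv_sub => //; exact: fS].
have ec i : c i = pi ^+ nu i * u i by rewrite /u mulrC divfK // expf_neq0.
have q0 : (0 < #[s]%g)%N by exact: order_gt0.
pose N := \prod_(i < #[s]%g) c i.
pose j := (\sum_(i < #[s]%g) nu i)%N.
pose U := \prod_(i < #[s]%g) u i.
have eN : N = pi ^+ j * U.
  rewrite /N (eq_bigr (fun i : 'I_(#[s]%g) => pi ^+ nu i * u i)) => [|i _]; last exact: ec.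
  by rewrite big_split /= /j expr_sum.
have N0 : N != 0 by apply/prodf_neq0 => i _; exact: f0.
have shift (a : G -> K) : \prod_(i < #[s]%g) a (s ^+ i.+1)%g = \prod_(i < #[s]%g) a (s ^+ i)%g.
  case E : (#[s]%g) q0 => [//|p] _.
  rewrite big_ord_recr [RHS]big_ord_recl /= -E expg_order expg0 mulrC; congr (_ * _).
(* The cocycle identity at (s, s^i, s) multiplied over all i: the products of the f(s, s^i) and of
   the f(s, s^(i+1)) agree and cancel. *)
have sN : s N = N.
  have P0 : \prod_(i < #[s]%g) f s (s ^+ i)%g != 0 by apply/prodf_neq0 => i _; exact: f0.
  apply: (mulIf P0); rewrite -{1}(shift (fun x => f s x)) rmorph_prod -big_split /=.
  rewrite /N -(shift (fun x => f x s)) -big_split /=; apply: eq_bigr => i _.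
  have := cocycleE hf s (s ^+ i)%g s; rewrite /c /gcomp -expgS -expgSr => ->.
  by rewrite mulrC.
have OU : unit_of O U.
  rewrite /U; elim/big_ind: _ => [|x y [Ox x0 Oxi] [Oy y0 Oyi]|i _]; last exact: hu.
    by split; rewrite ?invr1 ?oner_eq0 //; exact: subring1 hO.
  split; [exact: (subringM hO) | by rewrite mulf_neq0 | by rewrite invfM; exact: (subringM hO)].
have [OUu U0 OUi] := OU.
pose z := s pi / pi.
have spi0 : s pi != 0 by rewrite fmorph_eq0.
have Oz : O z by apply: hpi; exact: mlocT.
have mzj : m (z ^+ j - 1).
  have sU0 : s U != 0 by rewrite fmorph_eq0.
  have ez : z ^+ j - 1 = - ((s U - U) * (s U)^-1).
    have : s pi ^+ j * s U = pi ^+ j * U by rewrite -rmorphXn -rmorphM /= -eN sN.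
    move=> h; rewrite /z expr_div_n; have -> : s pi ^+ j = pi ^+ j * U / s U by rewrite -h mulfK.
    have gen (a b c' : K) : a != 0 -> c' != 0 -> a * b / c' / a - 1 = - ((c' - b) * c'^-1).
      by move=> a0 c0; field; rewrite a0 c0.
    by rewrite gen // expf_neq0.
  rewrite ez; apply: (idealN hm); apply: (idealMr hm); last exact: mT.
  by rewrite -fmorphV; exact: OT.
have mzi i : m ((s ^+ i)%g pi / pi - z ^+ i).
  elim: i => [|i IH]; first by rewrite expg0 expr0 gal1E divff // subrr; exact: ideal0 hm.
  have Oi : O ((s ^+ i)%g pi / pi) by apply: hpi; apply: mlocT.
  have -> : (s ^+ i.+1)%g pi / pi - z ^+ i.+1 =
     (s ((s ^+ i)%g pi / pi) - (s ^+ i)%g pi / pi) * z + ((s ^+ i)%g pi / pi - z ^+ i) * z.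
    rewrite expgSr -[(s ^+ i * s)%g]/(gcomp s (s ^+ i)%g) gcompE exprSr -mulrDl addrA subrK mulrBl.
    congr (_ - _); rewrite /z rmorphM fmorphV /=; field.
    by rewrite spi0 pi0.
  apply: (idealD hm); apply: (idealMr hm) => //; exact: mT.
have wj : (s ^+ j)%g \in wild pi.
  rewrite inE hsX; apply/asboolP.
  have -> : (s ^+ j)%g pi / pi - 1 = ((s ^+ j)%g pi / pi - z ^+ j) + (z ^+ j - 1).
    by rewrite addrA subrK.
  exact: (idealD hm).
have sj := wild_trivial hram hfg mpi pi0 hpi wj.
have dj : (#[s]%g %| j)%N by rewrite order_dvdn sj eqxx.
(* The two end terms give 0 < j < q: f(1, s) = 1 contributes nothing, while f(s^-1, s) is conjugate
   to pi and contributes 1. *)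
have nu0 : nu 0%N = 0%N.
  by rewrite /nu /c expg0 (cocycle1l hf) asboolF // => /(max_ideal1 hM).
have s1 : (1 < #[s]%g)%N.
  rewrite ltn_neqAle q0 andbT eq_sym order_eq1; apply/eqP => s1.
  by apply: (max_ideal1 hM); rewrite /pi s1 (cocycle1l hf) in Mpi.
have nuq : nu #[s]%g.-1 = 1%N.
  rewrite /nu /c; have -> : (s ^+ (#[s]%g).-1 = s^-1)%g.
    by apply: (mulIg s); rewrite -expgSr prednK // expg_order mulVg.
  rewrite asboolT // -(decomp_M _ (inertia_decomp hV hM hs)).
  by rewrite (cocycleV hf).
have nu1 i : (nu i <= 1)%N by rewrite /nu; case: asbool.
have j0 : (0 < j)%N.
  have lq : (#[s]%g.-1 < #[s]%g)%N by rewrite prednK.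
  by rewrite /j (bigD1 (Ordinal lq)) //= nuq.
have jq : (j < #[s]%g)%N.
  rewrite /j (bigD1 (Ordinal q0)) //= nu0 add0n.
  apply: (@leq_ltn_trans (\sum_(i < #[s]%g | i != Ordinal q0) 1)%N).
    by apply: leq_sum => i _; exact: nu1.
  rewrite sum1_card cardC1 card_ord ltn_predL //.
by move: (dvdn_leq j0 dj); rewrite leqNgt jq.
Qed.
End Cocycle.
End Tame.

(** * Squares of maximal ideals and products of cocycle values *)

Lemma ideal_sq_sub (R : fieldType) (C I : R -> Prop) x : ideal C I -> ideal_sq I x -> I x.
Proof.
move=> hI [n [a [b [Ia [Ib ->]]]]]; apply: (ideal_sum hI) => i _.
by apply: (idealMl hI) => //; exact: (ideal_sub hI).
Qed.

Lemma ideal_sq_incl (R : fieldType) (I J : R -> Prop) x :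
  (forall y, I y -> J y) -> ideal_sq I x -> ideal_sq J x.
Proof. by move=> h [n [a [b [Ia [Ib e]]]]]; exists n, a, b; split=> [i|]; [exact: h | split=> // i; exact: h]. Qed.

(** The square of a maximal ideal is primary: x is in M by primality, and x = (x y) z - x (y z - 1)
    for z inverse to y modulo M. *)
Lemma ideal_sq_cancel (R : fieldType) (C M : R -> Prop) x y : subring C -> max_ideal C M ->
  C x -> C y -> ~ M y -> ideal_sq M (x * y) -> ideal_sq M x.
Proof.
move=> hC hM Cx Cy nMy h; have hI := max_ideal_ideal hM.
have [Mx|//] := max_ideal_prime hC hM Cx Cy (ideal_sq_sub hI h).
have [z Cz Mz] := max_ideal_inv hC hM Cy nMy.
have [n [a [b [Ma [Mb e]]]]] := h.
exists n.+1, (fun i => if unlift ord0 i is Some j then a j else x),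
  (fun i => if unlift ord0 i is Some j then b j * z else - (y * z - 1)); split; last split.
- by move=> i; case: (unlift ord0 i).
- move=> i; case: (unlift ord0 i) => [j|]; [exact: (idealMr hI) | exact: (idealN hI)].
- rewrite big_ord_recl unlift_none; under eq_bigr do rewrite liftK mulrA.
  by rewrite -mulr_suml -e; ring.
Qed.

Section CocycleProduct.
Variables (F : fieldType) (K : splittingFieldType F).
Local Notation G := (gal_of {:K}).
Variables (f : G -> G -> K) (hf : normalized_cocycle f).
(** With g_s = f(s, s^-1), this makes g_(su) a divisor of s(g_u) g_s: if both factors avoid M so
    does g_(su), and if g_(su) is in M^2 so is the product. *)
Lemma cocycle_compV (s u : G) : s (f u u^-1%g) * f s s^-1%g =
  f s u * gcomp s u (f u^-1%g s^-1%g) * f (gcomp s u) (gcomp s u)^-1%g.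
Proof.
have := cocycleE hf s u u^-1%g; rewrite gcompVr (cocycle1r hf) mulr1 => ->.
have := cocycleE hf (gcomp s u) u^-1%g s^-1%g; rewrite gcompKV.
have -> : gcomp u^-1%g s^-1%g = (gcomp s u)^-1%g by rewrite /gcomp invMg.
by rewrite -!mulrA => ->.
Qed.
End CocycleProduct.

(** * An element with unit trace at every maximal ideal *)

Section Main.
Variables (F : fieldType) (K : splittingFieldType F) (V : F -> Prop).
Hypotheses (hV : valuation_domain V) (hgal : galois 1%VS {:K}).
Local Notation G := (gal_of {:K}).
Local Notation S := (integral_over (@inK F K V)).
Let hS : subring S := int_closure_subring K hV.
Variables (f : G -> G -> K) (hf : normalized_cocycle f) (f0 : forall s t, f s t != 0).
Hypothesis fS : forall s t, S (f s t).

Section Trace.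
Variables (r : nat) (Ms : 'I_r -> K -> Prop).
Hypothesis hMs : forall i, max_ideal S (Ms i).
Hypothesis Ms_inj : forall i j, (forall x, Ms i x <-> Ms j x) -> i = j.
Hypothesis Ms_all : forall M, max_ideal S M -> exists i, forall x, M x <-> Ms i x.
Hypothesis tame : forall M, max_ideal S M -> ~ M #|inertia V M|%:R.
Hypothesis unram : forall M s, max_ideal S M -> s \in inertia V M -> ~ M (f s s^-1%g).

(** The summation set contains the whole inertia group, by [unram]. If the sum vanished modulo M for
    all x, independence of characters would give |T| = 0 in the residue field, against tameness. *)
Lemma decomp_trace M : max_ideal S M ->
  exists2 x, S x & ~ M (\sum_(s in decomp M | ~~ `[< M (f s s^-1%g) >]) s x).
Proof.
move=> hM; have hO := loc_subring hS hM; have hm := mloc_ideal hS hM.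
have [L [phi [phi1 phiD phiM phis phi0]]] := residue_field hO (max_ideal_loc hS hM).
have phie := phi_eq hV hM phiD phi0.
pose A := [set s in decomp M | ~~ `[< M (f s s^-1%g) >]].
have AD s : s \in A -> s \in decomp M by rewrite inE => /andP [].
have A1 : 1%g \in A.
  rewrite inE; apply/andP; split; first by apply/decompP; exact: conj_pred1.
  by apply/asboolP; rewrite (cocycle1l hf); exact: max_ideal1 hM.
apply: contrapT => nex.
have h x : loc_at S M S x -> \sum_(s in A) 1 * phi (s x) = 0.
  move=> [t [St Mt Stx]].
  have [u Su Mu] := max_ideal_inv hS hM St Mt.
  pose x' := u * (t * x).
  have Sx' : S x' by exact: subringM.
  have Ox : loc_at S M S x by exists t.
  have Ox' : loc_at S M S x' by exact: loc_sub.
  have mx : loc_at S M M (x - x').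
    have -> : x - x' = - ((t * u - 1) * x) by rewrite /x'; ring.
    by apply: (idealN hm); apply: (idealMr hm) => //; exact: mloc_sub.
  transitivity (phi (\sum_(s in A) s x')).
    rewrite (pmorph_sum hO phiD) => [|s hs]; last by apply: decomp_loc => //; exact: AD.
    apply: eq_bigr => s hs; rewrite mul1r; apply/phie; try by apply: decomp_loc => //; exact: AD.
    by rewrite -rmorphB; apply: decomp_mloc => //; exact: AD.
  apply/phi0; first by apply: loc_sub => //; apply: subring_sum => // s _; exact: int_closure_gal.
  apply: mloc_sub => //; apply: contrapT => nM; apply: nex; exists x' => //; move: nM.
  by under eq_bigl do rewrite inE.
have := dedekind_independence hO _ _ h A1.
have -> : \sum_(i in A | `[< forall x, loc_at S M S x -> phi (i x) = phi ((1%g : G) x) >]) (1 : L) =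
   #|inertia V M|%:R.
  rewrite -sumr_const; apply: eq_bigl => s; rewrite [in LHS]inE.
  apply/andP/idP => [[/andP [hs _] /asboolP e]|hs].
    apply/inertiaP => x Ox; apply/phie => //; first exact: decomp_loc.
    by rewrite e // gal1E.
  have hD := inertia_decomp hV hM hs.
  split; first by rewrite hD; apply/asboolP; exact: unram.
  apply/asboolP => x Ox; rewrite gal1E; apply/phie => //; first exact: decomp_loc.
  exact: (inertiaP _ _ _ hs).
move=> e; apply: (tame hM).
have Sn : S #|inertia V M|%:R by exact: subring_nat.
apply: (mloc_inM hS hM) => //; apply/phi0; first exact: loc_sub.
rewrite (pmorph_nat hO phi1 phiD); apply: e.
- by move=> s hs; rewrite rmorph1.
- by move=> s x y /AD hs Ox Oy; rewrite rmorphM phiM //; exact: decomp_loc.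
Qed.

(* Two maximal ideals N and s N are linked when f(s, s^-1) is a unit at s N; t is supported
   on one representative of each linkage class. *)
Lemma exists_trace_unit : exists2 t, S t & forall M, max_ideal S M ->
  ~ M (\sum_(s in [set: G] | ~~ `[< M (f s s^-1%g) >]) s t).
Proof.
pose E i j := exists s : G, Ms i = conj_pred s (Ms j) /\ ~ Ms i (f s s^-1%g).
have hcj i s := conj_max_int_closure s (hMs i).
have Erefl i : E i i.
  exists 1%g; rewrite conj_pred1 (cocycle1l hf); split=> //; exact: max_ideal1 (hMs i).
have Esym i j : E i j -> E j i.
  move=> [s [e h]]; exists s^-1%g; rewrite e conj_predVK; split=> //.
  by move=> h'; apply: h; rewrite e -[f s _](galKV s) conj_predE (cocycleV' hf); rewrite invgK in h'.
have compN i (s u : G) : ~ Ms i (f s s^-1%g) -> ~ conj_pred s^-1%g (Ms i) (f u u^-1%g) ->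
    ~ Ms i (f (gcomp s u) (gcomp s u)^-1%g).
  move=> h1 h2 h3; have := cocycle_compV hf s u => e.
  have : Ms i (s (f u u^-1%g) * f s s^-1%g).
    rewrite e; apply: (idealMl (max_ideal_ideal (hMs i))) => //.
    by apply: subringM => //; exact: int_closure_gal.
  case/(max_ideal_prime hS (hMs i)) => //; first exact: int_closure_gal.
  by move=> h4; apply: h2; rewrite /conj_pred invgK.
have Etrans i j k : E i j -> E j k -> E i k.
  move=> [s [e h]] [u [e' h']]; exists (gcomp s u); rewrite conj_pred_comp -e'; split=> //.
  by apply: compN => //; rewrite e conj_predVK.
(* A canonical index in the linkage class of i; the default is never taken, since i is linked to
   itself. *)
pose rep i := odflt i [pick j | `[< E i j >]].
have repE i : E i (rep i).
  by rewrite /rep; case: pickP => [j /asboolP //|/(_ i)]; rewrite asboolT.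
have rep_eq i j : E i j -> rep i = rep j.
  move=> ij; rewrite /rep.
  have e : (fun k => `[< E i k >]) =1 (fun k => `[< E j k >]).
    move=> k; apply/asbool_equiv_eq; split=> h; [exact: Etrans (Esym _ _ ij) h | exact: Etrans ij h].
  rewrite (eq_pick e); case: pickP => // /(_ j); rewrite asboolT //.
have /choice [x hx] : forall i, exists x, S x /\
    ~ Ms i (\sum_(s in decomp (Ms i) | ~~ `[< Ms i (f s s^-1%g) >]) s x).
  by move=> i; have [x Sx hx] := decomp_trace (hMs i); exists x.
have [|t St ht] := chinese hS hMs Ms_inj (z := fun i => if rep i == i then x i else 0).
  by move=> i; case: eqP => _; [case: (hx i) | exact: subring0].
exists t => // M hM hsum; have [i0 hi0] := Ms_all hM.
have eM : M = Ms i0 by apply: funext => y; apply: propext.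
rewrite {M hM hi0}eM in hsum.
pose j := rep i0; have [rho [erho hrho]] := repE i0; rewrite -/j in erho hrho.
have repj : rep j = j by rewrite -(rep_eq _ _ (repE i0)).
have hI := max_ideal_ideal (hMs i0).
have hIj := max_ideal_ideal (hMs j).
pose Z := \sum_(s in decomp (Ms j) | ~~ `[< Ms j (f s s^-1%g) >]) s (x j).
have nZ : ~ Ms i0 (rho Z) by rewrite erho conj_predE; case: (hx j).
apply: nZ.
have iff_unit (u : G) : u \in decomp (Ms j) ->
    Ms i0 (f (gcomp rho u) (gcomp rho u)^-1%g) <-> Ms j (f u u^-1%g).
  move=> /decompP hu; split=> h; apply: contrapT => h'.
    by apply: (compN i0 rho u) => //; rewrite erho conj_predVK.
  have hV' : ~ Ms j (f rho^-1%g rho^-1%g^-1%g).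
    by rewrite invgK => h2; apply: hrho; rewrite erho -(cocycleV hf) conj_predE.
  have := @compN j rho^-1%g (gcomp rho u) hV'; rewrite gcompVK invgK -erho; apply=> //.
(* The s with rho^-1 s in the decomposition group of the representative j sum to rho(Z). For the
   other s, the ideal s^-1(Ms i0) is linked to i0 but is not a representative, so t lies in it and
   s(t) in Ms i0. *)
have : Ms i0 (\sum_(s in [set: G] | ~~ `[< Ms i0 (f s s^-1%g) >]) s t - rho Z).
  rewrite (bigID (fun s => gcomp rho^-1%g s \in decomp (Ms j))) /= addrAC.
  apply: (idealD hI); last first.
    apply: (ideal_sum hI) => s /andP [/andP [_ /asboolP hs] ns].
    have [k hk] := Ms_all (hcj i0 s^-1%g).
    have ek : conj_pred s^-1%g (Ms i0) = Ms k by apply: funext => y; apply: propext.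
    have ik : E i0 k by exists s; rewrite -ek conj_predKV.
    have rk : rep k != k.
      apply: contra ns => /eqP rk; apply/decompP.
      have ekj : k = j by rewrite -rk -(rep_eq _ _ ik).
      have e1 : conj_pred s (Ms j) = Ms i0 by rewrite -ekj -ek conj_predKV.
      by rewrite conj_pred_comp e1 erho conj_predVK.
    have := ht k; rewrite (negPf rk) subr0 -ek /conj_pred invgK //.
  rewrite (reindex_inj (h := fun u => gcomp rho u)) /=; last first.
    by move=> a b e; rewrite -[a](gcompVK rho) e gcompVK.
  rewrite /Z rmorph_sum.
  rewrite (eq_bigl (fun s => (s \in decomp (Ms j)) && ~~ `[< Ms j (f s s^-1%g) >])); last first.
    move=> u; rewrite inE /= gcompVK; case: (boolP (u \in decomp (Ms j))) => hu; rewrite ?andbF ?andbT //=.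
    by congr (~~ _); apply/asbool_equiv_eq; exact: iff_unit.
  rewrite -sumrB; apply: (ideal_sum hI) => u /andP [/decompP hu _].
  rewrite gcompE -rmorphB -rmorphB erho conj_predE -hu conj_predE.
  by have := ht j; rewrite repj eqxx.
by move=> h; exact: (idealBl hI h hsum).
Qed.
End Trace.
End Main.

(** As [gcomp] reverses the group law, right cosets for composition are the library's left
    cosets. *)
Lemma exists_right_coset_reps (F : fieldType) (K : splittingFieldType F)
    (H : {group gal_of {:K}}) : exists r, right_coset_reps (fun s => s \in H) r.
Proof.
pose G := [set: gal_of {:K}].
pose cs := enum (lcosets H G).
exists [seq repr A | A <- cs] => g.
have hA : (g *: H)%g \in cs by rewrite mem_enum; apply/lcosetsP; exists g; rewrite ?inE.
have lcE A : A \in cs -> (repr A *: H)%g = A.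
  by rewrite mem_enum => /lcosetsP [x _ ->]; apply/lcoset_eqP; apply: (mem_repr x); exact: lcoset_refl.
exists (index (g *: H)%g cs); rewrite size_map index_mem hA; split=> //.
have hE x : (gcomp g x^-1%g \in H) = (g \in x *: H)%g by rewrite mem_lcoset.
rewrite hE (nth_map set0) ?index_mem // nth_index //; split; first by rewrite lcE // lcoset_refl.
move=> j hj; rewrite hE (nth_map set0) // lcE ?mem_nth // => hg.
have : (nth set0 cs j) \in cs by exact: mem_nth.
rewrite mem_enum => /lcosetsP [x _ ex]; rewrite ex in hg.
by rewrite (lcoset_eqP hg) -ex index_uniq // enum_uniq.
Qed.

(** * Equivalence of the three conditions *)

Section Main.
Variables (F : fieldType) (K : splittingFieldType F) (V : F -> Prop).
Hypotheses (hV : valuation_domain V) (hgal : galois 1%VS {:K}).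
Local Notation G := (gal_of {:K}).
Local Notation S := (integral_over (@inK F K V)).
Let hS : subring S := int_closure_subring K hV.

(** The valuation ring S_M is integrally closed and contains U. Conversely x in S_M is a root of the
    product of the X - s(x) over s in G^T, whose coefficients are fixed by G^T. *)
Lemma TM_localize M : max_ideal S M -> TM S M = loc_at S M S.
Proof.
move=> hM; have hO := loc_subring hS hM.
have hTG := inertia_group_set hV hM.
apply: funext => x; apply: propext; split=> [[p [pm pU px]]|Ox].
  have Ip : integral_over (loc_at S M S) x.
    by exists p; split=> // i; have [] := pU i; rewrite (localizeE hM).
  case: (loc_total hS hM (fun y => integral_closure_valuation hV y hM) x) => // Oxi.
  exact: (integral_over_inv hO Ip Oxi).
pose P : {poly K} := \prod_(s in inertia V M) ('X - (s x)%:P).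
exists P; split.
- exact: monic_prod_XsubC.
- move=> i; split; first rewrite (localizeE hM).
    rewrite /P; elim/big_ind: _ i => [i|p q|s hs i].
    + by rewrite coef1; case: eqP => _; [exact: subring1 | exact: subring0].
    + exact: poly_overM.
    + by apply: poly_overXsubC => //; exact: inertia_loc.
  move=> s /(GT_inertia hV hM) hs; rewrite -coef_map.
  suff -> : map_poly s P = P by [].
  rewrite rmorph_prod [RHS](reindex_inj (mulIg s)) /=.
  apply: eq_big => [u|u _].
    by rewrite -[RHS]/((u * s)%g \in Group hTG) groupMr.
  by rewrite rmorphB /= map_polyX map_polyC /= -gcompE.
- rewrite /root /P (bigD1 1%g) /=; last by rewrite -[inertia V M]/(gval (Group hTG)) group1.
  by rewrite hornerM hornerXsubC gal1E subrr mul0r.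
Qed.

Lemma GT_inertiaE M : max_ideal S M -> GT S M = (fun s => s \in inertia V M).
Proof. by move=> hM; apply: funext => s; apply/propext/(GT_inertia hV hM). Qed.

Variables (f : G -> G -> K) (hf : normalized_cocycle f) (f0 : forall s t, f s t != 0).
Hypothesis fS : forall s t, S (f s t).
Let hval M x : max_ideal S M -> exists t, [/\ S t, ~ M t & S (t * x) \/ S (t * x^-1)].
Proof. by move=> hM; exact: (integral_closure_valuation hV x hM). Qed.

Section Local.
Variables (M : K -> Prop) (hM : max_ideal S M).
Local Notation O := (loc_at S M S).
Local Notation m := (loc_at S M M).
Let hO : subring O := loc_subring hS hM.
Let hI := max_ideal_ideal hM.
Let TG : {group G} := Group (inertia_group_set hV hM).

Let loc_max_uniq N : max_ideal O N -> forall x, N x <-> m x.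
Proof.
move=> hN x; have [hm m1 hmax] := max_ideal_loc hS hM.
have Nm y : N y -> m y.
  move=> Ny; apply: contrapT => nm.
  have [y0 Oyi] := loc_inv hM (ideal_sub (max_ideal_ideal hN) Ny) nm.
  by apply: (max_ideal1 hN); rewrite -(mulVf y0); exact: (idealMl (max_ideal_ideal hN)).
case: hN => hNi N1 hNmax; case: (hNmax m hm Nm) => [e|]; last by move/m1.
by rewrite e.
Qed.
Let hvalO N x : max_ideal O N -> exists t, [/\ O t, ~ N t & O (t * x) \/ O (t * x^-1)].
Proof.
move=> hN; exists 1; rewrite !mul1r; split; [exact: subring1 | exact: max_ideal1 hN|].
exact: (loc_total hS hM (fun y => hval y hM)).
Qed.

(** The sufficiency theorem over the local ring with t = 1: all values f(s, s^-1) are units, so the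
    trace is |G^T|. *)
Lemma local_crossed_semihereditary : ~ M #|inertia V M|%:R ->
  (forall s, s \in inertia V M -> ~ M (f s s^-1%g)) ->
  semihereditary (cp_set (TM S M) (GT S M)) (cp_mul f).
Proof.
move=> tame unram; rewrite (TM_localize hM) (GT_inertiaE hM).
have nN N s : max_ideal O N -> s \in TG -> ~ N (f s s^-1%g).
  by move=> hN hs /(loc_max_uniq hN) /(mloc_inM hS hM (fS _ _)); exact: unram.
apply: (@semihereditary_crossed_product _ _ f hf f0 O hO 1 (fun _ => m) _ _ _ hvalO TG _ _ _ 1).
- by move=> _; exact: max_ideal_loc.
- by move=> i j _; rewrite !ord1.
- by move=> N hN; exists ord0; exact: (loc_max_uniq hN).
- by move=> s x; exact: inertia_loc.
- by move=> s t _ _; exact: loc_sub.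
- by move=> N s hN hs h; apply: (nN N s hN hs); exact: (ideal_sq_sub (max_ideal_ideal hN)).
- exact: subring1.
- move=> N hN; under eq_bigr do rewrite rmorph1.
  rewrite (eq_bigl (fun s => s \in TG)) => [|s].
    rewrite sumr_const => /(loc_max_uniq hN) /(mloc_inM hS hM) h; apply: tame; apply: h.
    exact: subring_nat.
  by case: (boolP (s \in TG)) => //= hs; rewrite asboolF //; exact: nN.
Qed.

Lemma local_semihereditary_nideal_sq : semihereditary (cp_set (TM S M) (GT S M)) (cp_mul f) ->
  forall s, s \in inertia V M -> ~ ideal_sq M (f s s^-1%g).
Proof.
rewrite (TM_localize hM) (GT_inertiaE hM) => hA s hs h.
have hm := max_ideal_loc hS hM.
apply: (@semihereditary_nideal_sq _ _ f hf f0 O m hO hm (fun x => hvalO x hm) TG _ _ s hA hs).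
- by move=> u x; exact: inertia_loc.
- by move=> u t _ _; exact: loc_sub.
- by apply: ideal_sq_incl h => y; exact: mloc_sub.
Qed.

(** Write s = t u with t in G^T and u a representative. By [cocycle_compV], g_s in M^2 would put
    t(g_u) g_t in M^2; here g_t is a unit at M and t preserves M, so g_u would be in M^2. *)
Lemma nideal_sq_of_reps : (forall s, s \in inertia V M -> ~ M (f s s^-1%g)) ->
  (exists r, right_coset_reps (GT S M) r /\
     forall i, (i < size r)%N -> ~ ideal_sq M (f (nth 1%g r i) (nth 1%g r i)^-1%g)) ->
  forall s, ~ ideal_sq M (f s s^-1%g).
Proof.
move=> unram [r [hr hsq]] s hs; have [i [hi [ht _]]] := hr s.
set u := nth 1%g r i in ht; set t := gcomp s u^-1%g in ht.
have es : s = gcomp t u by rewrite gcompK.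
apply: (hsq i hi); rewrite -/u.
have tT : t \in inertia V M by apply/(GT_inertia hV hM).
have tD := inertia_decomp hV hM tT.
have h1 : ideal_sq M (t (f u u^-1%g) * f t t^-1%g).
  rewrite (cocycle_compV hf) -es mulrC; apply: (ideal_sqMr hI) => //.
  by apply: (subringM hS) => //; exact: int_closure_gal.
have h2 := ideal_sq_cancel hS hM (int_closure_gal _ (fS _ _)) (fS _ _) (unram _ tT) h1.
have := conj_pred_sq t^-1%g h2; rewrite galVK.
by move/decompP: tD => {1}<-; rewrite conj_predVK.
Qed.
End Local.

Section Global.
Variables (r : nat) (Ms : 'I_r -> K -> Prop).
Hypothesis hMs : forall i, max_ideal S (Ms i).
Hypothesis Ms_inj : forall i j, (forall x, Ms i x <-> Ms j x) -> i = j.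
Hypothesis Ms_all : forall M, max_ideal S M -> exists i, forall x, M x <-> Ms i x.
Hypothesis tame : forall M, max_ideal S M -> ~ M #|inertia V M|%:R.
Hypothesis unram : forall M, max_ideal S M ->
  (forall s, s \in inertia V M -> ~ ideal_sq M (f s s^-1%g)) ->
  forall s, s \in inertia V M -> ~ M (f s s^-1%g).

Let full : (fun _ : G => True) = (fun s => s \in [set: G]%G).
Proof. by apply: funext => s; apply: propext; rewrite inE. Qed.

Lemma crossed_semihereditaryE :
  semihereditary (cp_set S (fun _ => True)) (cp_mul f) <->
  forall M s, max_ideal S M -> ~ ideal_sq M (f s s^-1%g).
Proof.
rewrite full; split=> [hA M s hM|hsq].
  apply: (@semihereditary_nideal_sq _ _ f hf f0 S M hS hM (fun x => hval x hM) [set: G]%G _ _ s hA).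
  - by move=> u x _; exact: int_closure_gal.
  - by move=> u t _ _; exact: fS.
  - by rewrite inE.
have [M s hM hs|t St ht] := exists_trace_unit hV hf fS hMs Ms_inj Ms_all tame.
  by apply: unram => // u _; exact: hsq.
apply: (@semihereditary_crossed_product _ _ f hf f0 S hS r Ms hMs Ms_inj Ms_all
  (fun M x hM => hval x hM) [set: G]%G _ _ _ t) => //.
- by move=> s x _; exact: int_closure_gal.
- by move=> M s hM _; exact: hsq.
Qed.

(** Common scheme for conditions (2) and (3), with [P] the requirement on G^T. The gap between what
    [P] implies and what implies it is closed by [unram]. *)
Lemma nideal_sqE (P : (K -> Prop) -> Prop) :
  (forall M, max_ideal S M -> P M -> forall s, s \in inertia V M -> ~ ideal_sq M (f s s^-1%g)) ->
  (forall M, max_ideal S M -> (forall s, s \in inertia V M -> ~ M (f s s^-1%g)) -> P M) ->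
  (forall M s, max_ideal S M -> ~ ideal_sq M (f s s^-1%g)) <->
  (forall M, max_ideal S M -> P M /\ exists l, right_coset_reps (GT S M) l /\
     forall i, (i < size l)%N -> ~ ideal_sq M (f (nth 1%g l i) (nth 1%g l i)^-1%g)).
Proof.
move=> P1 P2; split=> [hsq M hM|h M s hM].
  split; first by apply: P2 => //; apply: unram => // s _; exact: hsq.
  have [l hl] := exists_right_coset_reps (Group (inertia_group_set hV hM)).
  by exists l; rewrite (GT_inertiaE hM); split=> // i _; exact: hsq.
have [PM hl] := h M hM.
exact: (nideal_sq_of_reps hM (unram hM (P1 M hM PM)) hl).
Qed.
End Global.
End Main.

Theorem theorem3p14 (F : fieldType) (K : splittingFieldType F)
  (V : F -> Prop) (f : gal_of {:K} -> gal_of {:K} -> K) :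
  valuation_domain V ->
  galois 1%VS {:K} ->
  (let S := integral_over (inK V) in
   tame_defectless V S ->
   fin_gen_module V S ->
   (forall s t, S (f s t) /\ f s t != 0) ->
   normalized_cocycle f ->
   let Af_semi := semihereditary (cp_set S (fun _ => True)) (cp_mul f) in
   let cond2 := forall M, max_ideal S M ->
      (forall s, GT S M s -> HM S M f s) /\
      exists r, right_coset_reps (GT S M) r /\
        forall i, (i < size r)%N -> ~ ideal_sq M (f (nth 1%g r i) (nth 1%g r i)^-1%g) in
   let cond3 := forall M, max_ideal S M ->
      semihereditary (cp_set (TM S M) (GT S M)) (cp_mul f) /\
      exists r, right_coset_reps (GT S M) r /\
        forall i, (i < size r)%N -> ~ ideal_sq M (f (nth 1%g r i) (nth 1%g r i)^-1%g) in
   (Af_semi <-> cond2) /\ (cond2 <-> cond3)).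
Proof.
move=> hV hgal S [r [[Ms [hMs Ms_inj Ms_all]] htame]] hfg hfS hf Af_semi cond2 cond3.
have hS : subring S := int_closure_subring K hV.
have fS s t : S (f s t) by case: (hfS s t).
have f0 s t : f s t != 0 by case: (hfS s t).
have tame M : max_ideal S M -> ~ M #|inertia V M|%:R.
  move=> hM; have [e [d []]] := htame M hM; rewrite (localizeE hM) => _ hd hdim he hsep.
  exact: (inertia_tame hV hgal hM hMs Ms_inj Ms_all hd hdim he hsep).
have unram M : max_ideal S M ->
  (forall s, s \in inertia V M -> ~ ideal_sq M (f s s^-1%g)) ->
  forall s, s \in inertia V M -> ~ M (f s s^-1%g).
  move=> hM hsq; have [e [d []]] := htame M hM; rewrite (localizeE hM) => hram _ _ _ _.
  exact: (inertia_cocycle_unit hV hM (tame M hM) hf f0 fS hsq hram hfg).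
have e1 := crossed_semihereditaryE hV hf f0 fS hMs Ms_inj Ms_all tame unram.
have e2 : (forall M s, max_ideal S M -> ~ ideal_sq M (f s s^-1%g)) <-> cond2.
  apply: (nideal_sqE hV hf fS unram) => M hM.
    move=> h s /(GT_inertia hV hM) /h [_ nM] hsq; apply: nM.
    exact: (ideal_sq_sub (max_ideal_ideal hM)).
  move=> h s hs; have hs' := hs; move/(GT_inertia hV hM): hs' => hs'; split; last exact: h.
  by move=> x; rewrite (localizeE hM); exact: inertia_loc.
have e3 : (forall M s, max_ideal S M -> ~ ideal_sq M (f s s^-1%g)) <-> cond3.
  apply: (nideal_sqE hV hf fS unram) => M hM.
    exact: (local_semihereditary_nideal_sq hV hf f0 fS hM).
  by apply: (local_crossed_semihereditary hV hf f0 fS hM); exact: tame.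
by split; [rewrite /Af_semi e1 | rewrite -e2].
Qed.
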